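(* Consider the periodic initial boundary value problem $$u_{xt}+uu_{xx}-\lambda u_x^2=I(t),\quad u(x,0)=u_0(x),\quad I(t)=-(\lambda+1)\int_0^1u_x^2\,dx,\quad u(0,t)=u(1,t),\ u_x(0,t)=u_x(1,t),$$ for $x\in[0,1]$, $t>0$, where, for some $q>0$ and $C_1<0$, $u_0'(\alpha)\sim M_0+C_1|\alpha-\overline\alpha_i|^q$ near every $\overline\alpha_i$. Let $t_*\in(0,+\infty]$ be the maximal time defined in the context. Then: 1. For $q>0$ and $\lambda\in[0,q/2]$, $\lim_{t\to+\infty}\|u_x\|_p<+\infty$ for all $p\ge1$. More particularly, $\lim_{t\to+\infty}\|u_x\|_p=0$ for $\lambda\in(0,q/2)$, while, as $t\to+\infty$, $u_x$ converges to a nontrivial $L^\infty$ function when $\lambda=q/2$. 2. Let $p>1$. For all $q>0$ and $\lambda\in(q/2,q)$, $t_*$ is finite and $\lim_{t\uparrow t_*}\|u_x\|_p=+\infty$. The same holds for $\lambda>q>1$, and for $\frac12<\lambda<\frac{q}{1-q}$ with $q\in(1/3,1/2)$. 3. For all $q\in(0,1/2)$, $p\in[1,2)$ and $\lambda>\frac{1}{2-p}$, with $q\ne\frac1n$, $\lambda\neq\frac{q}{1-nq}$ and $\lambda\ne\frac{q}{1+q(n-p)}$ for all $n\in\mathbb{N}$, $t_*$ is finite and $\lim_{t\uparrow t_*}\|u_x\|_p<+\infty$. 4. Suppose $q\in(1/2,1)$. If $q<\lambda<\frac{q}{1-q}$ and $p>1$, then $t_*$ is finite and $\lim_{t\uparrow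 t_*}\|u_x\|_p=+\infty$, whereas if $p\in[1,1/q)$ and $\lambda>\frac{q}{1-pq}$, then $t_*$ is finite and $\lim_{t\uparrow t_*}\|u_x\|_p<+\infty$.
   Context: $\mathbb{N}=\{1,2,\dots\}$. Standing assumptions on the data: $u_0$ is periodic, $u_0'$ is bounded and at least continuous a.e. on $(0,1)$ (so $\int_0^1u_0'=0$); $M_0>0$ is the greatest value of $u_0'$, attained at finitely many points $\overline\alpha_i\in[0,1]$ (and $u_0'$ is bounded away from $M_0$ off any neighbourhood of these points). Neighbourhoods are periodic. $u_0'(\alpha)\sim M_0+C_1|\alpha-\overline\alpha_i|^q$ near $\overline\alpha_i$ means $M_0-u_0'(\alpha)$ is asymptotically equivalent (ratio $\to1$) to $|C_1||\alpha-\overline\alpha_i|^q$ as $\alpha\to\overline\alpha_i$. Solutions are understood along characteristics $\gamma$, $\dot\gamma(\alpha,t)=u(\gamma(\alpha,t),t)$, $\gamma(\alpha,0)=\alpha$. For $\lambda>0$ put $\mathcal{J}(\alpha,t)=1-\lambda\eta(t)u_0'(\alpha)$, $\bar{\mathcal{K}}_i(t)=\int_0^1\mathcal{J}(\alpha,t)^{-i-1/\lambda}d\alpha$, where $\dot\eta=\bar{\mathcal{K}}_0^{-2\lambda}$, $\eta(0)=0$. The solution is given by $$\gamma_\alpha=\frac{\mathcal{J}(\alpha,t)^{-1/\lambda}}{\bar{\mathcal{K}}_0(t)},\qquad u_x(\gamma(\alpha,t),t)=\frac{1}{\lambda\eta(t)\bar{\mathcal{K}}_0(t)^{2\lambda}}\left(\frac{1}{\mathcal{J}(\alpha,t)}-\frac{\bar{\mathcal{K}}_1(t)}{\bar{\mathcal{K}}_0(t)}\right)$$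 (with value $u_0'(\alpha)$ at $t=0$) as long as $\eta(t)<\eta_*=\frac1{\lambda M_0}$, and is defined for $t\in[0,t_* )$ with $$t_*=\lim_{\eta\uparrow\eta_*}\int_0^\eta\left(\int_0^1(1-\lambda\mu u_0'(\alpha))^{-1/\lambda}d\alpha\right)^{2\lambda}d\mu\in(0,+\infty].$$ When $\lambda\in(0,q/2]$, $t_*=+\infty$; in the finite cases $t_*$ is the $L^\infty$ blow-up time of $u_x$. For $\lambda=0$ the corresponding solution, defined for all $t\ge0$, is $\gamma_\alpha=e^{tu_0'(\alpha)}/\int_0^1e^{tu_0'}$, $u_x(\gamma(\alpha,t),t)=u_0'(\alpha)-\int_0^1u_0'e^{tu_0'}/\int_0^1e^{tu_0'}$. $\|\cdot\|_p$ is the norm of $L^p(0,1)$ in $x$, so $\|u_x(\cdot,t)\|_p^p=\int_0^1|u_x(\gamma(\alpha,t),t)|^p\gamma_\alpha(\alpha,t)\,d\alpha$. Convergence of $u_x$ to a nontrivial $L^\infty$ function means that, for every $\alpha$, $u_x(\gamma(\alpha,t),t)$ converges as $t\to\infty$, the limit being a bounded function of $\alpha$ that is not identically zero. *)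

(* Defs.v *)
From HB Require Import structures.
From mathcomp Require Import all_boot all_order all_algebra.
From mathcomp Require Import all_classical all_reals all_analysis.

Set Implicit Arguments.
Unset Strict Implicit.
Unset Printing Implicit Defensive.

Import Order.TTheory GRing.Theory Num.Theory.
Import numFieldNormedType.Exports.

Local Open Scope classical_set_scope.
Local Open Scope ring_scope.

(* The standing assumptions on the data.  [du0] is the everywhere defined,
   1-periodic representative of u0', which need not be continuous: that it is
   the derivative of u0 is expressed by integration ([data_primitive]), so that
   u0 is differentiable with derivative du0 at every point where du0 is
   continuous.  [peaks] lists the points of [0, 1] where du0 attains M0; since
   du0 lives on the whole line and is periodic, the neighbourhoods of 0 and 1
   are periodic ones. *)
Record initial_data (R : realType) (q C1 M0 : R) (peaks : seq R)
    (u0 du0 : R -> R) : Prop := InitialData {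
  data_periodic : forall x : R, u0 (x + 1) = u0 x ;
  data_deriv_periodic : forall x : R, du0 (x + 1) = du0 x ;
  data_bounded : exists B : R, forall x : R, `|du0 x| <= B ;
  data_ae_continuous :
    {ae (@lebesgue_measure R), forall x : R,
      x \in `]0, 1[ -> {for x, continuous du0}} ;
  data_primitive : forall x : R, x \in `[0, 1] ->
    u0 x = u0 0 + \int[@lebesgue_measure R]_(y in `[0, x]) du0 y ;
  data_max_gt0 : 0 < M0 ;
  data_max : forall x : R, du0 x <= M0 ;
  data_peaks_neq0 : peaks != [::] ;
  data_peaksP : forall a : R, a \in peaks <-> (a \in `[0, 1]) /\ du0 a = M0 ;
  data_away : forall r : R, 0 < r -> exists2 d : R, 0 < d &
    forall x : R, x \in `[0, 1] -> (forall a : R, a \in peaks -> r <= `|x - a|) ->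
      du0 x <= M0 - d ;
  data_local : forall a : R, a \in peaks ->
    (M0 - du0 x) / (`|C1| * `|x - a| `^ q) @[x --> a^'] --> (1 : R) }.

Definition jac (R : realType) (lam : R) (du0 : R -> R) (e a : R) : R :=
  1 - lam * e * du0 a.

(* \bar K_i(t) is [Kbar lam du0 i (eta t)]. *)
Definition Kbar (R : realType) (lam : R) (du0 : R -> R) (i : nat) (e : R) : R :=
  \int[@lebesgue_measure R]_(a in `[0, 1])
    jac lam du0 e a `^ (- (i%:R + lam^-1)).

Definition eta_star (R : realType) (lam M0 : R) : R := (lam * M0)^-1.

(* For lam = 0 the solution is global. *)
Definition tstar (R : realType) (lam M0 : R) (du0 : R -> R) : \bar R :=
  if lam == 0 then +oo%E else
  lim ((\int[@lebesgue_measure R]_(m in `[0%R, e])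
          Kbar lam du0 0 m `^ (2 * lam))%:E @[e --> (eta_star lam M0)^'-]).

(* The representation of the solution for lam > 0.  As du0 may be
   discontinuous, the formula for gam_alpha is stated in integrated form. *)
Definition repr_pos (R : realType) (lam M0 : R) (du0 : R -> R)
    (ux gam : R -> R -> R) : Prop :=
  exists eta : R -> R,
  [/\ eta 0 = 0 /\ eta t @[t --> 0^'+] --> (0 : R),
      forall t : R, 0 < t -> (t%:E < tstar lam M0 du0)%E ->
        is_derive t 1 eta (Kbar lam du0 0 (eta t) `^ (- (2 * lam))),
      forall t : R, 0 <= t -> (t%:E < tstar lam M0 du0)%E ->
        eta t < eta_star lam M0,
      forall t a : R, 0 <= t -> (t%:E < tstar lam M0 du0)%E -> a \in `[0, 1] ->
        gam a t = gam 0 t + \int[@lebesgue_measure R]_(b in `[0, a])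
          (jac lam du0 (eta t) b `^ (- lam^-1) / Kbar lam du0 0 (eta t)) &
      forall t a : R, 0 < t -> (t%:E < tstar lam M0 du0)%E -> a \in `[0, 1] ->
        ux (gam a t) t =
          (lam * eta t * Kbar lam du0 0 (eta t) `^ (2 * lam))^-1 *
          ((jac lam du0 (eta t) a)^-1
            - Kbar lam du0 1 (eta t) / Kbar lam du0 0 (eta t))].

Definition repr_zero (R : realType) (du0 : R -> R)
    (ux gam : R -> R -> R) : Prop :=
  forall t a : R, 0 <= t -> a \in `[0, 1] ->
    let E := \int[@lebesgue_measure R]_(b in `[0, 1]) expR (t * du0 b) in
    gam a t = gam 0 t +
      \int[@lebesgue_measure R]_(b in `[0, a]) (expR (t * du0 b) / E) /\
    ux (gam a t) t = du0 a -
      (\int[@lebesgue_measure R]_(b in `[0, 1]) (du0 b * expR (t * du0 b))) / E.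

(* [u x t], its x-derivative [ux x t] and the characteristics [gam alpha t], on
   the time interval [0, tstar).  The spatial variable is extended to the line
   by periodicity.  The left-hand side u_xt + u u_xx of the equation is the time
   derivative of u_x along characteristics, which is how it is stated in
   [sol_pde] (u_xx itself need not exist); [ux] is the x-derivative of [u] in
   the same integrated sense as for the data. *)
Record solution (R : realType) (lam M0 : R) (u0 du0 : R -> R)
    (u ux gam : R -> R -> R) : Prop := Solution {
  sol_periodic : forall t x : R, 0 <= t -> (t%:E < tstar lam M0 du0)%E ->
    u (x + 1) t = u x t /\ ux (x + 1) t = ux x t ;
  sol_init : forall x : R, u x 0 = u0 x /\ ux x 0 = du0 x ;
  sol_primitive : forall t x : R, 0 <= t -> (t%:E < tstar lam M0 du0)%E ->
    x \in `[0, 1] ->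
    u x t = u 0 t + \int[@lebesgue_measure R]_(y in `[0, x]) ux y t ;
  sol_char_init : forall a : R, a \in `[0, 1] ->
    gam a 0 = a /\ gam a t @[t --> 0^'+] --> a ;
  sol_char : forall t a : R, 0 < t -> (t%:E < tstar lam M0 du0)%E ->
    a \in `[0, 1] -> is_derive t 1 (gam a) (u (gam a t) t) ;
  sol_pde : forall t a : R, 0 < t -> (t%:E < tstar lam M0 du0)%E ->
    a \in `[0, 1] ->
    is_derive t 1 (fun s => ux (gam a s) s)
      (lam * ux (gam a t) t ^+ 2
       - (lam + 1) * \int[@lebesgue_measure R]_(x in `[0, 1]) (ux x t ^+ 2)) ;
  sol_repr_pos : 0 < lam -> repr_pos lam M0 du0 ux gam ;
  sol_repr_zero : lam = 0 -> repr_zero du0 ux gam }.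

(* The norm of L^p(0, 1). *)
Definition Lpnorm (R : realType) (p : R) (f : R -> R) : \bar R :=
  'N[@lebesgue_measure R]_(p%:E)[EFin \o (f \_ `]0, 1[)].

(* tstar is finite and ||u_x(., t)||_p tends to l as t increases to tstar. *)
Definition finite_time_limit (R : realType) (lam M0 : R) (du0 : R -> R)
    (p : R) (ux : R -> R -> R) (l : \bar R) : Prop :=
  exists2 T : R, tstar lam M0 du0 = T%:E &
    Lpnorm p (ux ^~ t) @[t --> T^'-] --> l.

(* Main.v *)
Require Import Defs.
From HB Require Import structures.
From mathcomp Require Import all_boot all_order all_algebra.
From mathcomp Require Import all_classical all_reals all_analysis.
From mathcomp Require Import measurable_realfun ring lra.
Import Order.TTheory GRing.Theory Num.Theory.
Import numFieldNormedType.Exports.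
Local Open Scope classical_set_scope.
Local Open Scope ring_scope.
Set Implicit Arguments.
Unset Strict Implicit.
Unset Printing Implicit Defensive.


(** Why the theorem holds.

    Put [g = M0 - u0'], which is nonnegative, vanishes exactly at the peaks and
    behaves there like [C |x - a|^q].  For [lam > 0] let [e = (lam eta)^-1 - M0] be
    the gap to blow-up, so that [1 - lam eta u0' = lam eta (e + g)].  All powers of
    [lam eta] then cancel in the representation, and with
    [th s e = \int (e + g)^(-s)] over the unit interval and [s = 1 / lam],
      [u_x = th s e ^ (- 2 lam) ((e + g)^-1 - th (1 + s) e / th s e)],
      [gam_alpha = (e + g)^(-s) / th s e].
    Hence the norm at time [t] is a function of [e] alone
    ([Lpnorm_gradient], through the change of variables
    [Lpnorm_along_characteristics]), and everything is decided by [e -> 0].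

    That limit is local at the peaks.  Substituting [x = a + e^(1/q) y] shows that
    an integral of a fast decreasing function of [g / e] is of order [e^(1/q)]
    ([profile_rescaling]).  So [th s e] is of order [e^(1/q - s)] if [s q > 1]
    ([profile_moment_supercritical]), and converges if [s q < 1], by dominated
    convergence ([profile_moment_subcritical]).  For the norm this leaves three
    regimes.
    - If [lam < q], both moments concentrate and the norm to the power [p] is of
      order [e^(p (1 - 2 lam / q))] ([gradient_norm_slow]): it tends to [0], to a
      positive number or to infinity as [lam] is below, at or above [q / 2].  At
      [lam = q / 2] the values of [u_x] converge too ([gradient_at_critical]).
    - If [s q < 1 < (1 + s) q], only the second moment blows up, and for [p > 1]
      the term [(e + g)^-1] outweighs its mean ([gradient_norm_blowup]).
    - If [(p + s) q < 1], everything converges ([gradient_norm_subcritical]).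
    The ranges of parameters of the theorem are translated into these conditions.

    In the gap as a variable the maximal time is, up to a constant, the integral of
    [th s e ^ (2 lam)] near [0].  This is of order [e^(- (2 - 2 lam / q))] for
    [lam < q] and bounded for [lam > q]; so it is integrable for [q / 2 < lam <> q], and
    not for [lam <= q / 2]
    ([tstar_finite], [tstar_infinite]); and the gap tends to [0] at the maximal
    time since [eta] inverts the clock.

    For [lam = 0] the weight is [exp (- t g)] up to normalization.  It concentrates
    where [g] is of order [1 / t], so the centred gradient tends to [0] in norm
    ([exp_gradient_norm_cvg0]).

    The derivative [u0'] is only almost everywhere continuous, so it is replaced by
    a Borel function that agrees with it off a null set ([borel_profile_exists]);
    the integrals do not see the difference ([eq_integral_off_null]). *)

(** * Null sets and densities *)

Section negligible.
Local Open Scope ereal_scope.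
Context d (T : measurableType d) (R : realType).
Variable mu : {measure set T -> \bar R}.
Import HBNNSimple.

Let ge0_eq_integral_off_le (f h : T -> \bar R) (N : set T) :
  measurable N -> mu N = 0 -> (forall x, 0 <= f x) -> (forall x, 0 <= h x) ->
  (forall x, ~ N x -> f x = h x) -> \int[mu]_x f x <= \int[mu]_x h x.
Proof.
move=> mN N0 f0 h0 fh.
rewrite [leLHS]ge0_integralTE// [leRHS]ge0_integralTE//.
apply: ge_ereal_sup => _ [k /= kf <-].
have mCN : measurable (~` N) by exact: measurableC.
apply: ereal_sup_ubound; exists (proj_nnsfun k mCN) => /=.
  move=> x; rewrite mindicE; have [xN|xN] := pselect (N x).
    by rewrite memNset ?mulr0 ?h0//= => /(_ xN).
  by rewrite mem_set// mulr1 -fh.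
rewrite -!integralT_nnsfun.
apply/esym/ge0_ae_eq_integral => //.
- exact/measurable_EFinP.
- exact/measurable_EFinP.
- by move=> x _; rewrite lee_fin.
- by move=> x _; rewrite lee_fin.
exists N; split => // x /= xP; apply: contrapT => Nx; apply: xP => _ /=.
by rewrite mindicE mem_set// mulr1.
Qed.

Let ge0_eq_integral_off (f h : T -> \bar R) (N : set T) :
  measurable N -> mu N = 0 -> (forall x, 0 <= f x) -> (forall x, 0 <= h x) ->
  (forall x, ~ N x -> f x = h x) -> \int[mu]_x f x = \int[mu]_x h x.
Proof.
move=> mN N0 f0 h0 fh; apply/eqP; rewrite eq_le.
by apply/andP; split; apply: (@ge0_eq_integral_off_le _ _ N) => // x /fh.
Qed.

(** The integral of an arbitrary function is built from the simple functions
    below its positive and negative parts, and those can be set to zero on a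
    null set.  This is what makes the integrals of the merely almost everywhere
    continuous derivative of the data computable from a Borel version of it. *)
Lemma eq_integral_off_null (D : set T) (f h : T -> \bar R) (N : set T) :
  measurable N -> mu N = 0 -> (forall x, D x -> ~ N x -> f x = h x) ->
  \int[mu]_(x in D) f x = \int[mu]_(x in D) h x.
Proof.
move=> mN N0 fh; rewrite integral_mkcond [RHS]integral_mkcond.
rewrite integralE [RHS]integralE.
have fhD x : ~ N x -> (f \_ D) x = (h \_ D) x.
  by move=> Nx; rewrite !patchE; case: ifPn => // /set_mem Dx; exact: fh.
congr (_ - _); apply: (ge0_eq_integral_off mN N0) => //.
- by move=> x /fhD; rewrite funeposE => ->; rewrite -funeposE.
- by move=> x /fhD; rewrite funenegE => ->; rewrite -funenegE.
Qed.

End negligible.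

Section density.
Local Open Scope ereal_scope.
Context d (T : measurableType d) (R : realType).
Variables (mu : {measure set T -> \bar R}) (k : T -> R).
Hypotheses (k0 : forall x, (0 <= k x)%R) (mk : measurable_fun setT k).

Let dens (A : set T) : \bar R := \int[mu]_(x in A) (k x)%:E.

Let dens0 : dens set0 = 0. Proof. exact: integral_set0. Qed.

Let dens_ge0 A : 0 <= dens A.
Proof. by apply: integral_ge0 => x _; rewrite lee_fin. Qed.

Let dens_sigma_additive : semi_sigma_additive dens.
Proof.
move=> A mA tA mUA; rewrite /dens/= ge0_integral_bigcup//=.
- by apply: is_cvg_ereal_nneg_natsum_cond => n _ _; exact: dens_ge0.
- by apply/measurable_EFinP; exact: measurable_funTS.
- by move=> x _; rewrite lee_fin.
Qed.

Lemma density_measure_exists : exists nu : {measure set T -> \bar R},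
  forall A, nu A = \int[mu]_(x in A) (k x)%:E.
Proof.
pose mixin := isMeasure.Build _ _ _ dens dens0 dens_ge0 dens_sigma_additive.
pose nu : {measure set T -> \bar R} := HB.pack dens mixin.
by exists nu.
Qed.

Variable nu : {measure set T -> \bar R}.
Hypothesis nuE : forall A, nu A = \int[mu]_(x in A) (k x)%:E.
Import HBNNSimple.

Let nnsfun_density (h : {nnsfun T >-> R}) :
  \int[nu]_x (h x)%:E = \int[mu]_x ((h x)%:E * (k x)%:E).
Proof.
have mEk : measurable_fun setT (EFin \o k) by exact/measurable_EFinP.
transitivity (\int[mu]_x (\sum_(r \in range h)
    (r * \1_(h @^-1` [set r]) x)%:E * (k x)%:E)); last first.
  apply: eq_integral => x _; rewrite [in RHS](fimfunE h) -fsumEFin//.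
  by rewrite ge0_mule_fsuml// => r; exact: nnfun_muleindic_ge0.
rewrite integralT_nnsfun sintegralE ge0_integral_fsum//; last 2 first.
- move=> r; apply: emeasurable_funM => //; apply/measurable_EFinP.
  exact: measurable_funM.
- move=> r x _; rewrite mule_ge0// ?lee_fin//.
  by have := nnfun_muleindic_ge0 h r x; rewrite lee_fin.
apply: eq_fsbigr => r; rewrite inE => -[z _ hz].
under [RHS]eq_integral do rewrite EFinM -muleA.
rewrite ge0_integralZl//; last 3 first.
- by apply: emeasurable_funM => //; apply/measurable_EFinP.
- by move=> x _; rewrite mule_ge0// lee_fin.
- by rewrite lee_fin -hz.
congr (_ * _); rewrite nuE// integral_mkcond; apply: eq_integral => x _.
by rewrite patchE indicE; case: (x \in _); rewrite ?mul1e ?mul0e.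
Qed.

Lemma ge0_integral_density (f : T -> \bar R) :
  (forall x, 0 <= f x) -> measurable_fun setT f ->
  \int[nu]_x f x = \int[mu]_x (f x * (k x)%:E).
Proof.
move=> f0 mf; pose h := nnsfun_approx measurableT mf.
have mEk : measurable_fun setT (EFin \o k) by exact/measurable_EFinP.
have hf x : (h n x)%:E @[n --> \oo] --> f x.
  by apply: cvg_nnsfun_approx.
transitivity (limn (fun n => \int[nu]_x (h n x)%:E)).
  rewrite -monotone_convergence//.
  - by apply: eq_integral => x _; apply/esym/cvg_lim.
  - by move=> n; apply/measurable_EFinP.
  - by move=> n x _; rewrite lee_fin.
  - by move=> x _ m n mn; rewrite lee_fin; exact/lefP/nd_nnsfun_approx.
under eq_fun do rewrite nnsfun_density.
rewrite -monotone_convergence//.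
- by apply: eq_integral => x _; apply/cvg_lim => //; apply: cvgeZr.
- by move=> n; apply: emeasurable_funM => //; apply/measurable_EFinP.
- by move=> n x _; rewrite mule_ge0// lee_fin.
- move=> x _ m n mn; rewrite lee_wpmul2r ?lee_fin//.
  exact/lefP/nd_nnsfun_approx.
Qed.

End density.

(** * Change of variables along characteristics *)

Section change_of_variables.
Context {R : realType}.
Notation mu := (@lebesgue_measure R).

Lemma bounded_integrable_itv (k : R -> R) (K u v : R) (b1 b2 : bool) :
  measurable_fun setT k -> (forall x, `|k x| <= K) ->
  mu.-integrable [set` Interval (BSide b1 u) (BSide b2 v)] (EFin \o k).
Proof.
move=> mk kK; apply: measurable_bounded_integrable => //.
- by rewrite /= lebesgue_measure_itv/=; case: ifPn => // _; rewrite -EFinB ltry.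
- exact: measurable_funTS.
- exists K; split; first exact: num_real.
  by move=> M KM x _ /=; exact: le_trans (kK x) (ltW KM).
Qed.

Section primitive.
Variables (k : R -> R) (K : R).
Hypotheses (mk : measurable_fun setT k) (kK : forall x, `|k x| <= K).

Let I (u v : R) : R := \int[mu]_(z in `]u, v]) k z.

Let I_split u v w : u <= v -> v <= w -> I u w = I u v + I v w.
Proof.
move=> uv vw; rewrite /I (@itv_bndbnd_setU _ _ _ (BRight v)) ?bnd_simp//.
rewrite Rintegral_setU//.
- by rewrite -itv_bndbnd_setU ?bnd_simp//; exact: bounded_integrable_itv mk kK.
- apply/disj_setPS => y [/=]; rewrite 2!in_itv/= => /andP[_ yx] /andP[].
  by rewrite ltNge yx.
Qed.

(** The primitive is extended to the whole line, where the lower bound on its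
    density makes it a bijection. *)
Lemma bounded_measurable_primitive (a c : R) : exists G : R -> R,
  [/\ forall x, a <= x -> G x = c + \int[mu]_(z in `]a, x]) k z &
      forall u v, u <= v -> (\int[mu]_(z in `]u, v]) (k z)%:E = (G v - G u)%:E)%E].
Proof.
pose G x := c + if a <= x then I a x else - I x a.
exists G; split=> [x ax|u v uv]; first by rewrite /G ax.
have IE : (\int[mu]_(z in `]u, v]) (k z)%:E = (I u v)%:E)%E.
  rewrite /I /Rintegral fineK//; apply: integrable_fin_num => //.
  exact: bounded_integrable_itv mk kK.
rewrite IE /G; congr EFin.
have [au|ua] := leP a u.
  by rewrite (le_trans au uv) (I_split au uv); ring.
have [av|va] := leP a v.
  by rewrite (I_split (ltW ua) av); ring.
by rewrite (I_split uv (ltW va)); ring.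
Qed.

End primitive.

Section along.
Variables (k G : R -> R) (k0 K : R).
Hypotheses (mk : measurable_fun setT k) (k0_gt0 : 0 < k0).
Hypotheses (kge : forall x, k0 <= k x) (kle : forall x, k x <= K).
Hypothesis GE : forall u v, u <= v ->
  (\int[mu]_(z in `]u, v]) (k z)%:E = (G v - G u)%:E)%E.

Let k_ge0 x : 0 <= k x. Proof. exact: le_trans (ltW k0_gt0) (kge x). Qed.

Let k_bd x : `|k x| <= K. Proof. by rewrite ger0_norm. Qed.

Let Gbounds u v : u <= v -> k0 * (v - u) <= G v - G u <= K * (v - u).
Proof.
move=> uv; rewrite -2!lee_fin -GE//.
have muE : mu `]u, v] = (v - u)%:E.
  rewrite lebesgue_measure_itv/= lte_fin; case: ltP => // vu.
  have -> : u = v by apply/eqP; rewrite eq_le uv.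
  by rewrite subrr.
have cstE c : (\int[mu]_(z in `]u, v]) c%:E = (c * (v - u))%:E)%E.
  by rewrite integral_cst// [X in (_ * X)%E]muE.
rewrite -!cstE; apply/andP; split; apply: ge0_le_integral => //=.
all: try by move=> x _; rewrite lee_fin// ltW.
all: try by apply/measurable_EFinP; exact: measurable_funTS.
all: by move=> x _; rewrite lee_fin (le_trans (k_ge0 x)).
Qed.

Let Gincr u v : u < v -> G u < G v.
Proof.
move=> uv; rewrite -subr_gt0; have /andP[+ _] := Gbounds (ltW uv).
by apply: lt_le_trans; rewrite mulr_gt0// subr_gt0.
Qed.

Let Gmono : {mono G : u v / u <= v}.
Proof. by apply: le_mono => u v; exact: Gincr. Qed.

Let Gcont : continuous G.
Proof.
have K0 : 0 < K by exact: lt_le_trans k0_gt0 (le_trans (kge 0) (kle 0)).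
have Lip x y : `|G x - G y| <= K * `|x - y|.
  wlog yx : x y / y <= x.
    by move=> H; case: (leP y x) => [/H//|/ltW /H]; rewrite distrC (distrC y).
  have /andP[l u] := Gbounds yx.
  by rewrite (@ger0_norm _ (x - y)) ?subr_ge0// ger0_norm// subr_ge0 Gmono.
move=> x; apply/cvgrPdist_le => e e0; near=> y.
rewrite (le_trans (Lip x y))// -ler_pdivlMl// mulrC.
near: y; apply: cvgr_dist_le; first exact: cvg_id.
by rewrite divr_gt0.
Unshelve. all: by end_near. Qed.

Let Gsurj y : exists x, G x = y.
Proof.
pose r := (`|y - G 0| / k0).
have r0 : 0 <= r by rewrite divr_ge0// ltW.
have k0r : k0 * r = `|y - G 0| by rewrite /r mulrC divfK// gt_eqF.
have /andP[l1 _] := Gbounds r0.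
have /andP[l2 _] : k0 * (0 - - r) <= G 0 - G (- r) <= K * (0 - - r).
  by apply: Gbounds; rewrite oppr_le0.
have [] := @IVT R G (- r) r y.
- by rewrite (le_trans _ r0)// oppr_le0.
- exact: continuous_subspaceT.
- rewrite subr0 k0r in l1; rewrite sub0r opprK k0r in l2.
  have := ler_norm (y - G 0); have := ler_norm (G 0 - y); rewrite distrC => h1 h2.
  by rewrite ge_min le_max; apply/andP; split; apply/orP; [left|right]; lra.
by move=> c _ <-; exists c.
Qed.

Let Gi y := sval (cid (Gsurj y)).

Let GiK : cancel Gi G. Proof. by move=> y; rewrite /Gi; case: cid. Qed.

Let GK : cancel G Gi.
Proof. by move=> x; apply/le_anti; rewrite -[X in X && _]Gmono -[X in _ && X]Gmono GiK lexx. Qed.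

Let mG : measurable_fun setT G. Proof. exact: continuous_measurable_fun. Qed.

Let mGi : measurable_fun setT Gi.
Proof.
by apply: nondecreasing_measurable => // x y xy; rewrite -Gmono !GiK.
Qed.

Let pushforward_nu (nu : {measure set (measurableTypeR R) -> \bar R}) :
  (forall A, nu A = \int[mu]_(x in A) (k x)%:E)%E ->
  forall A, measurable A ->
  pushforward nu (G : measurableTypeR R -> measurableTypeR R) A = mu A.
Proof.
move=> nuE A mA.
have mG' : measurable_fun setT (G : measurableTypeR R -> measurableTypeR R) := mG.
pose Gmixin := isMeasurableFun.Build _ _ _ _ _ mG'.
pose Gpack : {mfun (measurableTypeR R) >-> (measurableTypeR R)} :=
  HB.pack G Gmixin.
apply/esym/(@lebesgue_measure_unique R (pushforward nu Gpack)) => //=.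
move=> _ [[a b]] _ <-; rewrite /pushforward /= nuE.
have [ab|ba] := leP a b; last first.
  by rewrite set_itv_ge ?bnd_simp -?leNgt ?ltW// measure0 preimage_set0 integral_set0.
have -> : G @^-1` `]a, b] = `]Gi a, Gi b]%classic.
  apply/funext => x /=; rewrite !in_itv/=.
  by rewrite -(leW_mono Gmono (Gi a)) -(Gmono x) !GiK.
rewrite GE ?GiK; last by rewrite -Gmono !GiK.
rewrite lebesgue_measure_itv/= lte_fin; case: ltP => // ba.
have -> : a = b by apply/eqP; rewrite eq_le ab.
by rewrite subrr.
Qed.

(** Lebesgue measure is the image under [G] of the measure with density [k],
    since both give [b - a] to the interval from [a] to [b]. *)
Lemma ge0_integral_along_primitive (D : set R) (Q : R -> R) :
  measurable D -> measurable_fun setT Q -> (forall x, 0 <= Q x) ->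
  (\int[mu]_(y in D) (Q y)%:E = \int[mu]_(x in G @^-1` D) (Q (G x) * k x)%:E)%E.
Proof.
move=> mD mQ Q0.
have [nu nuE] := @density_measure_exists _ (measurableTypeR R) R mu k k_ge0 mk.
have mGD : measurable (G @^-1` D) by rewrite -[X in measurable X]setTI; exact: mG.
transitivity (\int[pushforward nu (G : measurableTypeR R -> measurableTypeR R)]_(y in D)
    (Q y)%:E)%E.
  by apply: eq_measure_integral => B mB _; exact/esym/(pushforward_nu nuE).
rewrite ge0_integral_pushforward//; last 2 first.
- by apply/measurable_EFinP/measurable_funTS.
- by move=> y _; rewrite lee_fin.
have mQG : measurable_fun setT (Q \o G) by exact: measurableT_comp.
rewrite integral_mkcond (@ge0_integral_density _ (measurableTypeR R) R mu k k_ge0 mk nu nuE).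
- rewrite [RHS]integral_mkcond; apply: eq_integral => x _.
  by rewrite !patchE; case: ifPn => _; rewrite ?mul0e.
- by move=> x; rewrite erestrict_ge0// => y _; rewrite lee_fin.
- by apply/(measurable_restrictT _ mGD)/measurable_EFinP/measurable_funTS.
Qed.

Lemma bijective_primitive : exists Gi : R -> R,
  [/\ cancel G Gi, cancel Gi G, {mono G : x y / x <= y} & measurable_fun setT Gi].
Proof. by exists Gi. Qed.

End along.

Lemma ge0_integral_translation (D : set R) (Q : R -> R) (t : R) :
  measurable D -> measurable_fun setT Q -> (forall x, 0 <= Q x) ->
  (\int[mu]_(y in D) (Q y)%:E =
   \int[mu]_(x in (fun x : R => x + t)%R @^-1` D) (Q (x + t)%R)%:E)%E.
Proof.
move=> mD mQ Q0.
rewrite (@ge0_integral_along_primitive (cst 1) (fun x => x + t) 1 1)//.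
- by apply: eq_integral => x _; rewrite mulr1.
- move=> u v uv; rewrite /cst integral_cst// mul1e [LHS]lebesgue_measure_itv/= lte_fin.
  case: ltP => // vu; first by rewrite -EFinB opprD addrACA subrr addr0.
  have -> : u = v by apply/eqP; rewrite eq_le uv.
  by rewrite subrr.
Qed.

Lemma lebesgue_measure_translation (N : set R) (t : R) : measurable N ->
  mu ((fun x => x + t) @^-1` N) = mu N.
Proof.
move=> mN; have mt : measurable_fun setT (fun x : R => x + t).
  by apply: measurable_funD.
have mNt : measurable ((fun x => x + t) @^-1` N).
  by rewrite -[X in measurable X]setTI; exact: mt.
have := @ge0_integral_translation N (cst 1) t mN (measurable_cst _) (fun=> ler01).
by rewrite /cst !integral_cst// !mul1e => ->.
Qed.

Lemma periodic_intr (v : R -> R) (m : int) (x : R) :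
  (forall x, v (x + 1) = v x) -> v (x + m%:~R) = v x.
Proof.
move=> v1; have vn n y : v (y + n%:R) = v y.
  by elim: n y => [|n IH] y; rewrite ?addr0// -natr1 addrA v1.
case: m => n; first exact: vn.
by rewrite NegzE intrN -[in RHS](subrK n.+1%:R x) vn.
Qed.

(** If [v] agrees with [w] along the characteristic map [gam] of a circle of
    length one, its norm is computed on the Lagrangian side.  The values of [v]
    are only known on the interval from [gam 0] to [gam 0 + 1], which is cut at
    an integer and translated back to the unit interval. *)
Lemma Lpnorm_along_characteristics (p k0 K : R) (v gam k w : R -> R) (N : set R) :
  0 < p -> measurable_fun setT k -> 0 < k0 -> (forall x, k0 <= k x) ->
  (forall x, k x <= K) -> (forall x, v (x + 1) = v x) ->
  (forall a, 0 <= a <= 1 -> gam a = gam 0 + \int[mu]_(z in `[0, a]) k z) ->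
  \int[mu]_(z in `[0, 1]) k z = 1 ->
  measurable_fun setT w -> measurable N -> mu N = 0%E ->
  (forall a, 0 <= a <= 1 -> ~ N a -> v (gam a) = w a) ->
  (Lpnorm p v = (\int[mu]_(a in `[0%R, 1%R]) (`|w a| `^ p * k a)%:E) `^ p^-1)%E.
Proof.
move=> p0 mk k0_gt0 kge kle v1 gamE k1 mw mN N0 vw.
have k_ge0 x : 0 <= k x by exact: le_trans (ltW k0_gt0) (kge x).
have kK x : `|k x| <= K by rewrite ger0_norm.
have [G [Gc GE]] := bounded_measurable_primitive mk kK 0 (gam 0).
have [Gi [GK GiK Gmono mGi]] := bijective_primitive mk k0_gt0 kge kle GE.
have cov := ge0_integral_along_primitive mk k0_gt0 kge kle GE.
have Ggam a : 0 <= a <= 1 -> G a = gam a.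
  move=> /[dup] a01 /andP[a0 _]; rewrite Gc// (gamE a)//; congr (_ + _).
  by rewrite Rintegral_itv_obnd_cbnd//; exact: bounded_integrable_itv mk kK.
set c := gam 0; have G0 : G 0 = c by rewrite Ggam ?lexx ?ler01.
have G1 : G 1 = c + 1 by rewrite Ggam ?lexx ?ler01// (gamE 1) ?lexx ?ler01// k1.
pose W x := `|w x| `^ p.
have mW : measurable_fun setT W.
  apply: (@measurableT_comp _ _ _ _ _ _ (@powR R ^~ p)) => //.
  exact: measurableT_comp.
have W0 x : 0 <= W x by exact: powR_ge0.
pose F' := W \o Gi.
have mF' : measurable_fun setT F' by exact: measurableT_comp.
have F'0 x : 0 <= F' x by exact: W0.
pose N' := Gi @^-1` N.
have mN' : measurable N' by rewrite -[X in measurable X]setTI; exact: mGi.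
have N'0 : mu N' = 0%E.
  have := cov N' (cst 1) mN' (measurable_cst _) (fun=> ler01).
  rewrite /cst integral_cst// mul1e => ->; rewrite (_ : G @^-1` N' = N); last first.
    by apply/seteqP; split=> x; rewrite /N' /= GK.
  rewrite null_set_integral//; apply/measurable_EFinP/measurable_funTS.
  exact: measurable_funM.
have vF' y : c < y <= c + 1 -> ~ N' y -> `|v y| `^ p = F' y.
  move=> /andP[cy yc] N'y; have Giy : 0 <= Gi y <= 1.
    by rewrite -(Gmono 0) -(Gmono _ 1) GiK G0 G1 yc ltW.
  by rewrite /F' /W /= -vw// -Ggam// GiK.
pose m := Num.floor c; pose r := c - m%:~R.
have m1E : (m + 1)%:~R = m%:~R + 1 :> R by rewrite intrD.
have /andP[r0 r1] : 0 <= r < 1.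
  by have /andP[] := floor_itv c; rewrite -/m m1E /r; lra.
pose F'' x := if x <= r then F' (x + (m + 1)%:~R) else F' (x + m%:~R).
have mt (t : R) : measurable_fun setT (fun x : R => x + t).
  by apply: measurable_funD.
have mF'' : measurable_fun setT F''.
  apply: measurable_fun_ifT => //.
  - exact: measurable_fun_ler.
  - exact: (measurableT_comp mF' (mt _)).
  - exact: (measurableT_comp mF' (mt _)).
have F''0 x : 0 <= F'' x by rewrite /F''; case: ifPn.
pose sh (j : int) (x : R) : R := x + j%:~R.
pose N'' := sh m @^-1` N' `|` sh (m + 1) @^-1` N' `|` [set 1].
have mpre j : measurable (sh j @^-1` N').
  by rewrite -[X in measurable X]setTI; exact: mt.
have mN'' : measurable N'' by apply: measurableU => //; exact: measurableU.
have N''0 : mu N'' = 0%E.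
  have sh0 j : mu (sh j @^-1` N') = 0%E by rewrite lebesgue_measure_translation.
  apply: null_set_setU => //; last exact: lebesgue_measure_set1.
    by apply: measurableU; exact: mpre.
  by apply: null_set_setU; [exact: mpre|exact: mpre|exact: sh0|exact: sh0].
rewrite /Lpnorm unlock /=; congr (_ `^ _)%E.
rewrite (@eq_integral_off_null _ _ _ mu _ _ (EFin \o F'' \_ `]0, 1]) N'')//; last first.
  move=> x _ N''x; rewrite /= !patchE.
  have [/= x01|/= x01] := boolP (x \in [set` `]0%R, 1%R[]).
    rewrite mem_set; last first.
      by move: x01; rewrite inE/= !in_itv/= => /andP[-> /ltW ->].
    congr EFin.
    move: x01; rewrite inE/= in_itv/= => /andP[x0 x1].
    rewrite /F''; case: leP => xr.
      rewrite -vF'.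
      - by rewrite periodic_intr.
      - by rewrite m1E; move: xr x0 r1; rewrite /r => *; apply/andP; split; lra.
      - by move=> N'x; apply: N''x; left; right.
    rewrite -vF'.
    - by rewrite periodic_intr.
    - by move: xr x1 r0; rewrite /r => *; apply/andP; split; lra.
    - by move=> N'x; apply: N''x; left; left.
  have point0 : point = 0 :> R by [].
  rewrite memNset ?point0 ?normr0 ?powR0 ?gt_eqF//.
  move=> /=; rewrite in_itv/= => /andP[x0 x1]; apply: N''x; right => /=.
  apply/eqP; rewrite eq_le x1/= leNgt; apply: contra x01 => x1'.
  by rewrite inE/= in_itv/= x0.
rewrite -restrict_EFin -integral_mkcond.
rewrite (@itv_bndbnd_setU _ _ _ (BRight r)) ?bnd_simp//; last exact: ltW.
rewrite ge0_integral_setU//=; last 3 first.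
- by apply/measurable_EFinP/measurable_funTS.
- by move=> x _; rewrite lee_fin.
- apply/disj_setPS => y [/=]; rewrite 2!in_itv/= => /andP[_ yx] /andP[].
  by rewrite ltNge yx.
have -> : (\int[mu]_(x in `]0%R, r]) (F'' x)%:E =
    \int[mu]_(x in `](m%:~R + 1)%R, (c + 1)%R]) (F' x)%:E)%E.
  rewrite [RHS](@ge0_integral_translation _ _ (m + 1)%:~R)//.
  rewrite (_ : _ @^-1` _ = `]0, r]%classic).
    by apply: eq_integral => x; rewrite inE/= in_itv/= /F'' => /andP[_ ->].
  by apply/funext => x /=; rewrite !in_itv/= /r m1E; congr (_ && _); lra.
have -> : (\int[mu]_(x in `]r, 1%R]) (F'' x)%:E =
    \int[mu]_(x in `]c, (m%:~R + 1)%R]) (F' x)%:E)%E.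
  rewrite [RHS](@ge0_integral_translation _ _ m%:~R)//.
  rewrite (_ : _ @^-1` _ = `]r, 1]%classic).
    apply: eq_integral => x; rewrite inE/= in_itv/= /F'' => /andP[+ _].
    by rewrite ltNge => /negbTE ->.
  by apply/funext => x /=; rewrite !in_itv/= /r; congr (_ && _); lra.
rewrite addeC -ge0_integral_setU//=; last 3 first.
- by apply/measurable_EFinP/measurable_funTS.
- by move=> x _; rewrite lee_fin.
- apply/disj_setPS => y [/=]; rewrite 2!in_itv/= => /andP[_ yx] /andP[].
  by rewrite ltNge yx.
rewrite -itv_bndbnd_setU ?bnd_simp; [|by move: r1; rewrite /r; lra|by move: r0; rewrite /r; lra].
have preG : G @^-1` `]c, c + 1]%classic = `]0, 1]%classic.
  apply/funext => x /=; rewrite !in_itv/= -(leW_mono Gmono 0 x) -(Gmono x 1).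
  by rewrite G0 G1.
have mcc : measurable (`]c, c + 1]%classic : set R) by [].
rewrite (cov _ _ mcc mF' F'0) preG.
have mWk : measurable_fun setT (fun x => W x * k x) by exact: measurable_funM.
transitivity (\int[mu]_(x in `]0%R, 1%R]) (W x * k x)%:E)%E.
  by apply: eq_integral => x _; rewrite /F' /= GK.
rewrite integral_itv_obnd_cbnd//.
by apply/measurable_EFinP/measurable_funTS.
Qed.

End change_of_variables.

(** * The profile of the data at its maximum *)

(** The profile [g] of [M0 - u0']: it vanishes at the peaks like [C |x - a|^q]
    and is bounded below away from them.  It is Borel and bounded on the whole
    line, so that it can stand for [M0 - u0'], which need not be Borel. *)
Record peak_profile (R : realType) (q C : R) (peaks : seq R) (g : R -> R) :
    Prop := PeakProfile {
  profile_measurable : measurable_fun setT g ;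
  profile_peaks_neq0 : peaks != [::] ;
  profile_peaks_in : forall a, a \in peaks -> 0 <= a <= 1 ;
  profile_bounded : exists B, forall x, 0 <= g x <= B ;
  profile_local : forall a e, a \in peaks -> 0 < e ->
    exists2 r, 0 < r & forall x, 0 <= x <= 1 -> `|x - a| < r ->
      (1 - e) * (C * `|x - a| `^ q) <= g x <= (1 + e) * (C * `|x - a| `^ q) ;
  profile_away : forall r, 0 < r -> exists2 d, 0 < d &
    forall x, 0 <= x <= 1 -> (forall a, a \in peaks -> r <= `|x - a|) ->
      d <= g x }.

Lemma profile_ge0 (R : realType) (q C : R) (peaks : seq R) (g : R -> R) :
  peak_profile q C peaks g -> forall x, 0 <= g x.
Proof. by move=> pg x; have [B gB] := profile_bounded pg; have /andP[] := gB x. Qed.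

Section borel_profile.
Context {R : realType}.
Notation mu := (@lebesgue_measure R).

(** The distance to the peaks, cut off at 1 to stay bounded. *)
Lemma truncated_distance (peaks : seq R) : exists d : R -> R,
  [/\ measurable_fun setT d, forall x, 0 <= d x <= 1,
      forall x a, a \in peaks -> d x <= `|x - a| &
      forall x, d x = 1 \/ exists2 a, a \in peaks & d x = `|x - a|].
Proof.
elim: peaks => [|b s [d [md d01 dle deq]]].
  by exists (cst 1); split => // [x|x]; [rewrite ler01 lexx|left].
exists (fun x => Num.min `|x - b| (d x)); split.
- apply: measurable_minr => //; apply: measurableT_comp => //.
  exact: measurable_funB.
- move=> x; have /andP[d0 d1] := d01 x.
  by rewrite le_min normr_ge0 d0 ge_min d1 orbT.
- move=> x a; rewrite inE ge_min => /predU1P[->|/dle ->]; first by rewrite lexx.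
  by rewrite orbT.
- move=> x; case: (leP `|x - b| (d x)) => _.
    by right; exists b; rewrite ?inE ?eqxx.
  case: (deq x) => [->|[a sa ->]]; [by left|right].
  by exists a; rewrite ?inE ?sa ?orbT.
Qed.

Lemma peaks_separated (peaks : seq R) (a : R) : exists2 r, 0 < r &
  forall b, b \in peaks -> b != a -> r <= `|b - a|.
Proof.
elim: peaks => [|b s [r r0 rs]]; first by exists 1.
have [ba|ba] := eqVneq b a.
  by exists r => // c; rewrite inE => /predU1P[->|/rs//]; rewrite ba eqxx.
exists (Num.min r `|b - a|); first by rewrite lt_min r0 normr_gt0 subr_eq0.
move=> c; rewrite inE ge_min => /predU1P[->|/rs + ca]; first by rewrite lexx orbT.
by move=> ->.
Qed.

(** On the null set where [u0'] is not continuous, the model profile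
    [C d^q], with [d] the distance to the peaks, is used instead: it has the
    same behaviour at the peaks. *)
Lemma borel_profile_exists (q C1 M0 : R) (peaks : seq R) (u0 du0 : R -> R) :
  0 < q -> C1 < 0 -> initial_data q C1 M0 peaks u0 du0 ->
  exists g : R -> R, exists N : set R,
  [/\ peak_profile q `|C1| peaks g, measurable N, mu N = 0%E &
      forall x, 0 <= x <= 1 -> ~ N x -> g x = M0 - du0 x].
Proof.
move=> q0 C10 [_ _ [B duB] [N0 [mN0 N00 N0c]] _ M00 duM peaks0 peaksP away loc].
have C0 : 0 < `|C1| by rewrite normr_gt0 lt_eqF.
set C := `|C1| in C0 loc *.
have duc x : 0 < x < 1 -> ~ N0 x -> {for x, continuous du0}.
  move=> x01 N0x; apply: contrapT => ncx; apply: N0x; apply: N0c => /= H.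
  by apply: ncx; apply: H; rewrite in_itv.
have [d [md d01 dle deq]] := truncated_distance peaks.
have B0 : 0 <= B by exact: le_trans (normr_ge0 _) (duB 0).
pose E : set R := `]0, 1[%classic `\` N0.
have mE : measurable E by exact: measurableD.
have mdu : measurable_fun E du0.
  apply: subspace_continuous_measurable_fun => //.
  apply: continuous_in_subspaceT => x; rewrite inE => -[/=].
  by rewrite in_itv/=; exact: duc.
pose g x := if x \in E then M0 - du0 x else C * d x `^ q.
have dq x : 0 <= d x `^ q <= 1.
  have /andP[d0 d1] := d01 x; rewrite powR_ge0/=.
  by have := @ge0_ler_powR _ _ (ltW q0) (d x) 1; rewrite powR1 !nnegrE; apply.
exists g, (N0 `|` [set 0] `|` [set 1]); split.
- split => //.
  + apply: measurable_fun_if => //.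
    * apply: (measurable_fun_bool true); rewrite setTI (_ : _ @^-1` _ = E)//.
      by apply/seteqP; split=> x; [exact: set_mem|exact: mem_set].
    * rewrite setTI (_ : _ @^-1` _ = E); first exact: measurable_funB.
      by apply/seteqP; split=> x; [exact: set_mem|exact: mem_set].
    * apply: measurable_funTS; apply: measurable_funM => //.
      exact: (measurableT_comp (measurable_powR q)).
  + by move=> a /peaksP[]; rewrite in_itv.
  + exists (M0 + B + C) => x; rewrite /g; case: ifPn => _.
      have := duB x; rewrite ler_norml => /andP[h1 h2].
      by rewrite subr_ge0 duM/=; lra.
    have /andP[h1 h2] := dq x.
    by rewrite mulr_ge0 ?(ltW C0)//= (le_trans (ler_piMr (ltW C0) h2))//; lra.
  + move=> a e ap e0.
    have [ai dua] : 0 <= a <= 1 /\ du0 a = M0 by have /peaksP[] := ap; rewrite in_itv.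
    have [r1 r10 sep] := peaks_separated peaks a.
    have /cvgrPdist_le/(_ e e0)[r2 /= r20 near2] := loc a ap.
    exists (Num.min 1 (Num.min (r1 / 2) r2)).
      by rewrite !lt_min ltr01 r20 divr_gt0.
    move=> x x01; rewrite !lt_min => /and3P[xa1 xar1 xar2].
    have P0 : 0 <= C * `|x - a| `^ q by rewrite mulr_ge0 ?powR_ge0 ?ltW.
    rewrite /g; case: ifPn => xE; last first.
      have -> : d x = `|x - a|.
        apply/eqP; rewrite eq_le dle//=.
        case: (deq x) => [->|[b bp ->]]; first exact: ltW.
        have [->//|ba] := eqVneq b a.
        have := sep b bp ba; have := ler_distD x b a; rewrite (distrC b x).
        by move: xar1; lra.
      by nra.
    have [->|xa] := eqVneq x a.
      by rewrite dua !subrr normr0 powR0 ?gt_eqF// !mulr0 lexx.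
    have Pgt0 : 0 < C * `|x - a| `^ q.
      by rewrite mulr_gt0// powR_gt0// normr_gt0 subr_eq0.
    have := near2 x; rewrite /ball_/= distrC => /(_ xar2 xa).
    rewrite distrC ler_distl => /andP[h1 h2]; apply/andP; split.
      by rewrite -ler_pdivlMr//; lra.
    by rewrite -ler_pdivrMr//; lra.
  + move=> r r0; have [e e0 He] := away r r0.
    pose rr := Num.min 1 r; have rr0 : 0 < rr by rewrite lt_min ltr01.
    exists (Num.min e (C * rr `^ q)).
      by rewrite lt_min e0 mulr_gt0// powR_gt0.
    move=> x x01 far; rewrite /g; case: ifPn => _.
      have := He x; rewrite in_itv/= => /(_ x01 far); rewrite ge_min => h.
      by apply/orP; left; lra.
    rewrite ge_min ler_pM2l//; apply/orP; right.
    apply: (ge0_ler_powR (ltW q0)); [by rewrite nnegrE ltW| |].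
      by rewrite nnegrE; have /andP[] := d01 x.
    rewrite /rr ge_min; case: (deq x) => [->|[b bp ->]]; first by rewrite lexx.
    by rewrite far// orbT.
- by apply: measurableU => //; exact: measurableU.
- have m1 (y : R) : mu [set y] = 0%E by exact: lebesgue_measure_set1.
  apply: null_set_setU; [by apply: measurableU|by []| |exact: m1].
  by apply: null_set_setU; [exact: mN0|by []|exact: N00|exact: m1].
- move=> x /andP[x0 x1] Nx; rewrite /g mem_set//; split.
    rewrite /= in_itv/= !lt_neqAle x0 x1 !andbT eq_sym; apply/andP; split.
      by apply/eqP => x0'; apply: Nx; left; right.
    by apply/eqP => x1'; apply: Nx; right.
  by move=> N0x; apply: Nx; left; left.
Qed.

End borel_profile.

(** * Limits and integrals of powers *)

Section power_limits.
Context {R : realType}.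
Notation mu := (@lebesgue_measure R).
Implicit Types a b p x y : R.

Lemma continuous_powR a x : 0 < x -> {for x, continuous (@powR R ^~ a)}.
Proof.
move=> x0; apply/differentiable_continuous/derivable1_diffP.
exact: (@ex_derive _ _ _ _ _ _ _ (is_derive1_powR a x0)).
Qed.

Lemma cvg_powR (T : Type) (F : set_system T) {FF : Filter F} (f : T -> R) (l a : R) :
  0 < l -> f t @[t --> F] --> l -> f t `^ a @[t --> F] --> l `^ a.
Proof. by move=> l0 fl; apply: (continuous_cvg _ (continuous_powR l0) fl). Qed.

Lemma le_powRN b x y : 0 <= b -> 0 < x -> x <= y -> y `^ (- b) <= x `^ (- b).
Proof.
move=> b0 x0 xy; have y0 := lt_le_trans x0 xy.
rewrite !powRN lef_pV2 ?posrE ?powR_gt0//.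
by apply: (ge0_ler_powR b0); rewrite ?nnegrE// ltW.
Qed.

Lemma cvg_norm_powR (T : Type) (F : set_system T) {FF : Filter F} (f : T -> R) (l p : R) :
  0 < p -> f t @[t --> F] --> l -> `|f t| `^ p @[t --> F] --> `|l| `^ p.
Proof.
move=> p0 fl; have nfl : `|f t| @[t --> F] --> `|l| by exact: cvg_norm.
have [l0|l0] := eqVneq l 0; last by apply: cvg_powR => //; rewrite normr_gt0.
rewrite l0 normr0 powR0 ?gt_eqF// in nfl *.
apply/cvgrPdist_lt => e e0.
have e1 : 0 < e `^ p^-1 by rewrite powR_gt0.
move/cvgrPdist_lt : nfl => /(_ _ e1); apply: filterS => t.
rewrite !sub0r !normrN normr_id (ger0_norm (powR_ge0 _ _)) => h.
rewrite -[ltRHS](@powRr1 _ e) ?ltW// -(mulVf (lt0r_neq0 p0)) powRrM.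
by apply: (gt0_ltr_powR p0); rewrite ?nnegrE ?powR_ge0.
Qed.

Lemma cvgy_powRN b : 0 < b -> x `^ (- b) @[x --> +oo] --> (0 : R).
Proof.
move=> b0; apply/cvgrPdist_le => e e0; near=> x.
rewrite sub0r normrN ger0_norm ?powR_ge0//.
have e1 : 0 < e `^ (- b^-1) by rewrite powR_gt0.
have -> : e = (e `^ (- b^-1)) `^ (- b).
  by rewrite -powRrM mulrNN mulVf ?gt_eqF// powRr1// ltW.
apply: (le_powRN (ltW b0) e1).
by near: x; exact: nbhs_pinfty_ge.
Unshelve. all: by end_near. Qed.

Lemma is_derive_powR_shift b (c x : R) : 0 < c + x ->
  is_derive x 1 (fun y => (c + y) `^ b) (b * (c + x) `^ (b - 1)).
Proof.
move=> cx; have d1 := is_derive1_powR b cx.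
have d2 : is_derive x 1 (fun y : R => c + y) 1.
  by have := is_deriveD (is_derive_cst c x 1) (is_derive_id x 1); rewrite add0r.
have := @is_derive1_comp R (@powR R ^~ b) (fun y : R => c + y) x _ _ d1 d2.
by rewrite mulr1.
Qed.

Lemma continuous_powR_shift b (c x : R) : 0 < c + x ->
  {for x, continuous (fun y => (c + y) `^ b)}.
Proof.
move=> cx; apply/differentiable_continuous/derivable1_diffP.
exact: (@ex_derive _ _ _ _ _ _ _ (is_derive_powR_shift b cx)).
Qed.

Lemma integrable_power_decay b : 1 < b ->
  mu.-integrable setT (fun y => ((1 + `|y|) `^ (- b))%:E).
Proof.
move=> b1; pose f (y : R) := (1 + `|y|) `^ (- b).
have pos (y : R) : 0 < 1 + `|y| by rewrite ltr_pwDl.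
have cf : continuous f.
  move=> y; apply: cvg_powR => //; apply: cvgD; first exact: cvg_cst.
  by apply: cvg_norm; exact: cvg_id.
have f0 y : 0 <= f y by exact: powR_ge0.
apply/integrableP; split.
  by apply/measurable_EFinP; exact: continuous_measurable_fun.
under eq_integral do rewrite gee0_abs ?lee_fin//.
rewrite ge0_symfun_integralT//; last by move=> x; rewrite /f /= normrN.
rewrite -set_itvcy.
pose F (y : R) := - (b - 1)^-1 * (1 + y) `^ (1 - b).
have b10 : b - 1 != 0 by rewrite subr_eq0 gt_eqF.
have dF x : 0 <= x -> is_derive x 1 F ((1 + x) `^ (- b)).
  move=> x0; have x1 : 0 < 1 + x by rewrite ltr_pwDl.
  have := is_deriveZ (- (b - 1)^-1) (is_derive_powR_shift (1 - b) x1).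
  rewrite /GRing.scale/= mulrA (_ : - (b - 1)^-1 * (1 - b) = 1); last by field.
  by rewrite mul1r addrAC subrr add0r.
have -> : (\int[mu]_(x in `[0%R, +oo[) (f x)%:E = 0%:E - (F 0)%:E)%E.
  apply: (@ge0_continuous_FTC2y _ f F 0 0) => //.
  - exact: continuous_subspaceT.
  - rewrite -[X in _ --> X](mulr0 (- (b - 1)^-1)); apply: cvgM; first exact: cvg_cst.
    rewrite (_ : 1 - b = - (b - 1)); last by rewrite opprB.
    have b10' : 0 < b - 1 by rewrite subr_gt0.
    exact: (cvg_comp _ _ (cvg_addrl 1) (cvgy_powRN b10')).
  - by move=> x x0; apply: (@ex_derive _ _ _ _ _ _ _ (dF x (ltW x0))).
  - apply: cvg_at_right_filter; apply/differentiable_continuous/derivable1_diffP.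
    exact: (@ex_derive _ _ _ _ _ _ _ (dF 0 (lexx _))).
  - move=> x; rewrite in_itv/= andbT => x0; rewrite derive1E.
    by rewrite (@derive_val _ _ _ _ _ _ _ (dF x (ltW x0))) /f ger0_norm// ltW.
by rewrite -EFinB -EFinM ltry.
Qed.

End power_limits.

Section power_singularity.
Context {R : realType}.
Notation mu := (@lebesgue_measure R).

Let shifted_power_integral_le (b c : R) : b < 1 -> 0 < c -> c <= 1 ->
  (\int[mu]_(y in `]0%R, 1%R]) ((c + y) `^ (- b))%:E <= (2 `^ (1 - b) / (1 - b))%:E)%E.
Proof.
move=> b1 c0 c1.
have b10 : 1 - b != 0 by rewrite subr_eq0 gt_eqF.
have b1p : 0 < 1 - b by rewrite subr_gt0.
pose F (y : R) := (1 - b)^-1 * (c + y) `^ (1 - b).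
have pos (y : R) : 0 <= y -> 0 < c + y by move=> y0; rewrite ltr_pwDl.
have dF (x : R) : 0 <= x -> is_derive x 1 F ((c + x) `^ (- b)).
  move=> x0; have x1 := pos _ x0.
  have := is_deriveZ ((1 - b)^-1) (is_derive_powR_shift (1 - b) x1).
  by rewrite /GRing.scale/= mulrA mulVf// mul1r addrAC subrr add0r.
have cF (x : R) : 0 <= x -> {for x, continuous F}.
  move=> x0; apply/differentiable_continuous/derivable1_diffP.
  exact: (@ex_derive _ _ _ _ _ _ _ (dF x x0)).
have mf : measurable_fun setT (fun y : R => (c + y) `^ (- b)).
  apply: (@measurableT_comp _ _ _ _ _ _ (@powR R ^~ (- b))) => //.
  exact: measurable_funD.
rewrite integral_itv_obnd_cbnd; last by apply/measurable_EFinP/measurable_funTS.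
rewrite (@continuous_FTC2 _ _ F 0 1)//.
- rewrite -EFinB lee_fin /F -mulrBr mulrC ler_pM2r ?invr_gt0//.
  rewrite (@le_trans _ _ ((c + 1) `^ (1 - b)))//.
    by rewrite gerBl powR_ge0.
  by apply: (ge0_ler_powR (ltW b1p)); rewrite ?nnegrE//; lra.
- apply: continuous_in_subspaceT => x; rewrite inE/= in_itv/= => /andP[x0 _].
  exact/continuous_powR_shift/pos.
- split.
  + move=> x; rewrite in_itv/= => /andP[x0 _].
    exact: (@ex_derive _ _ _ _ _ _ _ (dF x (ltW x0))).
  + by apply: cvg_at_right_filter; exact: cF.
  + by apply: cvg_at_left_filter; exact: cF.
- move=> x; rewrite in_itv/= => /andP[x0 _]; rewrite derive1E.
  by rewrite (@derive_val _ _ _ _ _ _ _ (dF x (ltW x0))).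
Qed.

Let power_singularity_at0 (b : R) : 0 <= b -> b < 1 ->
  (\int[mu]_(y in `[0%R, 1%R]) (`|y| `^ (- b))%:E < +oo)%E.
Proof.
move=> b0 b1; pose c n : R := n.+1%:R^-1.
have c0 n : 0 < c n by rewrite invr_gt0.
have c1 n : c n <= 1 by rewrite invf_le1// ler1n.
have mf n : measurable_fun setT (fun y : R => (c n + y) `^ (- b)).
  apply: (@measurableT_comp _ _ _ _ _ _ (@powR R ^~ (- b))) => //.
  exact: measurable_funD.
have mg : measurable_fun setT (fun y : R => `|y| `^ (- b)).
  apply: (@measurableT_comp _ _ _ _ _ _ (@powR R ^~ (- b))) => //.
rewrite -integral_itv_obnd_cbnd; last by apply/measurable_EFinP/measurable_funTS.
apply: (@le_lt_trans _ _ (2 `^ (1 - b) / (1 - b))%:E); last exact: ltry.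
have fpos n (y : R) : 0 < y -> 0 < c n + y by move=> y0; rewrite ltr_wpDr// ltW.
have -> : (\int[mu]_(y in `]0%R, 1%R]) (`|y| `^ (- b))%:E =
    \int[mu]_(y in `]0%R, 1%R]) limn (fun n => ((c n + y) `^ (- b))%:E))%E.
  apply: eq_integral.
  move=> y; rewrite inE/= in_itv/= => /andP[y0 y1].
  apply/esym/cvg_lim => //; apply: cvg_EFin; first exact: nearW.
  rewrite ger0_norm ?ltW//; apply: cvg_powR => //.
  rewrite -[X in _ --> X]add0r; apply: cvgD; last exact: cvg_cst.
  exact: cvg_harmonic.
pose D : set (measurableTypeR R) := `]0, 1]%classic.
have mD : measurable D by exact: measurable_itv.
have mfn n : measurable_fun D (fun y => ((c n + y) `^ (- b))%:E).
  apply/measurable_EFinP; apply: measurable_funTS; exact: mf.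
have f0 n x : D x -> (0 <= ((c n + x) `^ (- b))%:E)%E.
  by move=> _; rewrite lee_fin powR_ge0.
have ndf x : D x ->
    nondecreasing_seq (fun n => ((c n + x) `^ (- b))%:E).
  rewrite /D /= in_itv/= => /andP[x0 x1] m n mn; rewrite lee_fin.
  by apply: le_powRN; rewrite ?fpos// lerD2r lef_pV2 ?posrE// ler_nat.
have := @cvg_monotone_convergence _ _ _ mu _ mD _ mfn f0 ndf.
move=> /cvg_lim => /(_ (@ereal_hausdorff R)) <-.
apply: lime_le; last by apply: nearW => n; exact: shifted_power_integral_le.
apply/cvg_ex; eexists.
exact: (@cvg_monotone_convergence _ _ _ mu _ mD _ mfn f0 ndf).
Qed.

(** The translates [(c + y)^(-b)] with [c > 0] have integrals bounded uniformly in
    [c], and increase to the singular power. *)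
Lemma integrable_power_singularity (a b : R) : 0 <= b -> b < 1 -> 0 <= a <= 1 ->
  mu.-integrable `[0, 1] (fun x => (`|x - a| `^ (- b))%:E).
Proof.
move=> b0 b1 /andP[a0 a1].
have mf (t : R) : measurable_fun setT (fun y : R => `|y + t| `^ (- b)).
  apply: (@measurableT_comp _ _ _ _ _ _ (@powR R ^~ (- b))) => //.
  by apply: measurableT_comp => //; exact: measurable_funD.
apply/integrableP; split; first by apply/measurable_EFinP; apply: measurable_funTS; exact: mf.
under eq_integral do rewrite gee0_abs ?lee_fin ?powR_ge0//.
pose phi (y : R) := if `|y| <= 1 then `|y| `^ (- b) else 0.
have mphi : measurable_fun setT phi.
  apply: measurable_fun_ifT => //; first exact: measurable_fun_ler.
  by have := mf 0; under eq_fun do rewrite addr0.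
have phi0 y : 0 <= phi y by rewrite /phi; case: ifPn => // _; exact: powR_ge0.
apply: (@le_lt_trans _ _ (\int[mu]_y (phi y)%:E)%E).
  rewrite (@ge0_integral_translation _ _ phi (- a))//=.
  apply: (@le_trans _ _ (\int[mu]_(x in `[0%R, 1%R]) (phi (x - a))%:E)%E).
    apply: ge0_le_integral => //=.
    - apply/measurable_EFinP; apply: measurable_funTS; exact: mf.
    - apply/measurable_EFinP/measurable_funTS.
      by apply: (measurableT_comp mphi); exact: measurable_funD.
    - move=> x; rewrite in_itv/= => /andP[x0 x1]; rewrite lee_fin /phi ifT//.
      by rewrite ler_norml; lra.
  rewrite preimage_setT; apply: ge0_subset_integral => //=.
    apply/measurable_EFinP.
    by apply: (measurableT_comp mphi); exact: measurable_funD.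
  by move=> x _; rewrite lee_fin.
rewrite -(setUv (`[0, +oo[%classic : set R)) ge0_integral_setU//=; last 4 first.
- exact: measurableC.
- by apply/measurable_EFinP; rewrite setUv.
- by move=> x _; rewrite lee_fin.
- exact/disj_setPCl.
have half : (\int[mu]_(x in `[0%R, +oo[) (phi x)%:E < +oo)%E.
  rewrite (_ : (\int[mu]_(x in _) _)%E = (\int[mu]_(y in `[0%R, 1%R]) (`|y| `^ (- b))%:E)%E).
    exact: power_singularity_at0.
  rewrite integral_mkcond [RHS]integral_mkcond; apply: eq_integral => x _.
  rewrite !patchE !mem_setE !in_itv/= andbT /phi.
  case: ifPn => //= x0; rewrite ger0_norm//; case: ifPn => //.
rewrite lte_add_pinfty// setCitvr integral_itv_bndo_bndc; last first.
  exact/measurable_EFinP/measurable_funTS.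
have := @ge0_integration_by_substitution0 R (EFin \o phi).
under [X in _ -> _ -> _ = X]eq_integral do rewrite /= /phi normrN -/(phi _).
by move=> <-//; exact/measurable_EFinP.
Qed.

End power_singularity.

(** * Rescaling at a peak *)

Section dominated.
Context d (T : measurableType d) (R : realType).
Variable mu : {measure set T -> \bar R}.

Lemma Rintegral_dominated_cvg (D : set T) (f_ : nat -> T -> R) (f h : T -> R) :
  measurable D -> (forall n, measurable_fun D (f_ n)) ->
  (forall x, D x -> f_ n x @[n --> \oo] --> f x) ->
  mu.-integrable D (EFin \o h) ->
  (forall n x, D x -> `|f_ n x| <= h x) ->
  mu.-integrable D (EFin \o f) /\
  \int[mu]_(x in D) f_ n x @[n --> \oo] --> \int[mu]_(x in D) f x.
Proof.
move=> mD mf_ cf ih bf.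
have mEf_ n : measurable_fun D (EFin \o f_ n) by exact/measurable_EFinP.
have cEf x : D x -> (EFin \o f_ n) x @[n --> \oo] --> (EFin \o f) x.
  by move=> Dx; apply: cvg_EFin; [exact: nearW|exact: cf].
have mEf : measurable_fun D (EFin \o f) by exact: (emeasurable_fun_cvg _ _ mEf_ cEf).
have [intf _ lim] := @dominated_convergence _ _ _ mu D mD (fun n => EFin \o f_ n)
  (EFin \o f) (EFin \o h) mEf_ mEf (aeW _ cEf) ih
  (aeW _ (fun x n (Dx : D x) => bf n x Dx)).
split => //; apply: fine_cvg; rewrite fineK//; exact: integrable_fin_num.
Qed.

End dominated.

(** Around a peak at an endpoint only one side of the unit interval is seen. *)
Definition blowup (R : realType) (a : R) : set R :=
  [set y | (a = 0 -> 0 <= y) /\ (a = 1 -> y <= 0)].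

(** The limit law of the rescaled profile: each peak contributes the image of
    Lebesgue measure on its blow-up under [y |-> C |y|^q].  Duplicates in the list
    of peaks are discarded. *)
Definition peak_mass (R : realType) (q C : R) (peaks : seq R) (H : R -> R) : R :=
  \sum_(a <- undup peaks)
    \int[@lebesgue_measure R]_(y in blowup a) H (C * `|y| `^ q).

Section single_peak.
Context {R : realType}.
Notation mu := (@lebesgue_measure R).
Variables (q C : R) (peaks : seq R) (g : R -> R).
Hypotheses (q0 : 0 < q) (C0 : 0 < C) (pg : peak_profile q C peaks g).
Variables (u : nat -> R) (H : nat -> R -> R) (Hl : R -> R) (M s : R).
(* [H] varies with [n] because the gradient is centred by a mean that itself
   depends on the scale [u n]. *)
Hypotheses (u0 : forall n, 0 < u n) (ucv : u n @[n --> \oo] --> 0).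
Hypotheses (mH : forall n, measurable_fun setT (H n)).
Hypothesis Hbd : forall n z, 0 <= z -> 0 <= H n z <= M * (1 + z) `^ (- s).
Hypotheses (s0 : 0 < s) (sq1 : 1 < s * q).
Hypothesis Hcv : forall (z_ : nat -> R) z, (forall n, 0 <= z_ n) ->
  z_ n @[n --> \oo] --> z -> H n (z_ n) @[n --> \oo] --> Hl z.

Lemma measurable_blowup (a : R) : measurable (blowup a).
Proof.
have [->|a0] := eqVneq a 0.
  rewrite (_ : blowup 0 = `[0, +oo[%classic)//; apply/seteqP; split=> y /=.
    by rewrite in_itv/= andbT => -[-> //].
  by rewrite in_itv/= andbT; split => // /eqP; rewrite eq_sym oner_eq0.
have [->|a1] := eqVneq a 1.
  rewrite (_ : blowup 1 = `]-oo, 0]%classic)//; apply/seteqP; split=> y /=.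
    by rewrite in_itv/= => -[_ -> //].
  by rewrite in_itv/=; split => // /eqP; rewrite oner_eq0.
rewrite (_ : blowup a = setT)//; apply/seteqP; split=> y //= _.
by split => /eqP; [rewrite (negbTE a0)|rewrite (negbTE a1)].
Qed.

Let g_ge0 := profile_ge0 pg.

Let M0 : 0 <= M.
Proof.
have /andP[h1 h2] := Hbd 0 (lexx 0); have := le_trans h1 h2.
by rewrite addr0 powR1 mulr1.
Qed.

Let mQ n : measurable_fun setT (fun x => H n (g x / u n)).
Proof.
apply: (measurableT_comp (mH n)); apply: measurable_funM => //.
exact: profile_measurable pg.
Qed.

Section peak.
Variables (a r : R).
Hypotheses (ap : a \in peaks) (r0 : 0 < r).
Hypothesis gr : forall x, 0 <= x <= 1 -> `|x - a| < r ->
  2^-1 * (C * `|x - a| `^ q) <= g x.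

Let D : set R := [set x | 0 <= x <= 1 /\ `|x - a| < r].
Let rho n := u n `^ q^-1.

Let rho_gt0 n : 0 < rho n. Proof. exact: powR_gt0. Qed.

Let rhoq n : rho n `^ q = u n.
Proof. by rewrite /rho -powRrM mulVf ?gt_eqF// powRr1// ltW. Qed.

Let rho_cv : rho n @[n --> \oo] --> 0.
Proof.
have qi : 0 < q^-1 by rewrite invr_gt0.
have := cvg_norm_powR qi ucv; rewrite normr0 powR0 ?gt_eqF//.
have E : (fun n => `|u n| `^ q^-1) = rho.
  by apply/funext => n; rewrite ger0_norm// ltW.
by rewrite E => h; exact: h.
Qed.

Let mD : measurable D.
Proof.
rewrite (_ : D = `[0, 1]%classic `&` ball a r).
  by apply: measurableI => //; exact: measurable_ball.
apply/seteqP; split=> x /=; rewrite in_itv/= /D/= distrC => -[x01 xa]; split => //.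
Qed.

Let f_ n y : R :=
  if a + rho n * y \in D then H n (g (a + rho n * y) / u n) else 0.

Let K := (2 * Num.max 1 (2 / C) `^ q^-1) `^ (s * q).

Let dom (y : R) : R := M * K * (1 + `|y|) `^ (- (s * q)).

Let mG n : measurable_fun setT (fun y : R => a + rho n * y).
Proof. by apply: measurable_funD => //; exact: measurable_funM. Qed.

Let mf_ n : measurable_fun setT (f_ n).
Proof.
apply: measurable_fun_ifT => //.
- apply: (measurable_fun_bool true); rewrite setTI.
  rewrite (_ : _ @^-1` _ = (fun y => a + rho n * y) @^-1` D).
    by rewrite -[X in measurable X]setTI; exact: mG.
  by apply/seteqP; split=> x; [exact: set_mem|exact: mem_set].
- exact: (measurableT_comp (mQ n) (mG n)).
Qed.

Let powRq_scaled n (y : R) : C * `|rho n * y| `^ q = u n * (C * `|y| `^ q).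
Proof. by rewrite normrM powRM// (ger0_norm (ltW (rho_gt0 n))) rhoq; ring. Qed.

(* [1 + |y| <= 2 max(1, |y|)], and [|y|^q] is dominated by [1 + C |y|^q / 2] *)
Let dom_model (y : R) : (1 + 2^-1 * (C * `|y| `^ q)) `^ (- s) <= K * (1 + `|y|) `^ (- (s * q)).
Proof.
set m := Num.max 1 (2 / C).
have m1 : 1 <= m by rewrite /m le_max lexx.
have m0 : 0 < m by exact: lt_le_trans m1.
have y1 : 0 < 1 + `|y| by rewrite ltr_pwDl.
set X := 1 + 2^-1 * (C * `|y| `^ q).
have Pq : 0 <= `|y| `^ q by exact: powR_ge0.
have X1 : 1 <= X by rewrite /X lerDl !mulr_ge0// ltW.
have X0 : 0 < X by exact: lt_le_trans X1.
have Xb : `|y| `^ q <= m * X.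
  rewrite (@le_trans _ _ (2 / C * X))//; last first.
    by rewrite ler_pM2r// /m le_max lexx orbT.
  rewrite /X mulrDr mulr1 (_ : 2 / C * (2^-1 * (C * _)) = `|y| `^ q).
    by rewrite lerDr divr_ge0// ltW.
  by field; rewrite gt_eqF.
have key : 1 + `|y| <= 2 * m `^ q^-1 * X `^ q^-1.
  have qi : 0 <= q^-1 by rewrite invr_ge0 ltW.
  rewrite -mulrA -powRM ?(ltW m0) ?(ltW X0)//.
  have mX1 : 1 <= m * X by rewrite -[1]mulr1 ler_pM.
  have A1 : 1 <= (m * X) `^ q^-1.
    have := @ge0_ler_powR _ _ qi 1 (m * X); rewrite powR1 !nnegrE; apply => //.
    exact: le_trans mX1.
  have A2 : `|y| <= (m * X) `^ q^-1.
    have := @ge0_ler_powR _ _ qi (`|y| `^ q) (m * X); rewrite !nnegrE.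
    rewrite -powRrM mulfV ?gt_eqF// powRr1//; apply => //.
    exact: le_trans mX1.
  by lra.
have sq0 : 0 < s * q by rewrite mulr_gt0.
have := le_powRN (ltW sq0) y1 key.
rewrite powRM ?mulr_ge0 ?powR_ge0// -(powRrM X) (_ : q^-1 * - (s * q) = - s).
  rewrite powRN -/K => h.
  rewrite -ler_pdivrMl//; last by rewrite /K powR_gt0// mulr_gt0// powR_gt0.
by field; rewrite gt_eqF.
Qed.

Let f_bd n y : 0 <= f_ n y <= dom y.
Proof.
rewrite /f_; case: ifPn => [/set_mem[x01 xa]|_]; last first.
  by rewrite lexx /dom mulr_ge0 ?powR_ge0// mulr_ge0// powR_ge0.
have zge0 : 0 <= g (a + rho n * y) / u n by rewrite divr_ge0// ltW.
have /andP[-> /= h] := Hbd n zge0.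
rewrite (le_trans h)// /dom -mulrA ler_wpM2l//.
rewrite (le_trans _ (dom_model y))//; apply: le_powRN; first exact: ltW.
  by rewrite ltr_pwDl// !mulr_ge0 ?powR_ge0// ltW.
rewrite lerD2l ler_pdivlMr// mulrC -[u n * _]mulrCA -powRq_scaled.
have := gr x01 xa; rewrite (_ : a + rho n * y - a = rho n * y); last by ring.
by [].
Qed.

Let dom_integrable : mu.-integrable setT (EFin \o dom).
Proof.
have := integrableZl measurableT (M * K) (integrable_power_decay sq1).
by apply: eq_integrable => // y _; rewrite /dom /= EFinM.
Qed.

Let f_cv y : f_ n y @[n --> \oo] -->
  (if y \in blowup a then Hl (C * `|y| `^ q) else 0).
Proof.
have a01 := profile_peaks_in pg ap.
have rhoy : rho n * y @[n --> \oo] --> 0.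
  rewrite -[X in _ --> X](mul0r y); apply: cvgM => //; exact: cvg_cst.
have nrhoy e : 0 < e -> \forall n \near \oo, `|rho n * y| < e.
  move=> e0; move/cvgrPdist_lt : rhoy => /(_ e e0).
  by apply: filterS => n; rewrite sub0r normrN.
case: ifPn => [/set_mem[y0 y1]|yb]; last first.
  have f0 n : f_ n y = 0.
    rewrite /f_ ifF//; apply/negP => /set_mem[/andP[h0 h1] _].
    move/negP : yb; apply; rewrite inE; split => [a0|a1].
      by move: h0; rewrite a0 add0r pmulr_rge0.
    by move: h1; rewrite a1 gerDl pmulr_rle0.
  under eq_fun do rewrite f0; exact: cvg_cst.
have inD : \forall n \near \oo, a + rho n * y \in D.
  have e0 : 0 < Num.min r (Num.min (if a == 0 then 1 else a) (if a == 1 then 1 else 1 - a)).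
    have /andP[a0 a1] := a01.
    rewrite !lt_min r0 /=; apply/andP; split; case: ifPn => // h.
      by rewrite lt_neqAle eq_sym h.
    by rewrite subr_gt0 lt_neqAle h.
  have := nrhoy _ e0; apply: filterS => n; rewrite !lt_min => /and3P[h1 h2 h3].
  rewrite inE; split; last by rewrite (_ : _ - a = rho n * y)//; ring.
  have rn := ltW (rho_gt0 n); apply/andP; split.
    move: h2; have [a0|a0] := eqVneq a 0; first by rewrite a0 add0r mulr_ge0// y0.
    by rewrite ltr_norml => /andP[+ _]; rewrite -subr_gt0 opprK addrC => /ltW.
  move: h3; have [a1|a1] := eqVneq a 1; first by rewrite a1 gerDl mulr_ge0_le0// y1.
  by rewrite ltr_norml => /andP[_ +]; rewrite ltrBrDl => /ltW.
pose z_ n := g (a + rho n * y) / u n.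
have z_ge0 n : 0 <= z_ n by rewrite divr_ge0// ltW.
have z_cv : z_ n @[n --> \oo] --> C * `|y| `^ q.
  set P := C * `|y| `^ q; have P0 : 0 <= P by rewrite mulr_ge0 ?powR_ge0// ltW.
  apply/cvgrPdist_le => e e0.
  have e'0 : 0 < e / (P + 1) by rewrite divr_gt0// ltr_wpDl.
  have [r' r'0 loc] := profile_local pg ap e'0.
  near=> n.
  have nD : a + rho n * y \in D by near: n.
  have nr : `|rho n * y| < r' by near: n; exact: nrhoy.
  have := loc (a + rho n * y); rewrite (_ : _ - a = rho n * y); last by ring.
  rewrite powRq_scaled -/P => /(_ _ nr) h.
  have {h}/andP[h1 h2] := h (set_mem nD).1.
  have eP : e / (P + 1) * P <= e.
    rewrite mulrAC ler_pdivrMr ?ltr_wpDl//; nra.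
  rewrite distrC ler_distl /z_ ler_pdivlMr// ler_pdivrMr//.
  have un := u0 n; apply/andP; split; nra.
have := Hcv z_ge0 z_cv; apply: cvg_trans; apply: near_eq_cvg.
move: inD; apply: filterS => n nD; rewrite /f_ nD//.
Unshelve. all: by end_near. Qed.

Let f_integral n : u n `^ (- q^-1) * \int[mu]_(x in D) H n (g x / u n) =
  \int[mu]_y f_ n y.
Proof.
have rho0 := rho_gt0 n.
have if_ : mu.-integrable setT (EFin \o f_ n).
  apply: le_integrable dom_integrable => //; first by apply/measurable_EFinP; exact: mf_.
  move=> y _ /=; rewrite lee_fin; have /andP[h1 h2] := f_bd n y.
  by rewrite !ger0_norm// (le_trans h1).
have -> : \int[mu]_(x in D) H n (g x / u n) = rho n * \int[mu]_y f_ n y.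
  rewrite -RintegralZl// /Rintegral; congr fine.
  have Q0 x : 0 <= H n (g x / u n).
    by have /andP[] := @Hbd n (g x / u n) (divr_ge0 (g_ge0 x) (ltW (u0 n))).
  have GE v w : v <= w -> (\int[mu]_(z in `]v, w]) (rho n)%:E =
      ((a + rho n * w) - (a + rho n * v))%:E)%E.
    move=> vw; rewrite integral_cst// [X in (_ * X)%E]lebesgue_measure_itv/= lte_fin.
    case: ltP => [_|wv]; first by rewrite -EFinB -EFinM; congr EFin; ring.
    have -> : v = w by apply/eqP; rewrite eq_le vw.
    by rewrite subrr mule0.
  rewrite (@ge0_integral_along_primitive _ (cst (rho n)) (fun y => a + rho n * y)
    (rho n) (rho n) _ rho0 _ _ GE D (fun x => H n (g x / u n)))//.
  rewrite [LHS]integral_mkcond; apply: eq_integral => y _; rewrite patchE /f_.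
  have -> : (y \in (fun y0 => a + rho n * y0) @^-1` D) = (a + rho n * y \in D).
    by apply/idP/idP => /set_mem h; exact: mem_set.
  by case: ifPn => _; rewrite ?mulr0// mulrC.
by rewrite mulrA powRN mulVf ?mul1r// gt_eqF.
Qed.

(** Substitute [x = a + u^(1/q) y].  As [g] is at least half its model
    [C |x - a|^q] on the neighbourhood of the peak, the integrand is dominated by a
    multiple of [(1 + |y|)^(-s q)], which is integrable as [s q > 1]. *)
Lemma single_peak_rescaling :
  mu.-integrable (blowup a) (fun y => (Hl (C * `|y| `^ q))%:E) /\
  u n `^ (- q^-1) * \int[mu]_(x in D) H n (g x / u n) @[n --> \oo] -->
  \int[mu]_(y in blowup a) Hl (C * `|y| `^ q).
Proof.
have f_dom n y : setT y -> `|f_ n y| <= dom y.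
  by move=> _; have /andP[h1 h2] := f_bd n y; rewrite ger0_norm.
have [intf cf] := @Rintegral_dominated_cvg _ (measurableTypeR R) R mu setT f_
  (fun y => if y \in blowup a then Hl (C * `|y| `^ q) else 0) dom
  measurableT mf_ (fun y _ => @f_cv y) dom_integrable f_dom.
have mB := measurable_blowup a.
split.
  apply/(@integrable_mkcond _ (measurableTypeR R) R mu _ _ mB).
  apply: eq_integrable intf => // y _; rewrite patchE /=.
  by case: ifPn.
have -> : \int[mu]_(y in blowup a) Hl (C * `|y| `^ q) =
    \int[mu]_y (if y \in blowup a then Hl (C * `|y| `^ q) else 0).
  by rewrite Rintegral_mkcond; apply: eq_Rintegral => y _; rewrite patchE.
by under eq_fun do rewrite f_integral.
Qed.

End peak.
End single_peak.

(** * Rescaling on the unit interval *)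

Section unit_interval.
Context {R : realType}.
Notation mu := (@lebesgue_measure R).
Implicit Types (A : set R) (f : R -> R).

Lemma lebesgue_measure_sub_unit A : measurable A -> A `<=` `[0, 1] ->
  (mu A <= 1)%E.
Proof.
move=> mA A01; have m01 : measurable (`[0, 1]%classic : set R) by [].
have := le_measure mu (mem_set mA) (mem_set m01) A01.
by rewrite /= lebesgue_measure_itv/= lte_fin ltr01 oppr0 adde0.
Qed.

Lemma integrable_sub_unit A f (K : R) : measurable A -> A `<=` `[0, 1] ->
  measurable_fun A f -> (forall x, A x -> `|f x| <= K) ->
  mu.-integrable A (EFin \o f).
Proof.
move=> mA A01 mf fK; apply: measurable_bounded_integrable => //.
- exact: le_lt_trans (lebesgue_measure_sub_unit mA A01) (ltry _).
- exists K; split; first exact: num_real.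
  by move=> N KN x Ax /=; rewrite (le_trans (fK x Ax))// ltW.
Qed.

Lemma Rintegral_sub_unit_le A f (c : R) : measurable A -> A `<=` `[0, 1] ->
  mu.-integrable A (EFin \o f) -> 0 <= c -> (forall x, A x -> f x <= c) ->
  \int[mu]_(x in A) f x <= c.
Proof.
move=> mA A01 intf c0 fc.
have mu1 := lebesgue_measure_sub_unit mA A01.
have mufin : mu A \is a fin_num.
  by rewrite ge0_fin_numE//; exact: le_lt_trans mu1 (ltry _).
have intc : mu.-integrable A (EFin \o cst c).
  apply: (@integrable_sub_unit A (cst c) c) => // x _ /=.
  by rewrite ger0_norm.
rewrite (le_trans (@le_Rintegral _ (measurableTypeR R) R mu A _ _ mA intf intc fc))//.
rewrite Rintegral_cst// -[leRHS]mulr1 ler_wpM2l//.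
by rewrite -lee_fin fineK.
Qed.

End unit_interval.

Section rescaling.
Context {R : realType}.
Notation mu := (@lebesgue_measure R).

Lemma common_radius (t : seq R) (P : R -> R -> Prop) :
  (forall a, a \in t -> exists2 r, 0 < r & P a r) ->
  (forall a r r', P a r -> 0 < r' -> r' <= r -> P a r') ->
  exists2 r, 0 < r & forall a, a \in t -> P a r.
Proof.
move=> + Pmono; elim: t => [_|b t IH bt]; first by exists 1.
have [r r0 Pr] := IH (fun a ta => bt a (mem_behead (s := b :: t) ta)).
have [r' r'0 Pr'] := bt b (mem_head b t).
have m0 : 0 < Num.min r r' by rewrite lt_min r0.
exists (Num.min r r') => // a; rewrite inE => /predU1P[->|ta].
  by apply: Pmono Pr' m0 _; rewrite ge_min lexx orbT.
by apply: Pmono (Pr a ta) m0 _; rewrite ge_min lexx.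
Qed.

Variables (q C : R) (peaks : seq R) (g : R -> R).
Hypotheses (q0 : 0 < q) (C0 : 0 < C) (pg : peak_profile q C peaks g).
Variables (u : nat -> R) (H : nat -> R -> R) (Hl : R -> R) (M s : R).
Hypotheses (u0 : forall n, 0 < u n) (ucv : u n @[n --> \oo] --> 0).
Hypotheses (mH : forall n, measurable_fun setT (H n)).
Hypothesis Hbd : forall n z, 0 <= z -> 0 <= H n z <= M * (1 + z) `^ (- s).
Hypotheses (s0 : 0 < s) (sq1 : 1 < s * q).
Hypothesis Hcv : forall (z_ : nat -> R) z, (forall n, 0 <= z_ n) ->
  z_ n @[n --> \oo] --> z -> H n (z_ n) @[n --> \oo] --> Hl z.

Let g_ge0 := profile_ge0 pg.

Let M0 : 0 <= M.
Proof.
have /andP[h1 h2] := Hbd 0 (lexx 0); have := le_trans h1 h2.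
by rewrite addr0 powR1 mulr1.
Qed.

Let Q n x := H n (g x / u n).

Let mQ n : measurable_fun setT (Q n).
Proof.
apply: (measurableT_comp (mH n)); apply: measurable_funM => //.
exact: profile_measurable pg.
Qed.

Let Q_ge0 n x : 0 <= Q n x.
Proof.
by have /andP[] := @Hbd n (g x / u n) (divr_ge0 (g_ge0 x) (ltW (u0 n))).
Qed.

Let Q_le n x d : 0 <= d -> d <= g x / u n -> Q n x <= M * (1 + d) `^ (- s).
Proof.
move=> d0 dg; have z0 := divr_ge0 (g_ge0 x) (ltW (u0 n)).
have /andP[_ h] := @Hbd n _ z0; rewrite (le_trans h)// ler_wpM2l//.
by apply: le_powRN; rewrite ?(ltW s0) ?lerD2l// ltr_pwDl.
Qed.

Let Q_integrable n (A : set R) : measurable A -> A `<=` `[0, 1] ->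
  mu.-integrable A (EFin \o Q n).
Proof.
move=> mA A01; apply: (@integrable_sub_unit _ _ _ M) => //.
  by apply: measurable_funTS; exact: mQ.
move=> x _; rewrite ger0_norm//.
have := @Q_le n x 0 (lexx 0) (divr_ge0 (g_ge0 x) (ltW (u0 n))).
by rewrite addr0 powR1 mulr1.
Qed.

Let local (a r : R) := forall x, 0 <= x <= 1 -> `|x - a| < r ->
  2^-1 * (C * `|x - a| `^ q) <= g x.

Section with_radius.
Variable r : R.
Hypotheses (r0 : 0 < r) (loc : forall a, a \in peaks -> local a r).
Hypothesis sep : forall a b, a \in peaks -> b \in peaks -> b != a ->
  2 * r <= `|b - a|.

Let D (a : R) : set R := [set x | 0 <= x <= 1 /\ `|x - a| < r].
Let U (t : seq R) : set R :=
  [set x | 0 <= x <= 1 /\ exists2 a, a \in t & `|x - a| < r].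

Let mD a : measurable (D a).
Proof.
rewrite (_ : D a = `[0, 1]%classic `&` ball a r).
  by apply: measurableI => //; exact: measurable_ball.
by apply/seteqP; split=> x /=; rewrite in_itv/= /D/= distrC => -[x01 xa].
Qed.

Let U_cons a t : U (a :: t) = D a `|` U t.
Proof.
apply/seteqP; split=> x /=.
  move=> [x01 [b]]; rewrite inE => /predU1P[->|tb] xb; first by left.
  by right; split => //; exists b.
move=> [[x01 xa]|[x01 [b tb xb]]]; split => //.
  by exists a; rewrite ?mem_head.
by exists b; rewrite // inE tb orbT.
Qed.

Let mU t : measurable (U t).
Proof.
elim: t => [|a t IH]; last by rewrite U_cons; exact: measurableU.
by rewrite (_ : U [::] = set0)//; apply/seteqP; split=> x //= [_ []].
Qed.

Let U_rescaling t : uniq t -> {subset t <= peaks} ->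
  u n `^ (- q^-1) * \int[mu]_(x in U t) Q n x @[n --> \oo] -->
  \sum_(a <- t) \int[mu]_(y in blowup a) Hl (C * `|y| `^ q).
Proof.
elim: t => [_ _|a t IH /= /andP[at_ ut] sub].
  rewrite big_nil (_ : U [::] = set0); last by apply/seteqP; split=> x //= [_ []].
  by under eq_fun do rewrite Rintegral_set0 mulr0; exact: cvg_cst.
have ap : a \in peaks by apply: sub; rewrite mem_head.
have sub' : {subset t <= peaks} by move=> b tb; apply: sub; rewrite inE tb orbT.
have [_ ca] := single_peak_rescaling q0 C0 pg u0 ucv mH Hbd s0 sq1 Hcv ap r0 (loc ap).
have ct := IH ut sub'.
have E n : u n `^ (- q^-1) * \int[mu]_(x in U (a :: t)) Q n x =
    u n `^ (- q^-1) * \int[mu]_(x in D a) Q n x +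
    u n `^ (- q^-1) * \int[mu]_(x in U t) Q n x.
  rewrite U_cons (@Rintegral_setU _ (measurableTypeR R) R mu _ _ _ (mD a) (mU t)); last 2 first.
  - rewrite -U_cons; apply: Q_integrable; first exact: mU.
    by move=> x [x01 _]; rewrite /= in_itv.
  - apply/disj_setPS => x [[x01 xa] [_ [b tb xb]]].
    have ba : b != a by apply: contraNneq at_ => <-.
    have := sep ap (sub' _ tb) ba.
    by have := ler_distD x b a; rewrite (distrC b x) => h1 h2; exfalso; lra.
  by rewrite mulrDr.
by rewrite big_cons; under eq_fun do rewrite E; exact: cvgD.
Qed.

(* away from the peaks the integral is of order [u^s], and [s > 1 / q] *)
Let rest_rescaling (V : set R) d : measurable V -> V `<=` `[0, 1] -> 0 < d ->
  (forall x, V x -> d <= g x) ->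
  u n `^ (- q^-1) * \int[mu]_(x in V) Q n x @[n --> \oo] --> 0.
Proof.
move=> mV V01 d0 Vd.
have sqp : 0 < s - q^-1 by rewrite subr_gt0 -(ltr_pM2r q0) mulVf ?gt_eqF.
apply: (@squeeze_cvgr _ _ _ _ (cst 0) (fun n => M * d `^ (- s) * `|u n| `^ (s - q^-1))).
- apply: nearW => n; have un := u0 n; apply/andP; split.
    by rewrite mulr_ge0 ?powR_ge0//; apply: Rintegral_ge0 => x _; exact: Q_ge0.
  have ub : \int[mu]_(x in V) Q n x <= M * d `^ (- s) * u n `^ s.
    apply: Rintegral_sub_unit_le => //.
    - exact: Q_integrable.
    - by rewrite !mulr_ge0 ?powR_ge0.
    move=> x Vx; rewrite (le_trans (@Q_le n x (d / u n) _ _))//.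
    - by rewrite divr_ge0// ltW.
    - by rewrite ler_pM2r ?invr_gt0// Vd.
    rewrite -mulrA ler_wpM2l//.
    rewrite (@le_trans _ _ ((d / u n) `^ (- s)))//.
      by apply: (le_powRN (ltW s0)); [rewrite divr_gt0|rewrite lerDr].
    rewrite powRM ?(ltW d0) ?invr_ge0 ?(ltW un)// -powR_inv1 ?(ltW un)//.
    by rewrite -powRrM mulN1r opprK.
  rewrite (le_trans (ler_wpM2l (powR_ge0 _ _) ub))//.
  rewrite mulrCA -powRD; last by rewrite (gt_eqF un) implybT.
  by rewrite addrC ger0_norm ?(ltW un).
- exact: cvg_cst.
- rewrite -[X in _ --> X](mulr0 (M * d `^ (- s))); apply: cvgM; first exact: cvg_cst.
  by have := cvg_norm_powR sqp ucv; rewrite normr0 powR0 ?gt_eqF//; apply.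
Qed.

Lemma separated_peaks_rescaling :
  u n `^ (- q^-1) * \int[mu]_(x in `[0, 1]) Q n x @[n --> \oo] -->
  peak_mass q C peaks Hl.
Proof.
have [d d0 away] := profile_away pg r0.
pose V := `[0, 1]%classic `\` U (undup peaks).
have mV : measurable V by exact: measurableD.
have V01 : V `<=` `[0, 1] by exact: subDsetl.
have cV : u n `^ (- q^-1) * \int[mu]_(x in V) Q n x @[n --> \oo] --> 0.
  apply: (@rest_rescaling V d) => // x [/= x01 Ux]; move: x01; rewrite in_itv/= => x01.
  apply: away => // a ap; rewrite leNgt; apply/negP => xa.
  by apply: Ux; split => //; exists a => //; rewrite mem_undup.
have sub : {subset undup peaks <= peaks} by move=> a; rewrite mem_undup.
have U01 : U (undup peaks) `<=` `[0, 1]%classic by move=> x [x01 _]; rewrite /= in_itv.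
have E n : u n `^ (- q^-1) * \int[mu]_(x in `[0, 1]) Q n x =
    u n `^ (- q^-1) * \int[mu]_(x in U (undup peaks)) Q n x +
    u n `^ (- q^-1) * \int[mu]_(x in V) Q n x.
  rewrite -mulrDr -(@Rintegral_setU _ (measurableTypeR R) R mu _ _ _ (mU _) mV); last 2 first.
  - rewrite setDUK//; exact: Q_integrable.
  - by rewrite disj_set2E setDIK.
  by rewrite setDUK.
under eq_fun do rewrite E; rewrite -(addr0 (peak_mass q C peaks Hl)).
exact: cvgD (U_rescaling (undup_uniq peaks) sub) cV.
Qed.

End with_radius.

Let exists_radius : exists2 r, 0 < r & forall a, a \in peaks ->
  local a r /\ forall b, b \in peaks -> b != a -> 2 * r <= `|b - a|.
Proof.
pose P a r := local a r /\
  forall b, b \in peaks -> b != a -> 2 * r <= `|b - a|.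
have locP a : a \in peaks -> exists2 r, 0 < r & P a r.
  move=> ap; have half0 : 0 < 2^-1 :> R by rewrite invr_gt0.
  have [r1 r10 h1] := profile_local pg ap half0.
  have [r2 r20 h2] := peaks_separated peaks a.
  exists (Num.min r1 (r2 / 2)); first by rewrite lt_min r10 divr_gt0.
  split=> [x x01|b bp ba].
    rewrite lt_min => /andP[xa _]; have /andP[+ _] := h1 x x01 xa.
    by rewrite (_ : 1 - 2^-1 = 2^-1 :> R)//; field.
  by rewrite (le_trans _ (h2 b bp ba))// mulrC -ler_pdivlMr// ge_min lexx orbT.
have monoP a r r' : P a r -> 0 < r' -> r' <= r -> P a r'.
  move=> [h1 h2] r'0 rr; split=> [x x01 xa|b bp ba].
    by apply: h1 => //; exact: lt_le_trans xa rr.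
  by rewrite (le_trans _ (h2 b bp ba))// ler_pM2l.
exact: common_radius locP monoP.
Qed.

(** The mass of a function of the profile at the scale [u] of its argument
    concentrates at the peaks, where [u^(1/q)] is the natural length. *)
Lemma profile_rescaling :
  u n `^ (- q^-1) * \int[mu]_(x in `[0, 1]) H n (g x / u n) @[n --> \oo] -->
  peak_mass q C peaks Hl.
Proof.
have [r r0 rP] := exists_radius.
apply: (@separated_peaks_rescaling r) => // [a /rP[]//|a b /rP[_ h]]; exact: h.
Qed.

Let Hl_ge0 z : 0 <= z -> 0 <= Hl z.
Proof.
move=> z0; have cz : H n z @[n --> \oo] --> Hl z.
  by apply: (@Hcv (fun=> z)) => //; exact: cvg_cst.
rewrite -(cvg_lim _ cz)//; apply: limr_ge; first by apply/cvg_ex; exists (Hl z).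
by apply: nearW => n; have /andP[] := @Hbd n z z0.
Qed.

(* an interval of values of [z] is an interval of values of [y] *)
Let blowup_mass_gt0 (a Z : R) : a \in peaks -> 0 <= Z ->
  (forall Z', exists2 c, 0 < c & forall z, Z <= z <= Z' -> c <= Hl z) ->
  0 < \int[mu]_(y in blowup a) Hl (C * `|y| `^ q).
Proof.
move=> ap Z0 Hpos; have [r r0 rP] := exists_radius.
have [inta _] := single_peak_rescaling q0 C0 pg u0 ucv mH Hbd s0 sq1 Hcv ap r0 (rP a ap).1.
pose y0 := (Z / C) `^ q^-1.
have y00 : 0 <= y0 by exact: powR_ge0.
have Cy0 : C * y0 `^ q = Z.
  by rewrite /y0 -powRrM mulVf ?gt_eqF// powRr1 ?divr_ge0 ?(ltW C0)// mulrC divfK// gt_eqF.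
have [c c0 Hc] := Hpos (C * (y0 + 1) `^ q).
pose A : set R := if a == 1 then `[- y0 - 1, - y0]%classic else `[y0, y0 + 1]%classic.
have mA : measurable A by rewrite /A; case: ifPn.
have muA : mu A = 1%E.
  rewrite /A; case: ifPn => _; rewrite lebesgue_measure_itv/= lte_fin.
    by rewrite gtrBl ltr01 -EFinB; congr EFin; ring.
  by rewrite ltrDl ltr01 -EFinB; congr EFin; ring.
have Aabs y : A y -> y0 <= `|y| <= y0 + 1.
  rewrite /A; case: ifPn => _; rewrite /= in_itv/= => /andP[h1 h2].
    by rewrite ler0_norm; [apply/andP; split; lra|lra].
  by rewrite ger0_norm; [apply/andP; split; lra|lra].
have AB : A `<=` blowup a.
  rewrite /A; case: ifPn => [/eqP a1|a1] y; rewrite /= in_itv/= => /andP[h1 h2].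
    by split => [a0|_]; [move: a1; rewrite a0 => /eqP; rewrite eq_sym oner_eq0|lra].
  by split => [_|/eqP]; [lra|rewrite (negbTE a1)].
have mB := measurable_blowup a.
have Hl0 y : 0 <= Hl (C * `|y| `^ q).
  by apply: Hl_ge0; rewrite mulr_ge0 ?powR_ge0// ltW.
have cA : (c%:E <= \int[mu]_(y in A) (Hl (C * `|y| `^ q))%:E)%E.
  have -> : c%:E = (\int[mu]_(y in A) c%:E)%E.
    by rewrite integral_cst// [X in (_ * X)%E]muA mule1.
  apply: ge0_le_integral => //=.
  - by move=> y _; rewrite lee_fin ltW.
  - apply: (@measurable_funS _ _ (measurableTypeR R) _ _ _ _ mB AB).
    exact: measurable_int inta.
  - move=> y Ay; rewrite lee_fin; apply: Hc; have /andP[h1 h2] := Aabs y Ay.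
    rewrite -Cy0 !ler_pM2l//; apply/andP; split.
      by apply: (ge0_ler_powR (ltW q0)); rewrite ?nnegrE.
    by apply: (ge0_ler_powR (ltW q0)); rewrite ?nnegrE ?addr_ge0.
have AleB : (\int[mu]_(y in A) (Hl (C * `|y| `^ q))%:E <=
    \int[mu]_(y in blowup a) (Hl (C * `|y| `^ q))%:E)%E.
  apply: ge0_subset_integral => //=; first exact: measurable_int inta.
  by move=> y _; rewrite lee_fin.
have fin : (\int[mu]_(y in blowup a) (Hl (C * `|y| `^ q))%:E)%E \is a fin_num.
  exact: integrable_fin_num.
by apply: (lt_le_trans c0); rewrite -lee_fin /Rintegral fineK// (le_trans cA).
Qed.

(** The threshold [Z] allows limits [Hl] that vanish at a point, such as the
    centred gradient does. *)
Lemma peak_mass_gt0 (Z : R) : 0 <= Z ->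
  (forall Z', exists2 c, 0 < c & forall z, Z <= z <= Z' -> c <= Hl z) ->
  0 < peak_mass q C peaks Hl.
Proof.
move=> Z0 Hpos; rewrite /peak_mass.
have neq0_mem (l : seq R) : l != [::] -> exists b, b \in l.
  by case: l => [//|b t _]; exists b; rewrite mem_head.
have [b] := neq0_mem _ (profile_peaks_neq0 pg); rewrite -mem_undup => bp.
rewrite (bigD1_seq b) ?undup_uniq//= ltr_pwDl//.
  by apply: (@blowup_mass_gt0 b Z) => //; rewrite -mem_undup.
rewrite big_seq_cond sumr_ge0// => a /andP[ap _]; apply: ltW.
by apply: (@blowup_mass_gt0 a Z) => //; rewrite -mem_undup.
Qed.

End rescaling.

(** * Moments of the profile *)

(** The integrals [Kbar] of the representation, freed of a power of [lam * eta];
    the variable [e] is the gap [(lam * eta)^-1 - M0]. *)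
Definition profile_moment (R : realType) (g : R -> R) (s e : R) : R :=
  \int[@lebesgue_measure R]_(x in `[0, 1]) (e + g x) `^ (- s).

Section moments.
Context {R : realType}.
Notation mu := (@lebesgue_measure R).
Variables (q C : R) (peaks : seq R) (g : R -> R).
Hypotheses (q0 : 0 < q) (C0 : 0 < C) (pg : peak_profile q C peaks g).

Let mg : measurable_fun setT g. Proof. exact: profile_measurable pg. Qed.

Let g_ge0 := profile_ge0 pg.

Lemma measurable_shifted_profile_powR (e s : R) :
  measurable_fun setT (fun x => (e + g x) `^ (- s)).
Proof.
apply: (@measurableT_comp _ _ _ _ _ _ (@powR R ^~ (- s))) => //.
exact: measurable_funD.
Qed.

Lemma shifted_profile_gt0 (e x : R) : 0 < e -> 0 < e + g x.
Proof. by move=> e0; rewrite ltr_pwDl// g_ge0. Qed.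

Lemma shifted_profile_powR_le (e s x : R) : 0 <= s -> 0 < e ->
  (e + g x) `^ (- s) <= e `^ (- s).
Proof. by move=> s0 e0; apply: le_powRN => //; rewrite lerDl g_ge0. Qed.

Lemma integrable_shifted_profile_powR (e s : R) : 0 <= s -> 0 < e ->
  mu.-integrable `[0, 1] (fun x => ((e + g x) `^ (- s))%:E).
Proof.
move=> s0 e0; apply: (@integrable_sub_unit _ _ _ (e `^ (- s))) => //.
  by apply: measurable_funTS; exact: measurable_shifted_profile_powR.
by move=> x _; rewrite ger0_norm ?powR_ge0// shifted_profile_powR_le.
Qed.

Lemma profile_moment_ge (s : R) : 0 <= s ->
  exists2 B, 0 <= B & forall e, 0 < e -> (e + B) `^ (- s) <= profile_moment g s e.
Proof.
move=> s0; have [B gB] := profile_bounded pg.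
have B0 : 0 <= B by have /andP[h1 h2] := gB 0; exact: le_trans h2.
exists B => // e e0; set m := _ `^ _.
have m01 : measurable (`[0, 1]%classic : set R) by [].
have -> : m = \int[mu]_(x in `[0, 1]) cst m x.
  by rewrite Rintegral_cst//= lebesgue_measure_itv/= lte_fin ltr01 oppr0 addr0 mulr1.
apply: le_Rintegral => //.
- by apply: (@integrable_sub_unit _ _ _ `|m|).
- exact: integrable_shifted_profile_powR.
- move=> x _; apply: le_powRN => //; first exact: shifted_profile_gt0.
  by apply: lerD => //; have /andP[] := gB x.
Qed.

Lemma profile_moment_gt0 (s e : R) : 0 <= s -> 0 < e -> 0 < profile_moment g s e.
Proof.
move=> s0 e0; have [B B0 BP] := profile_moment_ge s0.
by apply: lt_le_trans (BP e e0); rewrite powR_gt0// ltr_pwDl.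
Qed.

Let powR_decay_family (s : R) : 0 < s ->
  forall (z_ : nat -> R) z, (forall n, 0 <= z_ n) ->
  z_ n @[n --> \oo] --> z -> (1 + z_ n) `^ (- s) @[n --> \oo] --> (1 + z) `^ (- s).
Proof.
move=> s0 z_ z z_0 cz.
have z0 : 0 <= z.
  rewrite -(cvg_lim _ cz)//; apply: limr_ge; first by apply/cvg_ex; exists z.
  exact: nearW.
apply: cvg_powR; first by rewrite ltr_pwDl.
by apply: cvgD => //; exact: cvg_cst.
Qed.

Let measurable_powR_decay (s : R) :
  measurable_fun setT (fun z : R => (1 + z) `^ (- s)).
Proof.
apply: (@measurableT_comp _ _ _ _ _ _ (@powR R ^~ (- s))) => //.
exact: measurable_funD.
Qed.

(** Above the critical exponent [1 / q] the moment concentrates at the peaks: it is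
    [e^(-s)] times the mass, of order [e^(1/q)], of the region where [g] is
    comparable to [e]. *)
Lemma profile_moment_supercritical (s : R) : 0 < s -> 1 < s * q ->
  exists2 c : R, 0 < c &
    e `^ (s - q^-1) * profile_moment g s e @[e --> 0^'+] --> c.
Proof.
move=> s0 sq1.
have bd (n : nat) (z : R) : 0 <= z -> 0 <= (1 + z) `^ (- s) <= 1 * (1 + z) `^ (- s).
  by move=> _; rewrite mul1r powR_ge0 lexx.
exists (peak_mass q C peaks (fun z => (1 + z) `^ (- s))).
  have c0 n : 0 < n.+1%:R^-1 :> R by rewrite invr_gt0.
  apply: (peak_mass_gt0 q0 C0 pg c0 (@cvg_harmonic R)
    (fun _ => measurable_powR_decay s) bd s0 sq1 (powR_decay_family s0) (lexx 0)).
  move=> Z'; exists ((1 + `|Z'|) `^ (- s)); first by rewrite powR_gt0// ltr_pwDl.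
  move=> z /andP[z0 zZ]; apply: le_powRN; first exact: ltW.
    by rewrite ltr_pwDl.
  by rewrite lerD2l (le_trans zZ)// ler_norm.
apply/cvg_at_rightP => u [u0 ucv].
have := profile_rescaling q0 C0 pg u0 ucv
  (fun _ => measurable_powR_decay s) bd s0 sq1 (powR_decay_family s0).
apply: cvg_trans; apply: near_eq_cvg; apply: nearW => n /=.
have un := u0 n.
have E : profile_moment g s (u n) =
    u n `^ (- s) * \int[mu]_(x in `[0, 1]) (1 + g x / u n) `^ (- s).
  rewrite -RintegralZl//.
    apply: eq_Rintegral => x _; rewrite -powRM ?(ltW un)//.
      by congr (_ `^ _); field; rewrite gt_eqF.
    by rewrite addr_ge0// divr_ge0 ?g_ge0// ltW.
  apply: (@integrable_sub_unit _ _ _ 1) => //.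
    apply: measurable_funTS; apply: (measurableT_comp (measurable_powR_decay s)).
    exact: measurable_funM.
  move=> x _; rewrite ger0_norm ?powR_ge0//.
  have := @le_powRN _ s 1 (1 + g x / u n) (ltW s0) ltr01; rewrite powR1; apply.
  by rewrite lerDl divr_ge0 ?g_ge0// ltW.
rewrite E mulrA -powRD; last by rewrite (gt_eqF un) implybT.
by congr (_ `^ _ * _); ring.
Qed.

End moments.

Section subcritical.
Context {R : realType}.
Notation mu := (@lebesgue_measure R).
Variables (q C : R) (peaks : seq R) (g : R -> R).
Hypotheses (q0 : 0 < q) (C0 : 0 < C) (pg : peak_profile q C peaks g).

Let g_ge0 := profile_ge0 pg.

Lemma profile_gt0 x : 0 <= x <= 1 -> x \notin peaks -> 0 < g x.
Proof.
move=> x01 xp; have [r r0 sep] := peaks_separated peaks x.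
have [d d0 away] := profile_away pg r0.
apply: lt_le_trans d0 (away x x01 _) => a ap; rewrite distrC; apply: sep => //.
by apply: contraNneq xp => <-.
Qed.

Definition off_peaks : set R := `[0, 1]%classic `\` [set` peaks].

Let finite_peaks : finite_set [set` peaks]. Proof. exact: finite_seq. Qed.

Let measurable_peaks : measurable ([set` peaks] : set R).
Proof. exact: countable_measurable (finite_set_countable finite_peaks). Qed.

Lemma measurable_off_peaks : measurable off_peaks.
Proof. exact: measurableD. Qed.

Lemma Rintegral_off_peaks (f : R -> R) :
  \int[mu]_(x in `[0, 1]) f x = \int[mu]_(x in off_peaks) f x.
Proof.
rewrite /Rintegral integral_mkcond [in RHS]integral_mkcond; congr fine.
apply: (@eq_integral_off_null _ (measurableTypeR R) R mu _ _ _ _ measurable_peaks).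
  exact: countable_lebesgue_measure0 (finite_set_countable finite_peaks).
move=> x _ xp; rewrite !patchE /off_peaks; congr (if _ then _ else _).
by apply/idP/idP => /set_mem h; apply/mem_set; [split|case: h].
Qed.

(** One power bound on the whole interval: near a peak by the local behaviour,
    and elsewhere because [g] is bounded below and [|x - a| <= 1]. *)
Lemma profile_ge_power : exists2 c, 0 < c & forall x, 0 <= x <= 1 ->
  exists2 a, a \in peaks & c * `|x - a| `^ q <= g x.
Proof.
have half0 : 0 < 2^-1 :> R by rewrite invr_gt0.
pose P a r := forall x, 0 <= x <= 1 -> `|x - a| < r ->
  2^-1 * (C * `|x - a| `^ q) <= g x.
have locP a : a \in peaks -> exists2 r, 0 < r & P a r.
  move=> ap; have [r r0 h] := profile_local pg ap half0; exists r => // x x01 xa.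
  by have /andP[+ _] := h x x01 xa; rewrite (_ : 1 - 2^-1 = 2^-1 :> R)//; field.
have monoP a r r' : P a r -> 0 < r' -> r' <= r -> P a r'.
  by move=> h _ rr x x01 xa; apply: h => //; exact: lt_le_trans xa rr.
have [r r0 rP] := common_radius locP monoP.
have [d d0 away] := profile_away pg r0.
exists (Num.min (2^-1 * C) d); first by rewrite lt_min d0 mulr_gt0.
move=> x x01; have [[a ap xa]|far] := pselect (exists2 a, a \in peaks & `|x - a| < r).
  exists a => //; apply: le_trans (rP a ap x x01 xa).
  by rewrite mulrA ler_wpM2r ?powR_ge0// ge_min lexx.
have neq0_mem (l : seq R) : l != [::] -> exists b, b \in l.
  by case: l => [//|b t _]; exists b; rewrite mem_head.
have [a ap] := neq0_mem _ (profile_peaks_neq0 pg); exists a => //.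
apply: (@le_trans _ _ d); last first.
  apply: away => // b bp; rewrite leNgt; apply/negP => xb.
  by apply: far; exists b.
have xa1 : `|x - a| <= 1.
  have := profile_peaks_in pg ap; move: x01 => /andP[? ?] /andP[? ?].
  by rewrite ler_norml; apply/andP; split; lra.
rewrite -[leRHS]mulr1 ler_pM ?powR_ge0//.
- by rewrite le_min (ltW d0) mulr_ge0 ?ltW.
- by rewrite ge_min lexx orbT.
have := @ge0_ler_powR _ _ (ltW q0) `|x - a| 1; rewrite powR1 !nnegrE.
by apply.
Qed.

(** [g^(-s)] is dominated by a sum of powers [|x - a|^(-s q)] over the peaks. *)
Lemma integrable_profile_powR (s : R) : 0 < s -> s * q < 1 ->
  mu.-integrable off_peaks (fun x => (g x `^ (- s))%:E).
Proof.
move=> s0 sq1; have [c c0 hc] := profile_ge_power.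
have mD := measurable_off_peaks.
have D01 : off_peaks `<=` `[0, 1]%classic by exact: subDsetl.
have m01 : measurable (`[0, 1]%classic : set R) by [].
pose F (a x : R) : R := c `^ (- s) * `|x - a| `^ (- (s * q)).
have intF a : a \in peaks -> mu.-integrable off_peaks (EFin \o F a).
  move=> ap; have a01 := profile_peaks_in pg ap.
  have h1 := integrable_power_singularity (ltW (mulr_gt0 s0 q0)) sq1 a01.
  have h2 := @integrableS _ (measurableTypeR R) R mu _ _ _ m01 mD D01 h1.
  have := @integrableZl _ (measurableTypeR R) R mu off_peaks mD (c `^ (- s)) _ h2.
  by apply: eq_integrable => // x _; rewrite /F /= EFinM.
have intS : mu.-integrable off_peaks (fun x => \sum_(a <- peaks | a \in peaks) (F a x)%:E)%E.
  exact: integrable_sum.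
apply: le_integrable intS => //.
  apply/measurable_EFinP; apply: measurable_funTS.
  apply: (@measurableT_comp _ _ _ _ _ _ (@powR R ^~ (- s))) => //.
  exact: profile_measurable pg.
move=> x Dx; rewrite sumEFin /= lee_fin.
have F0 a : 0 <= F a x by rewrite mulr_ge0 ?powR_ge0.
rewrite !ger0_norm ?powR_ge0 ?sumr_ge0//.
have [[x01 xp]] : (0 <= x <= 1) /\ x \notin peaks.
  by case: Dx => /=; rewrite in_itv/= => -> /negP.
have [a ap ga] := hc x x01.
have xa : 0 < `|x - a|.
  by rewrite normr_gt0 subr_eq0; apply: contraNneq xp => ->.
rewrite -big_seq (big_rem a)//= (le_trans _ (_ : F a x <= _))//; last first.
  by rewrite lerDl sumr_ge0.
have := le_powRN (ltW s0) (mulr_gt0 c0 (powR_gt0 q xa)) ga.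
by rewrite powRM ?powR_ge0 ?(ltW c0)// -powRrM mulrN (mulrC q).
Qed.

(** Below the critical exponent [1 / q] nothing concentrates, and the moment has
    the integral of [g^(-s)] for limit. *)
Lemma profile_moment_subcritical (s : R) : 0 < s -> s * q < 1 ->
  exists2 l : R, 0 < l & profile_moment g s e @[e --> 0^'+] --> l.
Proof.
move=> s0 sq1; have intg := integrable_profile_powR s0 sq1.
have lim : profile_moment g s e @[e --> 0^'+] -->
    \int[mu]_(x in off_peaks) g x `^ (- s).
  apply/cvg_at_rightP => u [u0 ucv].
  rewrite /profile_moment; under eq_fun do rewrite Rintegral_off_peaks.
  have inP x : off_peaks x -> 0 < g x.
    move=> [/= x01 xp]; move: x01; rewrite in_itv/= => x01.
    by apply: profile_gt0 => //; exact/negP.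
  have cv x : off_peaks x -> (u n + g x) `^ (- s) @[n --> \oo] --> g x `^ (- s).
    move=> /inP gx; apply: cvg_powR => //.
    by rewrite -[X in _ --> X]add0r; apply: cvgD => //; exact: cvg_cst.
  have bd n x : off_peaks x -> `|(u n + g x) `^ (- s)| <= g x `^ (- s).
    move=> /inP gx; rewrite ger0_norm ?powR_ge0//; apply: (le_powRN (ltW s0)) => //.
    by rewrite lerDr ltW.
  have [_ lim] := @Rintegral_dominated_cvg _ (measurableTypeR R) R mu off_peaks
    (fun n x => (u n + g x) `^ (- s)) (fun x => g x `^ (- s)) (fun x => g x `^ (- s))
    measurable_off_peaks
    (fun n => measurable_funTS (measurable_shifted_profile_powR pg (u n) s))
    cv intg bd.
  exact: lim.
exists (\int[mu]_(x in off_peaks) g x `^ (- s)) => //.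
have [B B0 BP] := profile_moment_ge pg (ltW s0).
apply: (@lt_le_trans _ _ ((1 + B) `^ (- s))); first by rewrite powR_gt0// ltr_pwDl.
rewrite -(cvg_lim _ lim)//; apply: limr_ge; first by apply/cvg_ex; eexists; exact: lim.
near=> e; have e0 : 0 < e by [].
apply: le_trans (BP e e0); apply: (le_powRN (ltW s0)).
  by rewrite ltr_pwDl.
by rewrite lerD2r; near: e; exact: nbhs_right_le.
Unshelve. all: by end_near. Qed.

End subcritical.

(** * The norms as functions of the gap *)

(** With [e = (lam * eta)^-1 - M0], all powers of [lam * eta] cancel in the
    representation of the solution: [gradient_at g lam e G] is the value of [u_x]
    at a characteristic where [M0 - u0' = G], and [jacobian_at] that of
    [gam_alpha]. *)
Definition gradient_at (R : realType) (g : R -> R) (lam e G : R) : R :=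
  profile_moment g lam^-1 e `^ (- (2 * lam)) *
  ((e + G)^-1 - profile_moment g (1 + lam^-1) e / profile_moment g lam^-1 e).

Definition jacobian_at (R : realType) (g : R -> R) (lam e G : R) : R :=
  (e + G) `^ (- lam^-1) / profile_moment g lam^-1 e.

Definition gradient_norm (R : realType) (g : R -> R) (lam p e : R) : R :=
  \int[@lebesgue_measure R]_(x in `[0, 1])
    (`|gradient_at g lam e (g x)| `^ p * jacobian_at g lam e (g x)).

Section gradient_norm.
Context {R : realType}.
Notation mu := (@lebesgue_measure R).
Variables (q C : R) (peaks : seq R) (g : R -> R).
Hypotheses (q0 : 0 < q) (C0 : 0 < C) (pg : peak_profile q C peaks g).
Variable lam : R.
Hypothesis lam0 : 0 < lam.

Let s := lam^-1.
Let s0 : 0 < s. Proof. by rewrite invr_gt0. Qed.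
Let th := profile_moment g s.
Let th1 := profile_moment g (1 + s).
Let s10 : 0 < 1 + s. Proof. by rewrite addr_gt0. Qed.
Let th_gt0 e : 0 < e -> 0 < th e.
Proof. by move=> e0; apply: (profile_moment_gt0 pg) => //; exact: ltW. Qed.
Let th1_gt0 e : 0 < e -> 0 < th1 e.
Proof. by move=> e0; apply: (profile_moment_gt0 pg) => //; exact: ltW. Qed.

Let g_ge0 := profile_ge0 pg.
Let mg : measurable_fun setT g. Proof. exact: profile_measurable pg. Qed.

Section slow.
Hypothesis lamq : lam < q.

Let sq1 : 1 < s * q. Proof. by rewrite mulrC ltr_pdivlMr// mul1r. Qed.
Let s1q1 : 1 < (1 + s) * q.
Proof. by rewrite (lt_trans sq1)// ltr_pM2r// ltrDr. Qed.

Let A e := e `^ (s - q^-1) * th e.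
Let B e := e `^ (1 + s - q^-1) * th1 e.

Let A_gt0 e : 0 < e -> 0 < A e.
Proof. by move=> e0; rewrite mulr_gt0 ?powR_gt0// th_gt0. Qed.

Let th_rescaled e : 0 < e -> th e = e `^ (q^-1 - s) * A e.
Proof.
move=> e0; rewrite /A mulrA -powRD ?(gt_eqF e0) ?implybT//.
by rewrite (_ : q^-1 - s + (s - q^-1) = 0) ?powRr0 ?mul1r//; ring.
Qed.

Lemma gradient_at_rescaled e G : 0 < e -> 0 <= G ->
  gradient_at g lam e G =
  A e `^ (- (2 * lam)) * e `^ (1 - 2 * lam / q) * ((1 + G / e)^-1 - B e / A e).
Proof.
move=> e0 G0; rewrite /gradient_at -/s -/th -/th1.
have thE := th_rescaled e0.
have E1 : th e `^ (- (2 * lam)) = A e `^ (- (2 * lam)) * (e `^ (1 - 2 * lam / q) * e).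
  rewrite thE powRM ?powR_ge0 ?(ltW (A_gt0 e0))// mulrC; congr (_ * _).
  rewrite -powRrM -[X in _ = _ * X](powRr1 (ltW e0)) -powRD ?(gt_eqF e0) ?implybT//.
  by congr (_ `^ _); rewrite /s; field; rewrite !gt_eqF.
have E2 : e * (th1 e / th e) = B e / A e.
  rewrite /A /B invfM.
  have -> : e `^ (1 + s - q^-1) = e * e `^ (s - q^-1).
    rewrite (_ : 1 + s - q^-1 = 1 + (s - q^-1)); last by ring.
    by rewrite powRD ?(gt_eqF e0) ?implybT// powRr1// ltW.
  by field; rewrite !gt_eqF ?th_gt0 ?powR_gt0.
have E3 : e * (e + G)^-1 = (1 + G / e)^-1.
  by field; rewrite !gt_eqF ?ltr_pwDl ?divr_ge0//; lra.
by rewrite E1 -E2 -E3; ring.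
Qed.

Let c0P := profile_moment_supercritical q0 C0 pg s0 sq1.
Let c1P := profile_moment_supercritical q0 C0 pg s10 s1q1.

(** At the critical exponent [lam = q / 2] the gradient survives: the limit has
    one value at the peaks and another, nonzero one, at all other points. *)
Lemma gradient_at_critical : lam = q / 2 ->
  exists K k : R, [/\ 0 < K, 0 < k &
    forall G, 0 <= G ->
      gradient_at g lam e G @[e --> 0^'+] --> K * ((G == 0)%:R - k)].
Proof.
move=> lq; have [c0 c00 cA] := c0P; have [c1 c10 cB] := c1P.
exists (c0 `^ (- (2 * lam))), (c1 / c0); split; [exact: powR_gt0|exact: divr_gt0|].
move=> G G0.
have cAB : A e `^ (- (2 * lam)) * ((1 + G / e)^-1 - B e / A e) @[e --> 0^'+] -->
    c0 `^ (- (2 * lam)) * ((G == 0)%:R - c1 / c0).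
  apply: cvgM; first exact: cvg_powR.
  apply: cvgB; last by apply: cvgM => //; apply: cvgV => //; rewrite gt_eqF.
  have [->|G_neq0] := eqVneq G 0.
    by under eq_fun do rewrite mul0r addr0 invr1; exact: cvg_cst.
  have Gp : 0 < G by rewrite lt_neqAle eq_sym G_neq0.
  have : e * (e + G)^-1 @[e --> 0^'+] --> 0 * (0 + G)^-1.
    apply: cvgM; first exact: cvg_at_right_filter.
    apply: cvgV; first by rewrite add0r.
    by apply: cvgD; [exact: cvg_at_right_filter|exact: cvg_cst].
  rewrite mul0r; apply: cvg_trans; apply: near_eq_cvg; near=> e.
  have e0 : 0 < e by [].
  by field; rewrite !gt_eqF ?ltr_pwDl ?divr_ge0//; lra.
apply: cvg_trans cAB; apply: near_eq_cvg; near=> e; have e0 : 0 < e by [].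
rewrite gradient_at_rescaled//.
by rewrite (_ : 1 - 2 * lam / q = 0) ?powRr0 ?mulr1// lq; field; rewrite gt_eqF.
Unshelve. all: by end_near. Qed.

(** For [lam < q] the integrals concentrate at the peaks, and the norm is a pure
    power of [e] up to a constant; [lam = q / 2] is where the power vanishes. *)
Lemma gradient_norm_slow (p : R) : 0 < p ->
  exists2 L : R, 0 < L &
    e `^ (- (p * (1 - 2 * lam / q))) * gradient_norm g lam p e @[e --> 0^'+] --> L.
Proof.
move=> p0; have [c0 c00 cA] := c0P; have [c1 c10 cB] := c1P.
set k := c1 / c0; have k0 : 0 < k by exact: divr_gt0.
pose Hl (z : R) := `|(1 + z) `^ (- 1) - k| `^ p * (1 + z) `^ (- s).
have main (u : nat -> R) : (forall n, 0 < u n) -> u n @[n --> \oo] --> 0 ->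
    0 < peak_mass q C peaks Hl /\
    u n `^ (- (p * (1 - 2 * lam / q))) * gradient_norm g lam p (u n) @[n --> \oo] -->
    c0 `^ (- (2 * lam * p + 1)) * peak_mass q C peaks Hl.
  move=> u0 ucv.
  have cAu : A (u n) @[n --> \oo] --> c0.
    by move/cvg_at_rightP : cA; apply; split.
  have cBu : B (u n) @[n --> \oo] --> c1.
    by move/cvg_at_rightP : cB; apply; split.
  pose kn n := B (u n) / A (u n).
  have ck : kn n @[n --> \oo] --> k.
    by apply: cvgM => //; apply: cvgV => //; rewrite gt_eqF.
  have [K [Kr HK]] := cvg_seq_bounded (cvgP _ ck).
  pose K' := `|K| + 1; have K'0 : 0 < K' by rewrite ltr_wpDl.
  have kK n : `|kn n| <= K'.
    by apply: HK => //; rewrite (le_lt_trans (ler_norm K))// ltrDl.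
  pose H n (z : R) := `|(1 + z) `^ (- 1) - kn n| `^ p * (1 + z) `^ (- s).
  have mH n : measurable_fun setT (H n).
    have m1 : measurable_fun setT (fun z : R => 1 + z) by exact: measurable_funD.
    apply: measurable_funM.
      apply: (@measurableT_comp _ _ _ _ _ _ (@powR R ^~ p)) => //.
      apply: measurableT_comp => //; apply: measurable_funB => //.
      exact: (@measurableT_comp _ _ _ _ _ _ (@powR R ^~ (- 1))).
    exact: (@measurableT_comp _ _ _ _ _ _ (@powR R ^~ (- s))).
  have Hbd n z : 0 <= z -> 0 <= H n z <= (1 + K') `^ p * (1 + z) `^ (- s).
    move=> z0; rewrite mulr_ge0 ?powR_ge0//= ler_wpM2r ?powR_ge0//.
    apply: (ge0_ler_powR (ltW p0)); rewrite ?nnegrE ?addr_ge0 ?(ltW K'0)//.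
    rewrite (le_trans (ler_normB _ _))// lerD// powR_inv1 ?addr_ge0//.
    by rewrite ger0_norm ?invr_ge0 ?addr_ge0// invf_le1 ?lerDl// ltr_pwDl.
  have Hcv (z_ : nat -> R) (z : R) : (forall n, 0 <= z_ n) -> z_ n @[n --> \oo] --> z ->
      H n (z_ n) @[n --> \oo] --> Hl z.
    move=> z_0 cz; have z0 : 0 <= z.
      rewrite -(cvg_lim _ cz)//; apply: limr_ge; first by apply/cvg_ex; exists z.
      exact: nearW.
    have z1 : 0 < 1 + z by rewrite ltr_pwDl.
    have cz1 : 1 + z_ n @[n --> \oo] --> 1 + z by apply: cvgD => //; exact: cvg_cst.
    apply: cvgM; last exact: cvg_powR.
    by apply: cvg_norm_powR => //; apply: cvgB => //; exact: cvg_powR.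
  split.
    apply: (peak_mass_gt0 q0 C0 pg u0 ucv mH Hbd s0 sq1 Hcv (_ : 0 <= 2 / k)).
      by rewrite divr_ge0// ltW.
    move=> Z'; exists ((k / 2) `^ p * (1 + `|Z'|) `^ (- s)).
      by rewrite mulr_gt0// powR_gt0 ?divr_gt0// ltr_pwDl.
    move=> z /andP[kz zZ].
    have z0 : 0 <= z by rewrite (le_trans _ kz)// divr_ge0// ltW.
    have z1 : 0 < 1 + z by rewrite ltr_pwDl.
    apply: ler_pM; rewrite ?powR_ge0//.
      apply: (ge0_ler_powR (ltW p0)); [|by rewrite nnegrE|].
        by rewrite nnegrE divr_ge0// ltW.
      have h : (1 + z)^-1 <= k / 2.
        rewrite -[leRHS]invrK lef_pV2 ?posrE ?invr_gt0 ?divr_gt0// invf_div.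
        by rewrite (le_trans kz)// lerDr.
      by rewrite powR_inv1 ?(ltW z1)// distrC (le_trans _ (ler_norm _))//; lra.
    apply: (le_powRN (ltW s0)) => //.
    by rewrite lerD2l (le_trans zZ)// ler_norm.
  have cI := profile_rescaling q0 C0 pg u0 ucv mH Hbd s0 sq1 Hcv.
  have cAp : A (u n) `^ (- (2 * lam * p + 1)) @[n --> \oo] --> c0 `^ (- (2 * lam * p + 1)).
    exact: cvg_powR.
  have E n : u n `^ (- (p * (1 - 2 * lam / q))) * gradient_norm g lam p (u n) =
      A (u n) `^ (- (2 * lam * p + 1)) *
      (u n `^ (- q^-1) * \int[mu]_(x in `[0, 1]) H n (g x / u n)).
    have un := u0 n; have An := A_gt0 un.
    rewrite mulrA; set c := A (u n) `^ _ * _.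
    pose c' := c * u n `^ (p * (1 - 2 * lam / q)).
    have zge x : 0 <= g x / u n by rewrite divr_ge0// ltW.
    have mQ : measurable_fun setT (fun x => H n (g x / u n)).
      by apply: (measurableT_comp (mH n)); exact: measurable_funM.
    have iQ : mu.-integrable `[0, 1] (fun x => (H n (g x / u n))%:E).
      apply: (@integrable_sub_unit _ _ _ ((1 + K') `^ p)) => //.
        exact: measurable_funTS.
      move=> x _; have /andP[h1 h2] := @Hbd n _ (zge x).
      rewrite ger0_norm// (le_trans h2)// ler_piMr ?powR_ge0//.
      have := @le_powRN _ s 1 (1 + g x / u n) (ltW s0) ltr01; rewrite powR1; apply.
      by rewrite lerDl.
    have -> : gradient_norm g lam p (u n) = c' * \int[mu]_(x in `[0, 1]) H n (g x / u n).
      rewrite /gradient_norm -RintegralZl//.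
      apply: eq_Rintegral => x _; have z0 := zge x.
      rewrite gradient_at_rescaled// /jacobian_at -/s -/th /H -/(kn n) powR_inv1 ?addr_ge0//.
      have -> : (u n + g x) `^ (- s) = u n `^ (- s) * (1 + g x / u n) `^ (- s).
        rewrite -powRM ?(ltW un) ?addr_ge0//; congr (_ `^ _).
        by field; rewrite gt_eqF.
      rewrite (th_rescaled un) /c' /c.
      move: (A (u n)) An => a a0; set w := 1 - 2 * lam / q.
      set x1 := a `^ (- (2 * lam)); set x2 := u n `^ w.
      have x10 : 0 <= x1 by exact: powR_ge0.
      have x20 : 0 <= x2 by exact: powR_ge0.
      rewrite normrM (ger0_norm (mulr_ge0 x10 x20)).
      rewrite (powRM _ (mulr_ge0 x10 x20) (normr_ge0 _)) (powRM _ x10 x20).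
      set P := `|_| `^ p; set Q := (1 + _) `^ _.
      have F1 : a `^ (- (2 * lam * p + 1)) = x1 `^ p * a^-1.
        rewrite /x1 -powRrM -(powR_inv1 (ltW a0)) -powRD ?(gt_eqF a0) ?implybT//.
        by congr (_ `^ _); ring.
      have F2 : u n `^ (- q^-1) = u n `^ (- s) * (u n `^ (q^-1 - s))^-1.
        rewrite -powRN -powRD ?(gt_eqF un) ?implybT//.
        by congr (_ `^ _); ring.
      have F3 : u n `^ (p * w) = x2 `^ p by rewrite /x2 -powRrM mulrC.
      rewrite F1 F2 F3; have := powR_gt0 (q^-1 - s) un.
      move: (u n `^ (q^-1 - s)) (x1 `^ p) (x2 `^ p) P Q (u n `^ (- s)).
      by move=> t X1 X2 P Q S t0; field; rewrite !gt_eqF.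
    rewrite mulrA /c' mulrCA -powRD ?(gt_eqF un) ?implybT// addNr powRr0 mulr1//.
  by under eq_fun do rewrite E; exact: cvgM.
have h0 n : 0 < n.+1%:R^-1 :> R by rewrite invr_gt0.
have [m0 _] := main _ h0 (@cvg_harmonic R).
exists (c0 `^ (- (2 * lam * p + 1)) * peak_mass q C peaks Hl).
  by rewrite mulr_gt0// powR_gt0.
by apply/cvg_at_rightP => u [u0 ucv]; have [] := main u u0 ucv.
Qed.

End slow.

Let k (e : R) : R := th1 e / th e.

Let k_ge0 e : 0 < e -> 0 <= k e.
Proof. by move=> e0; rewrite divr_ge0 ?(ltW (th1_gt0 e0)) ?(ltW (th_gt0 e0)). Qed.

Let F (p e x : R) : R := `|(e + g x)^-1 - k e| `^ p * (e + g x) `^ (- s).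

Lemma powR_normB_le (p a b : R) : 0 <= p -> 0 <= a -> 0 <= b ->
  `|a - b| `^ p <= 2 `^ p * (a `^ p + b `^ p).
Proof.
move=> p0 a0 b0; have [ab|ba] := leP a b.
  rewrite (@le_trans _ _ ((2 * b) `^ p))//.
    apply: (ge0_ler_powR p0); rewrite ?nnegrE ?mulr_ge0//.
    by rewrite ler_norml; apply/andP; split; lra.
  by rewrite powRM// ler_wpM2l ?powR_ge0// lerDr powR_ge0.
rewrite (@le_trans _ _ ((2 * a) `^ p))//.
  apply: (ge0_ler_powR p0); rewrite ?nnegrE ?mulr_ge0//.
  by rewrite ler_norml; apply/andP; split; lra.
by rewrite powRM// ler_wpM2l ?powR_ge0// lerDl powR_ge0.
Qed.

Let powR_le_normB (p a b : R) : 0 <= p -> 0 <= a -> 0 <= b ->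
  a `^ p <= 2 `^ p * (`|a - b| `^ p + b `^ p).
Proof.
move=> p0 a0 b0; have [ab|ba] := leP `|a - b| b.
  rewrite (@le_trans _ _ ((2 * b) `^ p))//.
    apply: (ge0_ler_powR p0); rewrite ?nnegrE ?mulr_ge0//.
    by have := ler_norm (a - b); lra.
  by rewrite powRM// ler_wpM2l ?powR_ge0// lerDr powR_ge0.
rewrite (@le_trans _ _ ((2 * `|a - b|) `^ p))//.
  apply: (ge0_ler_powR p0); rewrite ?nnegrE ?mulr_ge0//.
  by have := ler_norm (a - b); lra.
by rewrite powRM// ler_wpM2l ?powR_ge0// lerDl powR_ge0.
Qed.

Let mF p e : 0 < e -> measurable_fun setT (F p e).
Proof.
move=> e0; have m1 := measurable_shifted_profile_powR pg e s.
apply: measurable_funM => //.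
apply: (@measurableT_comp _ _ _ _ _ _ (@powR R ^~ p)) => //.
apply: measurableT_comp => //; apply: measurable_funB => //.
apply: eq_measurable_fun (measurable_shifted_profile_powR pg e 1) => x _.
by rewrite powR_inv1 ?(ltW (shifted_profile_gt0 pg x e0))//.
Qed.

Let iF p e : 0 < p -> 0 < e -> mu.-integrable `[0, 1] (EFin \o F p e).
Proof.
move=> p0 e0; apply: (@integrable_sub_unit _ _ _
  ((e^-1 + k e) `^ p * e `^ (- s))) => //.
  by apply: measurable_funTS; exact: mF.
move=> x _; rewrite ger0_norm ?mulr_ge0 ?powR_ge0// ler_pM ?powR_ge0//.
  have eg := shifted_profile_gt0 pg x e0.
  apply: (ge0_ler_powR (ltW p0)); rewrite ?nnegrE ?addr_ge0 ?invr_ge0 ?k_ge0 ?(ltW e0)//.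
  rewrite (le_trans (ler_normB _ _))// lerD// ger0_norm ?invr_ge0 ?(ltW eg) ?k_ge0//.
  by rewrite lef_pV2 ?posrE// lerDl.
by apply: (shifted_profile_powR_le pg) => //; exact: ltW.
Qed.

Let gradient_normE p e : 0 < p -> 0 < e ->
  gradient_norm g lam p e =
  th e `^ (- (2 * lam * p + 1)) * \int[mu]_(x in `[0, 1]) F p e x.
Proof.
move=> p0 e0; rewrite -RintegralZl//; last exact: iF.
apply: eq_Rintegral => x _; rewrite /gradient_at /jacobian_at -/s -/th -/th1 /F -/(k e).
have := th_gt0 e0; move: (th e) => t t0.
rewrite normrM ger0_norm ?powR_ge0// powRM ?powR_ge0//.
rewrite opprD powRD ?(gt_eqF t0) ?implybT// powR_inv1 ?(ltW t0)//.
by rewrite -powRrM mulNr; ring.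
Qed.

(** If [g^(-(p + 1/lam))] is integrable, nothing concentrates and the norm
    converges by dominated convergence. *)
Lemma gradient_norm_subcritical (p : R) : 1 <= p -> (p + s) * q < 1 ->
  exists l : R, gradient_norm g lam p e @[e --> 0^'+] --> l.
Proof.
move=> p1 psq; have p0 : 0 < p by exact: lt_le_trans p1.
have s1q : (1 + s) * q < 1.
  by apply: le_lt_trans psq; rewrite ler_pM2r// lerD2r.
have sq : s * q < 1 by apply: lt_trans s1q; rewrite ltr_pM2r// ltrDr.
have [l l0 cth] := profile_moment_subcritical q0 C0 pg s0 sq.
have [l1 l10 cth1] := profile_moment_subcritical q0 C0 pg s10 s1q.
have ps0 : 0 < p + s by rewrite addr_gt0.
have intg := integrable_profile_powR q0 C0 pg s0 sq.
have intpg := integrable_profile_powR q0 C0 pg ps0 psq.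
exists (l `^ (- (2 * lam * p + 1)) *
  \int[mu]_(x in off_peaks peaks) (`|(g x)^-1 - l1 / l| `^ p * g x `^ (- s))).
apply/cvg_at_rightP => u [u0 ucv].
have cthu : th (u n) @[n --> \oo] --> l.
  by move/cvg_at_rightP : cth; apply; split.
have cth1u : th1 (u n) @[n --> \oo] --> l1.
  by move/cvg_at_rightP : cth1; apply; split.
have ck : k (u n) @[n --> \oo] --> l1 / l.
  by apply: cvgM => //; apply: cvgV => //; rewrite gt_eqF.
have [K [Kr HK]] := cvg_seq_bounded (cvgP _ ck).
pose K' := `|K| + 1; have K'0 : 0 < K' by rewrite ltr_wpDl.
have kK n : `|k (u n)| <= K'.
  by apply: HK => //; rewrite (le_lt_trans (ler_norm K))// ltrDl.
under eq_fun do rewrite gradient_normE// (Rintegral_off_peaks peaks).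
apply: cvgM; first exact: cvg_powR.
have inP x : off_peaks peaks x -> 0 < g x.
  move=> [/= x01 xp]; move: x01; rewrite in_itv/= => x01.
  by apply: (profile_gt0 pg) => //; exact/negP.
have mD := measurable_off_peaks peaks.
pose dom (x : R) : R := 2 `^ p * g x `^ (- (p + s)) + 2 `^ p * K' `^ p * g x `^ (- s).
have idom : mu.-integrable (off_peaks peaks) (EFin \o dom).
  have h1 := @integrableZl _ (measurableTypeR R) R mu _ mD (2 `^ p) _ intpg.
  have h2 := @integrableZl _ (measurableTypeR R) R mu _ mD (2 `^ p * K' `^ p) _ intg.
  have := @integrableD _ (measurableTypeR R) R mu _ mD _ _ h1 h2.
  by apply: eq_integrable => // x _; rewrite /dom /= EFinD !EFinM.
have cv x : off_peaks peaks x ->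
    F p (u n) x @[n --> \oo] --> `|(g x)^-1 - l1 / l| `^ p * g x `^ (- s).
  move=> /inP gx; have cg : u n + g x @[n --> \oo] --> g x.
    by rewrite -[X in _ --> X]add0r; apply: cvgD => //; exact: cvg_cst.
  apply: cvgM; last exact: cvg_powR.
  by apply: cvg_norm_powR => //; apply: cvgB => //; apply: cvgV => //; rewrite gt_eqF.
have bd n x : off_peaks peaks x -> `|F p (u n) x| <= dom x.
  move=> /inP gx; have un := u0 n; have eg := shifted_profile_gt0 pg x un.
  have gle : g x <= u n + g x by rewrite lerDr ltW.
  rewrite ger0_norm ?mulr_ge0 ?powR_ge0//.
  have X0 : 0 <= (u n + g x)^-1 by rewrite invr_ge0 ltW.
  have h := powR_normB_le (ltW p0) X0 (k_ge0 un).
  rewrite (le_trans (ler_wpM2r (powR_ge0 _ _) h))//.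
  rewrite /dom -[X in _ <= _ + X]mulrA -mulrDr -mulrA ler_wpM2l ?powR_ge0//.
  rewrite mulrDl; apply: lerD.
    rewrite -(powR_inv1 (ltW eg)) -powRrM mulN1r -powRD ?(gt_eqF eg) ?implybT//.
    by rewrite -opprD; apply: le_powRN => //; exact: ltW.
  apply: ler_pM; rewrite ?powR_ge0//.
    apply: (ge0_ler_powR (ltW p0)); rewrite ?nnegrE ?k_ge0 ?(ltW K'0)//.
    by rewrite (le_trans (ler_norm _)).
  by apply: le_powRN => //; exact: ltW.
have [_ lim] := @Rintegral_dominated_cvg _ (measurableTypeR R) R mu (off_peaks peaks)
  (fun n => F p (u n)) _ dom mD (fun n => measurable_funTS (mF p (u0 n))) cv idom bd.
exact: lim.
Qed.

(** If [g^(-1/lam)] is integrable but [g^(-1-1/lam)] is not, then the first term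
    of the gradient dominates its mean in every [L^p] with [p > 1], because
    their norms to the power [p] grow like [e^(1/q - p - 1/lam)] and
    [e^(p (1/q - 1 - 1/lam))]. *)
Lemma gradient_norm_blowup (p : R) : 1 < p -> s * q < 1 -> 1 < (1 + s) * q ->
  gradient_norm g lam p e @[e --> 0^'+] --> +oo.
Proof.
move=> p1 sq s1q; have p0 : 0 < p by exact: lt_trans p1.
have psq : 1 < (p + s) * q.
  by apply: lt_trans s1q _; rewrite ltr_pM2r// ltrD2r.
have ps0 : 0 < p + s by rewrite addr_gt0.
have sqi : 0 < q^-1 - s by rewrite subr_gt0 -(ltr_pM2r q0) mulVf ?gt_eqF.
have psqi : 0 < p + s - q^-1 by rewrite subr_gt0 -(ltr_pM2r q0) mulVf ?gt_eqF.
have [l l0 cth] := profile_moment_subcritical q0 C0 pg s0 sq.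
have [c1 c10 cth1] := profile_moment_supercritical q0 C0 pg s10 s1q.
have [c2 c20 cthp] := profile_moment_supercritical q0 C0 pg ps0 psq.
pose A1 e := e `^ (1 + s - q^-1) * th1 e.
pose A2 e := e `^ (p + s - q^-1) * profile_moment g (p + s) e.
pose low e := th e `^ (- (2 * lam * p + 1)) *
  (2 `^ (- p) * A2 e - A1 e `^ p * th e `^ (1 - p) * e `^ ((p - 1) * (q^-1 - s))).
have lowP e : 0 < e -> low e <= e `^ (p + s - q^-1) * gradient_norm g lam p e.
  move=> e0; have the := th_gt0 e0; have the1 := th1_gt0 e0.
  rewrite gradient_normE// mulrCA ler_wpM2l ?powR_ge0//.
  have low1 : 2 `^ (- p) * profile_moment g (p + s) e - k e `^ p * th e <=
      \int[mu]_(x in `[0, 1]) F p e x.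
    have i1 := integrable_shifted_profile_powR pg (ltW ps0) e0.
    have i2 := integrable_shifted_profile_powR pg (ltW s0) e0.
    have m01 : measurable (`[0, 1]%classic : set (measurableTypeR R)).
      exact: measurable_itv.
    have i1' := @integrableZl _ (measurableTypeR R) R mu _ m01 (2 `^ (- p)) _ i1.
    have i2' := @integrableZl _ (measurableTypeR R) R mu _ m01 (k e `^ p) _ i2.
    rewrite /th /profile_moment -!RintegralZl// -RintegralB//.
    have iB := @integrableB _ (measurableTypeR R) R mu _ m01 _ _ i1' i2'.
    apply: (@le_Rintegral _ (measurableTypeR R) R mu _ _ _ m01 iB (iF p0 e0)).
    move=> x _ /=; have eg := shifted_profile_gt0 pg x e0.
    have X0 : 0 <= (e + g x)^-1 by rewrite invr_ge0 ltW.
    have := powR_le_normB (ltW p0) X0 (k_ge0 e0).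
    have -> : (e + g x) `^ (- (p + s)) = (e + g x)^-1 `^ p * (e + g x) `^ (- s).
      rewrite -(powR_inv1 (ltW eg)) -powRrM mulN1r -powRD ?(gt_eqF eg) ?implybT//.
      by rewrite -opprD.
    rewrite -ler_pdivrMl ?powR_gt0// -powRN => h.
    rewrite mulrA -mulrBl ler_wpM2r ?powR_ge0//; lra.
  rewrite (le_trans _ (ler_wpM2l (powR_ge0 _ _) low1))// le_eqVlt; apply/orP; left.
  have -> : A1 e `^ p * th e `^ (1 - p) * e `^ ((p - 1) * (q^-1 - s)) =
      e `^ (p + s - q^-1) * (k e `^ p * th e).
    rewrite /A1 /k; set X := e `^ (1 + s - q^-1).
    have X0 : 0 <= X by exact: powR_ge0.
    have -> : e `^ (p + s - q^-1) = X `^ p * e `^ ((p - 1) * (q^-1 - s)).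
      rewrite /X -powRrM -powRD ?(gt_eqF e0) ?implybT//.
      by congr (_ `^ _); ring.
    have -> : th e `^ (1 - p) = th e * th e `^ (- p).
      by rewrite powRD ?(gt_eqF the) ?implybT// powRr1 ?(ltW the).
    rewrite powRM ?(ltW the1)// (powRM p (ltW the1)) ?invr_ge0 ?(ltW the)//.
    have -> : (th e)^-1 `^ p = th e `^ (- p).
      by rewrite -(powR_inv1 (ltW the)) -powRrM mulN1r.
    move: (X `^ p) (th1 e `^ p) (th e `^ (- p)) (th e) (e `^ _).
    by move=> *; ring.
  by rewrite mulrBr /A2 mulrCA.
have clow : low e @[e --> 0^'+] --> l `^ (- (2 * lam * p + 1)) * (2 `^ (- p) * c2).
  apply: cvgM; first exact: cvg_powR.
  rewrite -[X in _ --> X]subr0; apply: cvgB; first by apply: cvgM => //; exact: cvg_cst.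
  rewrite -[X in _ --> X](mulr0 (c1 `^ p * l `^ (1 - p))); apply: cvgM.
    by apply: cvgM; exact: cvg_powR.
  by apply: powR_cvg0; rewrite mulr_gt0// subr_gt0.
set m := _ * _ in clow; have m0 : 0 < m by rewrite !mulr_gt0 ?powR_gt0.
apply/cvgryPge => M.
pose N := `|M / (m / 2)| + 1; have N0 : 0 < N by rewrite ltr_wpDl.
near=> e; have e0 : 0 < e by [].
have m2 : m / 2 <= low e.
  near: e; apply: cvgr_ge clow _ _.
  by rewrite ltr_pdivrMr// ltr_pMr// ltr1n.
have := le_trans m2 (lowP e e0).
rewrite -ler_pdivrMl ?powR_gt0// -powRN => h; apply: le_trans h.
rewrite -ler_pdivrMr ?divr_gt0//.
set w := p + s - q^-1 in psqi *.
rewrite (@le_trans _ _ N)//; first by rewrite (le_trans (ler_norm _))// /N lerDl.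
rewrite -[leLHS](powRr1 (ltW N0)) (_ : 1 = - w^-1 * - w); last first.
  by rewrite mulrNN mulVf// gt_eqF.
rewrite powRrM; apply: (le_powRN (ltW psqi)) => //.
by near: e; apply: nbhs_right_le; exact: powR_gt0.
Unshelve. all: by end_near. Qed.

End gradient_norm.

(** * The maximal time *)

Lemma cvg_at_right_gt {R : realType} {I : Type} (F : set_system I) {FF : Filter F}
    (f : I -> R) (x : R) :
  f i @[i --> F] --> x -> (\forall i \near F, x < f i) -> f i @[i --> F] --> x^'+.
Proof.
move=> fx gtx A Ax.
have h : \forall i \near F, x < f i -> A (f i) := fx _ Ax.
by apply: filterS2 gtx h => i xf; apply.
Qed.

Section clock.
Context {R : realType}.
Notation mu := (@lebesgue_measure R).
Variables (q C : R) (peaks : seq R) (g : R -> R) (lam M0 : R).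
Hypotheses (pg : peak_profile q C peaks g) (lam0 : 0 < lam) (M00 : 0 < M0).

Let g_ge0 := profile_ge0 pg.
Let mg : measurable_fun setT g. Proof. exact: profile_measurable pg. Qed.

Let du (x : R) : R := M0 - g x.
Let K0 := Kbar lam du 0.
Let es := eta_star lam M0.

Let es0 : 0 < es. Proof. by rewrite invr_gt0 mulr_gt0. Qed.

(** The distance to blow-up, in the variable that the profile is compared to. *)
Definition gap (e : R) : R := (lam * e)^-1 - M0.

Lemma gap_gt0 e : 0 < e -> e < eta_star lam M0 -> 0 < gap e.
Proof.
move=> e0 ee; have le0 : 0 < lam * e by rewrite mulr_gt0.
rewrite subr_gt0 -[ltLHS]invrK ltf_pV2 ?posrE ?invr_gt0//.
by move: ee; rewrite /eta_star invfM -ltr_pdivlMl// mulrC.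
Qed.

Lemma jac_profile e x : 0 < e ->
  jac lam du e x = lam * e * (gap e + g x).
Proof.
by move=> e0; rewrite /jac /du /gap; field; rewrite !gt_eqF.
Qed.

Lemma Kbar_profile i e : 0 < e -> e < eta_star lam M0 ->
  Kbar lam du i e = (lam * e) `^ (- (i%:R + lam^-1)) *
    profile_moment g (i%:R + lam^-1) (gap e).
Proof.
move=> e0 ee; have le0 : 0 < lam * e by rewrite mulr_gt0.
have ge0 := gap_gt0 e0 ee.
rewrite /Kbar /profile_moment -RintegralZl//; last first.
  apply: (integrable_shifted_profile_powR pg) => //.
  by rewrite addr_ge0// invr_ge0 ltW.
apply: eq_Rintegral => x _; rewrite jac_profile// powRM ?(ltW le0)//.
by rewrite addr_ge0// ltW.
Qed.

Let B_ex : exists2 B, 0 < B & forall x, `|du x| <= B.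
Proof.
have [B gB] := profile_bounded pg.
have B0 : 0 <= B by have /andP[h1 h2] := gB 0; exact: le_trans h2.
exists (M0 + B); first by rewrite ltr_pwDl.
move=> x; have /andP[h1 h2] := gB x.
rewrite /du ler_norml; move: M00 => M0p; apply/andP; split; lra.
Qed.

Let mjac e : measurable_fun setT (jac lam du e).
Proof.
by rewrite /jac; apply: measurable_funB => //; apply: measurable_funM => //;
  exact: measurable_funB.
Qed.

(* negative [e] are included so that [0] is an interior point for the continuity of
   integrals that depend on a parameter *)
Let jac_bounds v : 0 < v -> v < es -> exists d m B' : R,
  [/\ 0 < d, 0 < m & forall e x, - d < e -> e < v -> m <= jac lam du e x <= B'].
Proof.
move=> v0 ves; have [B B0 duB] := B_ex.
have lv1 : lam * v * M0 < 1.
  move: ves; rewrite /es /eta_star -[ltRHS]mul1r ltr_pdivlMr ?mulr_gt0//.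
  by rewrite mulrA (mulrC v).
exists (2 * lam * B)^-1, (Num.min 2^-1 (1 - lam * v * M0)), (1 + lam * v * B + 1).
split.
- by rewrite invr_gt0 !mulr_gt0.
- by rewrite lt_min invr_gt0 ltr0n subr_gt0 lv1.
move=> e x de ev; have := duB x; rewrite ler_norml => /andP[b1 b2].
have duM : du x <= M0 by rewrite /du gerBl.
have lB0 : 0 < lam * B by rewrite mulr_gt0.
rewrite /jac; have [e0|e0] := leP 0 e.
  have h1 : lam * e * du x <= lam * v * M0.
    rewrite (@le_trans _ _ (lam * e * M0))//.
      by rewrite ler_wpM2l// mulr_ge0// ltW.
    by rewrite ler_pM2r// ler_pM2l// ltW.
  have h2 : - (lam * v * B) <= lam * e * du x.
    rewrite (@le_trans _ _ (lam * e * - B))//.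
      rewrite mulrN lerN2 ler_pM2r// ler_pM2l//; exact: ltW.
    by rewrite ler_wpM2l// mulr_ge0// ltW.
  by rewrite ge_min; apply/andP; split; [apply/orP; right|]; lra.
have hd : lam * - e * B <= 2^-1.
  have -> : 2^-1 = lam * (2 * lam * B)^-1 * B :> R by field; rewrite !gt_eqF.
  by rewrite ler_pM2r// ler_pM2l// lerNl ltW.
have h3 : `|lam * e * du x| <= 2^-1.
  rewrite !normrM (gtr0_norm lam0) (ltr0_norm e0) (le_trans _ hd)//.
  by rewrite ler_wpM2l// mulr_ge0 ?oppr_ge0 ?(ltW lam0) ?(ltW e0).
move: h3; rewrite ler_norml => /andP[h3 h4].
have lvB : 0 <= lam * v * B by rewrite !mulr_ge0// ltW.
by rewrite ge_min; apply/andP; split; [apply/orP; left|]; lra.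
Qed.

Let K0E e : K0 e = \int[mu]_(x in `[0, 1]) jac lam du e x `^ (- lam^-1).
Proof. by rewrite /K0 /Kbar; apply: eq_Rintegral => x _; rewrite add0r. Qed.

Let K0_regular e : 0 <= e -> e < es -> {for e, continuous K0} /\ 0 < K0 e.
Proof.
move=> e0 ees.
have [v0 [ev ves]] : 0 < (e + es) / 2 /\ e < (e + es) / 2 /\ (e + es) / 2 < es.
  by split; [|split]; move: es0 e0 ees; lra.
set v := (e + es) / 2 in v0 ev ves.
have [d [m [B' [d0 m0 jb]]]] := jac_bounds v0 ves.
have li0 : 0 < lam^-1 by rewrite invr_gt0.
have jm e' x : - d < e' -> e' < v -> 0 < jac lam du e' x.
  by move=> h1 h2; have /andP[h3 _] := jb e' x h1 h2; exact: lt_le_trans h3.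
have mf e' : measurable_fun setT (fun x => jac lam du e' x `^ (- lam^-1)).
  exact: (@measurableT_comp _ _ _ _ _ _ (@powR R ^~ (- lam^-1))).
have ub e' x : - d < e' -> e' < v -> `|jac lam du e' x `^ (- lam^-1)| <= m `^ (- lam^-1).
  move=> h1 h2; rewrite ger0_norm ?powR_ge0//; apply: (le_powRN (ltW li0)) => //.
  by have /andP[] := jb e' x h1 h2.
have int e' : - d < e' -> e' < v ->
    mu.-integrable `[0, 1] (EFin \o (fun x => jac lam du e' x `^ (- lam^-1))).
  move=> h1 h2; apply: (@integrable_sub_unit _ _ _ (m `^ (- lam^-1))) => //.
    exact: measurable_funTS.
  by move=> x _; exact: ub.
have de : - d < e by rewrite (lt_le_trans _ e0)// oppr_lt0.
have m01 : measurable (`[0, 1]%classic : set (measurableTypeR R)).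
  exact: measurable_itv.
split; last first.
  have B'0 : 0 < B' by have /andP[h1 h2] := jb e 0 de ev; lra.
  set c := B' `^ (- lam^-1); have c0 : 0 < c by exact: powR_gt0.
  apply: (lt_le_trans c0); rewrite K0E.
  have -> : c = \int[mu]_(x in `[0, 1]) cst c x.
    by rewrite Rintegral_cst//= lebesgue_measure_itv/= lte_fin ltr01 oppr0 addr0 mulr1.
  apply: (@le_Rintegral _ (measurableTypeR R) R mu _ _ _ m01 _ (int e de ev)).
    by apply: (@integrable_sub_unit _ _ _ `|c|).
  move=> x _; apply: (le_powRN (ltW li0)); first exact: jm.
  by have /andP[] := jb e x de ev.
have -> : K0 = fun l => \int[mu]_(x in `[0, 1]) jac lam du l x `^ (- lam^-1).
  by apply/funext => l; exact: K0E.
have iv l : l \in `]- d, v[%classic -> - d < l /\ l < v.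
  by rewrite inE/= in_itv/= => /andP[].
apply: (@continuity_under_integral R _ (measurableTypeR R) mu
  (fun l x => jac lam du l x `^ (- lam^-1)) `[0, 1]%classic m01 (- d) v _ _
  (cst (m `^ (- lam^-1)))).
- by move=> l /mem_set /iv[h1 h2]; exact: int.
- apply: aeW => x _ l /iv[h1 h2]; apply: cvg_powR; first exact: jm.
  apply: cvgB; first exact: cvg_cst.
  apply: cvgM; last exact: cvg_cst.
  by apply: cvgM; [exact: cvg_cst|exact: cvg_id].
- by apply: (@integrable_sub_unit _ _ _ `|m `^ (- lam^-1)|).
- by move=> l /mem_set /iv[h1 h2]; apply: aeW => x _; exact: ub.
- by rewrite inE/= in_itv/= de.
Qed.

(* the time at which [eta] takes the value [e] *)
Let T (e : R) : R := \int[mu]_(m in `[0, e]) K0 m `^ (2 * lam).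

Let rate (e : R) : R := K0 e `^ (2 * lam).

Let rate_gt0 e : 0 <= e -> e < es -> 0 < rate e.
Proof. by move=> e0 ee; apply: powR_gt0; have [] := K0_regular e0 ee. Qed.

Let rate_continuous e : 0 <= e -> e < es -> {for e, continuous rate}.
Proof.
by move=> e0 ee; have [cK K0p] := K0_regular e0 ee; exact: cvg_powR.
Qed.

Let rate_within v : 0 <= v -> v < es -> {within `[0, v], continuous rate}.
Proof.
move=> v0 ves; apply: continuous_in_subspaceT => x; rewrite inE/= in_itv/= => /andP[x0 xv].
by apply: rate_continuous => //; exact: le_lt_trans ves.
Qed.

Let rate_integrable v : 0 <= v -> v < es -> mu.-integrable `[0, v] (EFin \o rate).
Proof.
move=> v0 ves; apply: continuous_compact_integrable; first exact: segment_compact.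
exact: rate_within.
Qed.

Let T_derive (e : R) : 0 < e -> e < es -> is_derive e 1 T (rate e).
Proof.
move=> e0 ees.
have [v0 [ev ves]] : 0 < (e + es) / 2 /\ e < (e + es) / 2 /\ (e + es) / 2 < es.
  by split; [|split]; lra.
have [dT T'] := @continuous_FTC1_closed R rate 0 e _ ev (rate_integrable (ltW v0) ves)
  e0 (rate_continuous (ltW e0) ees).
by split => //; rewrite -derive1E.
Qed.

Let T0 : T 0 = 0. Proof. by rewrite /T set_itv1 Rintegral_set1. Qed.

Let T_within v : 0 <= v -> v < es -> {within `[0, v], continuous T}.
Proof.
by move=> v0 ves; exact: (parameterized_integral_continuous v0 (rate_integrable v0 ves)).
Qed.

Let T_mono a b : 0 <= a -> a < b -> b < es -> T a < T b.
Proof.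
move=> a0 ab bes; have b0 := le_lt_trans a0 ab.
have sub : `[a, b]%classic `<=` `[0, b]%classic.
  by move=> x /=; rewrite !in_itv/= => /andP[ax ->]; rewrite (le_trans a0 ax).
have dT x : x \in `]a, b[ -> is_derive x 1 T (rate x).
  rewrite in_itv/= => /andP[ax xb].
  by apply: T_derive; [exact: le_lt_trans ax|exact: lt_trans bes].
have [c] := MVT ab dT (continuous_subspaceW sub (T_within (ltW b0) bes)).
rewrite in_itv/= => /andP[ac cb] E; rewrite -subr_gt0 E mulr_gt0 ?subr_gt0//.
by apply: rate_gt0; [exact: ltW (le_lt_trans a0 ac)|exact: lt_trans bes].
Qed.

Let gap_derive (e : R) : 0 < e -> is_derive e 1 gap (- lam * (lam * e) ^- 2).
Proof.
move=> e0; have le0 : lam * e != 0 by rewrite gt_eqF// mulr_gt0.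
have d1 : is_derive e 1 (fun y : R => lam * y) lam.
  by have := is_deriveZ lam (is_derive_id e 1); rewrite /GRing.scale/= mulr1.
have := is_deriveB (is_deriveV le0 d1) (is_derive_cst M0 e 1).
by rewrite subr0 /GRing.scale/= mulNr mulrC -mulNr.
Qed.

(* [(lam e)^-2] is the derivative of the gap up to a constant, so that in the gap
   as a variable the clock has the rate [profile_moment ^ (2 lam)] *)
Let rateE e : 0 < e -> e < es ->
  rate e = (lam * e) ^- 2 * profile_moment g lam^-1 (gap e) `^ (2 * lam).
Proof.
move=> e0 ee; have le0 : 0 < lam * e by rewrite mulr_gt0.
have th0 : 0 <= profile_moment g lam^-1 (gap e).
  by apply/ltW/(profile_moment_gt0 pg); [rewrite invr_ge0 ltW|exact: gap_gt0].
rewrite /rate /K0 Kbar_profile// add0r powRM ?powR_ge0//; congr (_ * _).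
rewrite -powRrM (_ : - lam^-1 * (2 * lam) = - 2%:R); last by field; rewrite gt_eqF.
by rewrite powR_invn// ltW.
Qed.

Let gap_decr a b : 0 < a -> a <= b -> gap b <= gap a.
Proof.
move=> a0 ab; rewrite lerD2r lef_pV2 ?posrE ?mulr_gt0//; last exact: lt_le_trans ab.
by rewrite ler_pM2l.
Qed.

Let gap_decr_lt a b : 0 < a -> a < b -> gap b < gap a.
Proof.
move=> a0 ab; rewrite ltrD2r ltf_pV2 ?posrE ?mulr_gt0//; last exact: lt_trans ab.
by rewrite ltr_pM2l.
Qed.

Let gap_hit y : 0 < y -> exists2 e, 0 < e < es & gap e = y.
Proof.
move=> y0; have My0 : 0 < M0 + y by rewrite addr_gt0.
exists (lam * (M0 + y))^-1.
  rewrite invr_gt0 mulr_gt0//= /es /eta_star ltf_pV2 ?posrE ?mulr_gt0//.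
  by rewrite ltr_pM2l// ltrDl.
by rewrite /gap; field; rewrite !gt_eqF.
Qed.

Let derive_le (F G f h : R -> R) (a b : R) : a <= b ->
  (forall x, a <= x <= b -> is_derive x 1 F (f x)) ->
  (forall x, a <= x <= b -> is_derive x 1 G (h x)) ->
  (forall x, a <= x <= b -> f x <= h x) -> F b - F a <= G b - G a.
Proof.
move=> ab dF dG fh; pose D (x : R) := G x - F x.
have dD (x : R) : a <= x <= b -> is_derive x 1 D (h x - f x).
  by move=> xab; exact: is_deriveB (dG x xab) (dF x xab).
have dD' x : x \in `]a, b[ -> is_derive x 1 D (h x - f x).
  by rewrite in_itv/= => /andP[ax xb]; apply: dD; rewrite !ltW.
have cD : {within `[a, b], continuous D}.
  apply: continuous_in_subspaceT => x; rewrite inE/= in_itv/= => xab.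
  apply/differentiable_continuous/derivable1_diffP.
  exact: (@ex_derive _ _ _ _ _ _ _ (dD x xab)).
have [c] := MVT_segment ab dD' cD.
rewrite in_itv/= => cab E; rewrite -subr_ge0.
have -> : G b - G a - (F b - F a) = D b - D a by rewrite /D; ring.
by rewrite E mulr_ge0 ?subr_ge0// fh.
Qed.

Let T_le_rate_bound (S h : R -> R) (a b : R) : 0 < a -> a <= b -> b < es ->
  (forall x, a <= x <= b -> is_derive x 1 S (h x)) ->
  (forall x, a <= x <= b -> rate x <= h x) -> T b - T a <= S b - S a.
Proof.
move=> a0 ab bes dS rh; apply: derive_le dS rh => // x /andP[ax xb].
by apply: T_derive; [exact: lt_le_trans ax|exact: le_lt_trans bes].
Qed.

Let T_ge_rate_bound (S h : R -> R) (a b : R) : 0 < a -> a <= b -> b < es ->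
  (forall x, a <= x <= b -> is_derive x 1 S (h x)) ->
  (forall x, a <= x <= b -> h x <= rate x) -> S b - S a <= T b - T a.
Proof.
move=> a0 ab bes dS rh; apply: (derive_le ab dS _ rh) => x /andP[ax xb].
by apply: T_derive; [exact: lt_le_trans ax|exact: le_lt_trans bes].
Qed.

(* comparison with a primitive of [K y^(-b)], where [y] is the gap *)
Let T_bounded (K b y0 : R) : 0 <= K -> b < 1 -> 0 < y0 ->
  (forall y, 0 < y -> y < y0 -> profile_moment g lam^-1 y `^ (2 * lam) <= K * y `^ (- b)) ->
  exists A, forall e, 0 <= e -> e < es -> T e <= A.
Proof.
move=> K_ge0 b1 y00 bd; have y20 : 0 < y0 / 2 by rewrite divr_gt0.
have b10 : 1 - b != 0 by rewrite subr_eq0 gt_eqF.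
have b1p : 0 < 1 - b by rewrite subr_gt0.
have [e0 /andP[e00 e0s] gape0] := gap_hit y20.
pose c := K / (lam * (1 - b)).
have c0 : 0 <= c by rewrite divr_ge0// mulr_ge0// ltW.
pose S e := - c * gap e `^ (1 - b).
exists (T e0 + c * gap e0 `^ (1 - b)) => e e_ge0 ees.
have cS : 0 <= c * gap e0 `^ (1 - b) by rewrite mulr_ge0 ?powR_ge0.
have [ee0|ee0] := ltP e e0.
  by rewrite (le_trans (ltW (T_mono e_ge0 ee0 e0s)))// lerDl.
have gp x : e0 <= x <= e -> 0 < gap x /\ 0 < x /\ x < es.
  move=> /andP[h1 h2]; have x0 := lt_le_trans e00 h1.
  by have xs := le_lt_trans h2 ees; split=> //; exact: gap_gt0.
have dS (x : R) : e0 <= x <= e -> is_derive x 1 S ((lam * x) ^- 2 * (K * gap x `^ (- b))).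
  move=> /gp[gx [x0 xs]].
  have d1 := @is_derive1_comp R (@powR R ^~ (1 - b)) gap x _ _
    (is_derive1_powR (1 - b) gx) (gap_derive x0).
  have := is_deriveZ (- c) d1; rewrite /GRing.scale/=.
  rewrite (_ : 1 - b - 1 = - b); last by ring.
  congr is_derive; rewrite /c; have lx : lam * x != 0 by rewrite gt_eqF// mulr_gt0.
  by field; rewrite b10 !gt_eqF.
have rh x : e0 <= x <= e -> rate x <= (lam * x) ^- 2 * (K * gap x `^ (- b)).
  move=> /[dup] /gp[gx [x0 xs]] /andP[h1 h2]; rewrite rateE// ler_wpM2l//.
    by rewrite invr_ge0 sqr_ge0.
  apply: bd => //; apply: (@le_lt_trans _ _ (y0 / 2)); last by lra.
  by rewrite -gape0; exact: gap_decr.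
have := T_le_rate_bound e00 ee0 ees dS rh.
have Se : S e <= 0 by rewrite /S mulNr oppr_le0 mulr_ge0 ?powR_ge0.
by rewrite /S; move: Se; rewrite /S; lra.
Qed.

(* comparison with the logarithm of the gap *)
Let T_unbounded (K y0 : R) : 0 < K -> 0 < y0 ->
  (forall y, 0 < y -> y < y0 -> K * y^-1 <= profile_moment g lam^-1 y `^ (2 * lam)) ->
  forall A, exists e, [/\ 0 <= e, e < es & A <= T e].
Proof.
move=> K_gt0 y00 bd A; have y20 : 0 < y0 / 2 by rewrite divr_gt0.
have [e0 /andP[e00 e0s] gape0] := gap_hit y20.
pose c := K / lam; have c0 : 0 < c by rewrite divr_gt0.
pose S e := - c * ln (gap e).
pose y1 := Num.min (y0 / 2) (expR (- (`|A - T e0 + S e0| / c))).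
have y10 : 0 < y1 by rewrite lt_min y20 expR_gt0.
have [e /andP[e1 es1] gape] := gap_hit y10.
have ee0 : e0 <= e.
  rewrite leNgt; apply/negP => ee0; have h := gap_decr_lt e1 ee0.
  have h2 : gap e <= gap e0 by rewrite gape gape0 /y1 ge_min lexx.
  by have := lt_le_trans h h2; rewrite ltxx.
exists e; split => //; first exact: ltW.
have gp x : e0 <= x <= e -> 0 < gap x /\ 0 < x /\ x < es.
  move=> /andP[h1 h2]; have x0 := lt_le_trans e00 h1.
  by have xs := le_lt_trans h2 es1; split=> //; exact: gap_gt0.
have dS (x : R) : e0 <= x <= e -> is_derive x 1 S ((lam * x) ^- 2 * (K * (gap x)^-1)).
  move=> /gp[gx [x0 xs]].
  have d1 := @is_derive1_comp R (@ln R) gap x _ _ (is_derive1_ln gx) (gap_derive x0).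
  have := is_deriveZ (- c) d1; rewrite /GRing.scale/=.
  congr is_derive; rewrite /c; have lx : lam * x != 0 by rewrite gt_eqF// mulr_gt0.
  by field; rewrite !gt_eqF.
have rh x : e0 <= x <= e -> (lam * x) ^- 2 * (K * (gap x)^-1) <= rate x.
  move=> /[dup] /gp[gx [x0 xs]] /andP[h1 h2]; rewrite rateE// ler_wpM2l//.
    by rewrite invr_ge0 sqr_ge0.
  apply: bd => //; apply: (@le_lt_trans _ _ (y0 / 2)); last by lra.
  by rewrite -gape0; exact: gap_decr.
have := T_ge_rate_bound e00 ee0 es1 dS rh.
have Sge : `|A - T e0 + S e0| <= S e.
  have hl : ln y1 <= - (`|A - T e0 + S e0| / c).
    by rewrite -[leRHS]expRK ler_ln ?posrE ?expR_gt0// /y1 ge_min lexx orbT.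
  by rewrite [S e]/S gape mulNr -mulrN mulrC -ler_pdivrMr// lerNr.
by have := ler_norm (A - T e0 + S e0); lra.
Qed.

Let tstarE : tstar lam M0 du = lim ((T e)%:E @[e --> es^'-]).
Proof. by rewrite /tstar gt_eqF. Qed.

Let T_monoW a b : 0 <= a -> a <= b -> b < es -> T a <= T b.
Proof.
move=> a0; rewrite le_eqVlt => /predU1P[->//|ab] bes.
exact: ltW (T_mono a0 ab bes).
Qed.

Let tstar_fin A : (forall e, 0 <= e -> e < es -> T e <= A) ->
  exists2 Ts : R, tstar lam M0 du = Ts%:E & forall e, 0 <= e -> e < es -> T e < Ts.
Proof.
move=> TA.
have cT : cvg (T e @[e --> es^'-]).
  apply: nondecreasing_at_left_is_cvgr.
    near=> x; move=> a b; rewrite !in_itv/= => /andP[xa aes] /andP[xb bes] ab.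
    apply: T_monoW => //; apply: (le_trans _ (ltW xa)).
    by near: x; exact: nbhs_left_ge.
  near=> x; exists A; move=> z [e /=]; rewrite in_itv/= => /andP[xe ees] <-.
  apply: TA => //; apply: (le_trans _ (ltW xe)).
  by near: x; exact: nbhs_left_ge.
exists (lim (T e @[e --> es^'-])).
  rewrite tstarE; apply/cvg_lim => //; apply: cvg_EFin => //; exact: nearW.
move=> e e0 ees.
have [h1 h2] : e < (e + es) / 2 /\ (e + es) / 2 < es.
  by split; move: ees; lra.
apply: (lt_le_trans (T_mono e0 h1 h2)); apply: limr_ge => //.
near=> x; apply: T_monoW => //; first exact: le_trans e0 (ltW h1).
by near: x; exact: nbhs_left_ge.
Unshelve. all: by end_near. Qed.

Let tstar_inf : (forall A, exists e, [/\ 0 <= e, e < es & A <= T e]) ->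
  tstar lam M0 du = +oo%E.
Proof.
move=> TA; rewrite tstarE; apply/cvg_lim => //; apply/cvgeryP/cvgryPge => A.
have [e1 [e10 e1s Ae1]] := TA A.
near=> e; apply: (le_trans Ae1); apply: T_monoW => //.
by near: e; exact: nbhs_left_ge.
Unshelve. all: by end_near. Qed.

Let T_lt_tstar e : 0 <= e -> e < es -> ((T e)%:E < tstar lam M0 du)%E.
Proof.
move=> e0 ees; have [[A hA]|nA] := pselect (exists A, forall e, 0 <= e -> e < es -> T e <= A).
  by have [Ts -> hTs] := tstar_fin hA; rewrite lte_fin hTs.
rewrite tstar_inf ?ltry// => A; apply: contrapT => h; apply: nA; exists A => x x0 xs.
rewrite leNgt; apply/negP => AT; apply: h; exists x; split => //; exact: ltW.
Qed.

Lemma tstar_gt0 : (0 < tstar lam M0 du)%E.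
Proof. by have := T_lt_tstar (lexx 0) es0; rewrite T0. Qed.

Section along_eta.
Variable eta : R -> R.
Hypotheses (eta0 : eta 0 = 0) (eta0cv : eta t @[t --> 0^'+] --> (0 : R)).
Hypothesis eta_derive : forall t : R, 0 < t -> (t%:E < tstar lam M0 du)%E ->
  is_derive t 1 eta (Kbar lam du 0 (eta t) `^ (- (2 * lam))).
Hypothesis eta_lt : forall t : R, 0 <= t -> (t%:E < tstar lam M0 du)%E ->
  eta t < eta_star lam M0.

Let before (s t : R) : s <= t -> (t%:E < tstar lam M0 du)%E ->
  (s%:E < tstar lam M0 du)%E.
Proof. by move=> st; apply: le_lt_trans; rewrite lee_fin. Qed.

Let eta_cont t : 0 < t -> (t%:E < tstar lam M0 du)%E -> {for t, continuous eta}.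
Proof.
move=> t0 ts; apply/differentiable_continuous/derivable1_diffP.
exact: (@ex_derive _ _ _ _ _ _ _ (eta_derive t0 ts)).
Qed.

Let eta_within t : 0 < t -> (t%:E < tstar lam M0 du)%E ->
  {within `[0, t], continuous eta}.
Proof.
move=> t0 ts; apply/(continuous_within_itvP _ t0); split.
- move=> x; rewrite in_itv/= => /andP[x0 xt]; apply: eta_cont => //.
  exact: before (ltW xt) ts.
- by rewrite eta0.
- by apply: cvg_at_left_filter; exact: eta_cont.
Qed.

Let eta_MVT t : 0 < t -> (t%:E < tstar lam M0 du)%E ->
  exists2 c, 0 < c < t & eta t = Kbar lam du 0 (eta c) `^ (- (2 * lam)) * t.
Proof.
move=> t0 ts.
have dE x : x \in `]0, t[ -> is_derive x 1 eta (Kbar lam du 0 (eta x) `^ (- (2 * lam))).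
  rewrite in_itv/= => /andP[x0 xt]; apply: eta_derive => //; exact: before (ltW xt) ts.
have [c] := MVT t0 dE (eta_within t0 ts).
by rewrite in_itv/= eta0 !subr0 => c0t ->; exists c.
Qed.

Let eta_ge0 t : 0 <= t -> (t%:E < tstar lam M0 du)%E -> 0 <= eta t.
Proof.
rewrite le_eqVlt => /predU1P[<-|t0 ts]; first by rewrite eta0.
by have [c _ ->] := eta_MVT t0 ts; rewrite mulr_ge0 ?powR_ge0// ltW.
Qed.

Lemma eta_gt0 t : 0 < t -> (t%:E < tstar lam M0 du)%E -> 0 < eta t.
Proof.
move=> t0 ts; have [c /andP[c0 ct] ->] := eta_MVT t0 ts.
have cs := before (ltW ct) ts.
have [_ Kp] := K0_regular (eta_ge0 (ltW c0) cs) (eta_lt (ltW c0) cs).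
by rewrite mulr_gt0// powR_gt0.
Qed.

(** The time is recovered from [eta] by separation of variables. *)
Let T_eta t : 0 < t -> (t%:E < tstar lam M0 du)%E -> T (eta t) = t.
Proof.
move=> t0 ts.
have dE x : x \in `]0, t[ -> is_derive x 1 (T \o eta) 1.
  rewrite in_itv/= => /andP[x0 xt]; have xs := before (ltW xt) ts.
  have ex0 := eta_gt0 x0 xs; have exs := eta_lt (ltW x0) xs.
  have := is_derive1_comp (T_derive ex0 exs) (eta_derive x0 xs).
  rewrite /rate -/K0 -powRD ?addrN ?powRr0//.
  by have [_ Kp] := K0_regular (ltW ex0) exs; rewrite (gt_eqF Kp) implybT.
have cE : {within `[0, t], continuous (T \o eta)}.
  apply/(continuous_within_itvP _ t0); split.
  - move=> x /dE d; apply/differentiable_continuous/derivable1_diffP.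
    exact: (@ex_derive _ _ _ _ _ _ _ d).
  - have [h1 h2] : 0 < es / 2 /\ es / 2 < es by split; move: es0; lra.
    have /(continuous_within_itvP _ h1) [_ + _] := T_within (ltW h1) h2.
    rewrite /= eta0; apply: cvg_comp; apply: cvg_at_right_gt => //.
    near=> x; have x0 : 0 < x by []; apply: (eta_gt0 x0).
    apply: (before _ ts); near: x; exact: nbhs_right_le.
  - apply: cvg_at_left_filter; apply: continuous_comp; first exact: eta_cont.
    apply/differentiable_continuous/derivable1_diffP.
    exact: (@ex_derive _ _ _ _ _ _ _ (T_derive (eta_gt0 t0 ts) (eta_lt (ltW t0) ts))).
have [c _] := MVT t0 dE cE.
by rewrite /= eta0 T0 !subr0 mul1r.
Unshelve. all: by end_near. Qed.

Let eta_above e t : 0 <= e -> e < es -> 0 < t -> (t%:E < tstar lam M0 du)%E ->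
  T e < t -> e < eta t.
Proof.
move=> e0 ees t0 ts Tet; rewrite ltNge; apply/negP => ete.
have := T_monoW (ltW (eta_gt0 t0 ts)) ete ees.
by rewrite T_eta// leNgt Tet.
Qed.

Let gap_eta_lt y : 0 < y -> exists2 A : R, (A%:E < tstar lam M0 du)%E &
  forall t, 0 < t -> (t%:E < tstar lam M0 du)%E -> A < t -> 0 < gap (eta t) < y.
Proof.
move=> y0; have [e1 /andP[e10 e1s] ge1] := gap_hit y0.
exists (T e1); first by apply: T_lt_tstar => //; exact: ltW.
move=> t t0 ts At; have e1t := eta_above (ltW e10) e1s t0 ts At.
rewrite gap_gt0 ?eta_gt0 ?eta_lt ?(ltW t0)//=.
by rewrite -ge1; exact: gap_decr_lt.
Qed.

Lemma gap_eta_cvg_finite (Ts : R) : tstar lam M0 du = Ts%:E ->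
  gap (eta t) @[t --> Ts^'-] --> (0 : R)^'+.
Proof.
move=> tE; have Ts0 : 0 < Ts by have := tstar_gt0; rewrite tE lte_fin.
have near_lt y : 0 < y -> \forall t \near Ts^'-, 0 < gap (eta t) < y.
  move=> /gap_eta_lt[A]; rewrite tE lte_fin => ATs h.
  near=> t; have tTs : t < Ts by [].
  apply: h; first by near: t; exact: nbhs_left_gt.
    by rewrite lte_fin.
  by near: t; exact: nbhs_left_gt.
apply: cvg_at_right_gt; last by apply: filterS (near_lt 1 ltr01) => t /andP[].
apply/cvgr0Pnorm_lt => y /near_lt; apply: filterS => t /andP[h1 h2].
by rewrite gtr0_norm.
Unshelve. all: by end_near. Qed.

Lemma gap_eta_cvg_infinite : tstar lam M0 du = +oo%E ->
  gap (eta t) @[t --> +oo] --> (0 : R)^'+.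
Proof.
move=> tE; have near_lt y : 0 < y -> \forall t \near +oo, 0 < gap (eta t) < y.
  move=> /gap_eta_lt[A _]; rewrite tE => h.
  near=> t; apply: h; last 2 first.
  - by rewrite ltry.
  - by near: t; apply: nbhs_pinfty_gt; rewrite num_real.
  by near: t; apply: nbhs_pinfty_gt; rewrite num_real.
apply: cvg_at_right_gt; last by apply: filterS (near_lt 1 ltr01) => t /andP[].
apply/cvgr0Pnorm_lt => y /near_lt; apply: filterS => t /andP[h1 h2].
by rewrite gtr0_norm.
Unshelve. all: by end_near. Qed.

End along_eta.

Hypotheses (q0 : 0 < q) (C0 : 0 < C).

Let sE : 0 < lam^-1. Proof. by rewrite invr_gt0. Qed.

Let th_power : lam < q -> exists2 c, 0 < c &
  \forall y \near (0 : R)^'+,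
    c / 2 * y `^ (- (2 - 2 * lam / q)) <= profile_moment g lam^-1 y `^ (2 * lam)
      <= (c + 1) * y `^ (- (2 - 2 * lam / q)).
Proof.
move=> lamq; have sq1 : 1 < lam^-1 * q by rewrite mulrC ltr_pdivlMr// mul1r.
have [c c0 cA] := profile_moment_supercritical q0 C0 pg sE sq1.
have cB : (y `^ (lam^-1 - q^-1) * profile_moment g lam^-1 y) `^ (2 * lam)
    @[y --> 0^'+] --> c `^ (2 * lam) by exact: cvg_powR.
have c20 : 0 < c `^ (2 * lam) by exact: powR_gt0.
exists (c `^ (2 * lam)) => //; near=> y; have y0 : 0 < y by [].
have th0 : 0 < profile_moment g lam^-1 y.
  by apply: (profile_moment_gt0 pg) => //; exact: ltW.
have E : (y `^ (lam^-1 - q^-1) * profile_moment g lam^-1 y) `^ (2 * lam) =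
    profile_moment g lam^-1 y `^ (2 * lam) / y `^ (- (2 - 2 * lam / q)).
  rewrite powRM ?powR_ge0 ?(ltW th0)// -powRrM powRN invrK mulrC; congr (_ * _ `^ _).
  by field; rewrite !gt_eqF.
apply/andP; split.
  rewrite -ler_pdivlMr ?powR_gt0// -E; near: y.
  by apply: cvgr_ge cB _ _; rewrite ltr_pdivrMr// ltr_pMr// ltr1n.
rewrite -ler_pdivrMr ?powR_gt0// -E; near: y.
by apply: cvgr_le cB _ _; rewrite ltrDl.
Unshelve. all: by end_near. Qed.

(** The integrand of [tstar] behaves like the power [2 - 2 lam / q] of the inverse
    gap when [lam < q], and is bounded when [lam > q]. *)
Lemma tstar_finite : q / 2 < lam -> lam != q ->
  exists Ts : R, tstar lam M0 du = Ts%:E.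
Proof.
move=> qlam; rewrite neq_lt => /orP[lamq|qltlam].
  have [c c0 [y0 /= y00 hy]] := th_power lamq.
  have bE : 2 - 2 * lam / q < 1.
    have : 1 < 2 * lam / q by rewrite ltr_pdivlMr//; lra.
    lra.
  have c10 : 0 <= c + 1 by rewrite addr_ge0// ltW.
  have bd y : 0 < y -> y < y0 ->
      profile_moment g lam^-1 y `^ (2 * lam) <= (c + 1) * y `^ (- (2 - 2 * lam / q)).
    move=> yp yy0; have yb : `|0 - y| < y0 by rewrite sub0r normrN gtr0_norm.
    by have /andP[] := hy y yb yp.
  have [A hA] := T_bounded c10 bE y00 bd.
  by have [Ts] := tstar_fin hA; exists Ts.
have sq1 : lam^-1 * q < 1 by rewrite mulrC ltr_pdivrMr// mul1r.
have [l l0 cl] := profile_moment_subcritical q0 C0 pg sE sq1.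
have cB : profile_moment g lam^-1 y `^ (2 * lam) @[y --> 0^'+] --> l `^ (2 * lam).
  exact: cvg_powR.
have [y0 /= y00 hy] : \forall y \near (0 : R)^'+,
    profile_moment g lam^-1 y `^ (2 * lam) <= l `^ (2 * lam) + 1.
  by apply: cvgr_le cB _ _; rewrite ltrDl.
have l10 : 0 <= l `^ (2 * lam) + 1 by rewrite addr_ge0// powR_ge0.
have bd y : 0 < y -> y < y0 ->
    profile_moment g lam^-1 y `^ (2 * lam) <= (l `^ (2 * lam) + 1) * y `^ (- 0).
  move=> yp yy0; rewrite oppr0 powRr0 mulr1; apply: hy => //.
  by rewrite /ball/= sub0r normrN gtr0_norm.
have [A hA] := T_bounded l10 ltr01 y00 bd.
by have [Ts] := tstar_fin hA; exists Ts.
Qed.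

Lemma tstar_infinite : lam <= q / 2 -> tstar lam M0 du = +oo%E.
Proof.
move=> lq; have lamq : lam < q by move: q0; lra.
have [c c0 [y0 /= y00 hy]] := th_power lamq.
have bE : 1 <= 2 - 2 * lam / q.
  have : 2 * lam / q <= 1 by rewrite ler_pdivrMr//; lra.
  lra.
apply: tstar_inf; apply: (@T_unbounded (c / 2) (Num.min y0 1)).
- by rewrite divr_gt0.
- by rewrite lt_min y00 ltr01.
move=> y yp; rewrite lt_min => /andP[yy0 y1].
have yb : `|0 - y| < y0 by rewrite sub0r normrN gtr0_norm.
have /andP[h _] := hy y yb yp.
apply: le_trans h; rewrite ler_wpM2l ?divr_ge0 ?(ltW c0)//.
rewrite -(powR_inv1 (ltW yp)) !powRN lef_pV2 ?posrE ?powR_gt0//.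
by apply: ger_powR => //; rewrite yp ltW.
Qed.

End clock.

(** * The solution for positive parameters *)

Section positive_parameter.
Context {R : realType}.
Notation mu := (@lebesgue_measure R).

Lemma eq_Rintegral_off_null (D : set R) (f h : R -> R) (N : set R) :
  measurable N -> mu N = 0%E -> (forall x, D x -> ~ N x -> f x = h x) ->
  \int[mu]_(x in D) f x = \int[mu]_(x in D) h x.
Proof.
move=> mN N0 fh; rewrite /Rintegral; congr fine.
apply: (@eq_integral_off_null _ (measurableTypeR R) R mu _ _ _ _ mN N0).
by move=> x Dx Nx; rewrite fh.
Qed.

Variables (q C M0 lam : R) (peaks : seq R) (du0 g : R -> R) (N : set R).
Variables (ux gam : R -> R -> R).
Hypotheses (pg : peak_profile q C peaks g) (mN : measurable N) (N0 : mu N = 0%E).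
Hypothesis gE : forall x : R, 0 <= x <= 1 -> ~ N x -> g x = M0 - du0 x.
Hypotheses (lam0 : 0 < lam) (M00 : 0 < M0) (du0_max : forall x, du0 x <= M0).

Let s := lam^-1.
Let s0 : 0 < s. Proof. by rewrite invr_gt0. Qed.
Let du (x : R) : R := M0 - g x.

Let duE (x : R) : 0 <= x <= 1 -> ~ N x -> du0 x = du x.
Proof. by move=> x01 Nx; rewrite /du gE//; ring. Qed.

Lemma Kbar_off_null i : Kbar lam du0 i = Kbar lam du i.
Proof.
apply/funext => e; apply: (eq_Rintegral_off_null mN N0) => x /=.
by rewrite in_itv/= => x01 Nx; rewrite /jac duE.
Qed.

Lemma tstar_off_null : tstar lam M0 du0 = tstar lam M0 du.
Proof. by rewrite /tstar Kbar_off_null. Qed.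

Let mg : measurable_fun setT g. Proof. exact: profile_measurable pg. Qed.
Let g_ge0 := profile_ge0 pg.
Let th e := profile_moment g s e.
Let th1 e := profile_moment g (1 + s) e.
Let th_gt0 e : 0 < e -> 0 < th e.
Proof. by move=> e0; apply: (profile_moment_gt0 pg) => //; exact: ltW. Qed.
Let th1_gt0 e : 0 < e -> 0 < th1 e.
Proof. by move=> e0; apply: (profile_moment_gt0 pg) => //; rewrite ltW// addr_gt0. Qed.

Let m_gradient e : 0 < e -> measurable_fun setT (fun x => gradient_at g lam e (g x)).
Proof.
move=> e0; apply: measurable_funM => //; apply: measurable_funB => //.
apply: eq_measurable_fun (measurable_shifted_profile_powR pg e 1) => x _.
by rewrite powR_inv1 ?(ltW (shifted_profile_gt0 pg x e0)).
Qed.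

Let m_jacobian e : measurable_fun setT (fun x => jacobian_at g lam e (g x)).
Proof.
by apply: measurable_funM => //; exact: (measurable_shifted_profile_powR pg e s).
Qed.

Let jacobian_bounds e : 0 < e -> exists2 k0 : R, 0 < k0 &
  forall x, k0 <= jacobian_at g lam e (g x) <= e `^ (- s) / th e.
Proof.
move=> e0; have [B gB] := profile_bounded pg.
have B0 : 0 <= B by have /andP[h1 h2] := gB 0; exact: le_trans h2.
have eB : 0 < e + B by rewrite ltr_pwDl.
exists ((e + B) `^ (- s) / th e); first by rewrite divr_gt0 ?powR_gt0 ?th_gt0.
move=> x; have eg := shifted_profile_gt0 pg x e0.
rewrite /jacobian_at !ler_pM2r ?invr_gt0 ?th_gt0//; apply/andP; split.
  by apply: (le_powRN (ltW s0)) => //; have /andP[_ h] := gB x; rewrite lerD2l.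
by apply: (shifted_profile_powR_le pg) => //; exact: ltW.
Qed.

Let jacobian_mean e : 0 < e ->
  \int[mu]_(x in `[0, 1]) jacobian_at g lam e (g x) = 1.
Proof.
move=> e0; rewrite /jacobian_at -/s -/(th e).
under eq_Rintegral do rewrite mulrC.
have h : mu.-integrable `[0, 1] (EFin \o (fun x => (e + g x) `^ (- s))).
  exact: (integrable_shifted_profile_powR pg (ltW s0) e0).
rewrite RintegralZl//.
by rewrite mulVf// gt_eqF// th_gt0.
Qed.

Let gradient_norm_EFin p e : 0 < p -> 0 < e ->
  (\int[mu]_(a in `[0%R, 1%R])
    (`|gradient_at g lam e (g a)| `^ p * jacobian_at g lam e (g a))%:E)%E =
  (gradient_norm g lam p e)%:E /\ 0 <= gradient_norm g lam p e.
Proof.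
move=> p0 e0; have [k0 k00 kb] := jacobian_bounds e0.
have J0 x : 0 <= jacobian_at g lam e (g x).
  by have /andP[h _] := kb x; exact: le_trans (ltW k00) h.
pose U := th e `^ (- (2 * lam)) * (e^-1 + th1 e / th e).
have kr : 0 <= th1 e / th e by rewrite divr_ge0 ?(ltW (th1_gt0 e0)) ?(ltW (th_gt0 e0)).
have U0 : 0 <= U by rewrite mulr_ge0 ?powR_ge0// addr_ge0 ?invr_ge0// ltW.
have int : mu.-integrable `[0, 1] (EFin \o (fun x =>
    `|gradient_at g lam e (g x)| `^ p * jacobian_at g lam e (g x))).
  apply: (@integrable_sub_unit _ _ _ (U `^ p * (e `^ (- s) / th e))) => //.
    apply: measurable_funTS; apply: measurable_funM => //.
    apply: (@measurableT_comp _ _ _ _ _ _ (@powR R ^~ p)) => //.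
    by apply: measurableT_comp => //; exact: m_gradient.
  move=> x _; have eg := shifted_profile_gt0 pg x e0.
  rewrite normrM (ger0_norm (powR_ge0 _ _)) (ger0_norm (J0 x)).
  rewrite ler_pM ?powR_ge0//; last first.
    by have /andP[] := kb x.
  apply: (ge0_ler_powR (ltW p0)); rewrite ?nnegrE//.
  rewrite /gradient_at normrM ger0_norm ?powR_ge0// ler_wpM2l ?powR_ge0//.
  rewrite (le_trans (ler_normB _ _))// lerD//; last by rewrite ger0_norm.
  by rewrite ger0_norm ?invr_ge0 ?(ltW eg)// lef_pV2 ?posrE// lerDl.
split; first by rewrite /gradient_norm/= /Rintegral fineK//; apply: integrable_fin_num.
by apply: Rintegral_ge0 => x _; rewrite mulr_ge0 ?powR_ge0.
Qed.

Lemma gradient_norm_ge0 p e : 0 < p -> 0 < e -> 0 <= gradient_norm g lam p e.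
Proof. by move=> p0 e0; have [] := gradient_norm_EFin p0 e0. Qed.

(** The solution only depends on time through the gap. *)
Lemma solution_along_gap :
  repr_pos lam M0 du0 ux gam ->
  exists e : R -> R,
  [/\ forall t, 0 < t -> (t%:E < tstar lam M0 du0)%E -> 0 < e t,
      forall t a, 0 < t -> (t%:E < tstar lam M0 du0)%E -> a \in `[0, 1] ->
        ux (gam a t) t = gradient_at g lam (e t) (M0 - du0 a),
      forall t a, 0 < t -> (t%:E < tstar lam M0 du0)%E -> 0 <= a <= 1 ->
        gam a t = gam 0 t + \int[mu]_(x in `[0, a]) jacobian_at g lam (e t) (g x),
      forall Ts : R, tstar lam M0 du0 = Ts%:E -> e t @[t --> Ts^'-] --> (0 : R)^'+ &
      tstar lam M0 du0 = +oo%E -> e t @[t --> +oo] --> (0 : R)^'+].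
Proof.
move=> [eta []]; rewrite tstar_off_null => -[eta0 eta0cv].
rewrite !Kbar_off_null => deta eta_lt gamE uxE.
have et0 t : 0 < t -> (t%:E < tstar lam M0 du)%E -> 0 < eta t.
  by move=> t0 ts; apply: (eta_gt0 pg lam0 M00 eta0 eta0cv deta eta_lt).
exists (fun t => gap lam M0 (eta t)); split.
- by move=> t t0 ts; apply: gap_gt0 => //; [exact: et0|exact: eta_lt (ltW t0) ts].
- move=> t a t0 ts a01; have e0 := et0 t t0 ts; have es := eta_lt t (ltW t0) ts.
  have ge0 := gap_gt0 lam0 M00 e0 es; have le0 : 0 < lam * eta t by rewrite mulr_gt0.
  have G0 : 0 <= M0 - du0 a by rewrite subr_ge0.
  rewrite uxE// !(Kbar_profile pg)// add0r -/s -/(th _) -/(th1 _).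
  have -> : jac lam du0 (eta t) a = lam * eta t * (gap lam M0 (eta t) + (M0 - du0 a)).
    by rewrite /jac /gap; field; rewrite !gt_eqF.
  rewrite /gradient_at -/s -/(th _) -/(th1 _).
  have th0 := th_gt0 ge0; have eg : 0 < gap lam M0 (eta t) + (M0 - du0 a).
    by rewrite ltr_pwDl.
  have -> : ((lam * eta t) `^ (- s) * th (gap lam M0 (eta t))) `^ (2 * lam) =
      (lam * eta t) ^- 2 * th (gap lam M0 (eta t)) `^ (2 * lam).
    rewrite powRM ?powR_ge0 ?(ltW th0)// -powRrM; congr (_ * _).
    by rewrite (_ : - s * (2 * lam) = - 2%:R) ?powR_invn ?(ltW le0)// /s; field; rewrite gt_eqF.
  rewrite opprD powRD ?(gt_eqF le0) ?implybT// powR_inv1 ?(ltW le0)// powRN.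
  have alg (l b X Y Z W : R) : l != 0 -> b != 0 -> X != 0 -> Y != 0 -> Z != 0 ->
      (l * (l ^- 2 * X))^-1 * ((l * b)^-1 - l^-1 * Y * W / (Y * Z)) =
      X^-1 * (b^-1 - W / Z).
    by move=> l0 b0 X0 Y0 Z0; field; rewrite l0 b0 X0 Y0 Z0.
  by apply: alg; rewrite gt_eqF// powR_gt0.
- move=> t a t0 ts /andP[a0 a1]; have e0 := et0 t t0 ts; have es := eta_lt t (ltW t0) ts.
  have ge0 := gap_gt0 lam0 M00 e0 es; have le0 : 0 < lam * eta t by rewrite mulr_gt0.
  have a01 : a \in `[0, 1] by rewrite in_itv/= a0.
  rewrite (gamE t a (ltW t0) ts a01).
  apply: (congr1 (fun z => gam 0 t + z)).
  apply: (eq_Rintegral_off_null mN N0) => x /=.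
  rewrite in_itv/= => /andP[x0 xa] Nx.
  have eg := shifted_profile_gt0 pg x ge0.
  rewrite (Kbar_profile pg)// add0r -/s -/(th _) /jacobian_at -/s -/(th _).
  have -> : jac lam du0 (eta t) x = lam * eta t * (gap lam M0 (eta t) + g x).
    by rewrite -(@jac_profile _ g lam M0 lam0)// /jac duE// x0 (le_trans xa).
  rewrite powRM ?(ltW le0) ?(ltW eg)//.
  have := powR_gt0 (- s) le0; have := th_gt0 ge0.
  move: (th _) (_ `^ _) (_ `^ _) => x1 x2 x3 x10 x20.
  by field; rewrite !gt_eqF.
- by move=> Ts tE; apply: (gap_eta_cvg_finite pg lam0 M00 eta0 eta0cv deta eta_lt).
- by move=> tE; apply: (gap_eta_cvg_infinite pg lam0 M00 eta0 eta0cv deta eta_lt).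
Qed.

Lemma Lpnorm_gradient p e t : 0 < p -> 0 < e ->
  (forall x, ux (x + 1) t = ux x t) ->
  (forall a, a \in `[0, 1] -> ux (gam a t) t = gradient_at g lam e (M0 - du0 a)) ->
  (forall a, 0 <= a <= 1 ->
    gam a t = gam 0 t + \int[mu]_(x in `[0, a]) jacobian_at g lam e (g x)) ->
  Lpnorm p (ux ^~ t) = (gradient_norm g lam p e `^ p^-1)%:E.
Proof.
move=> p0 e0 uxP uxE gamE; have [k0 k00 kb] := jacobian_bounds e0.
have [h1 _] := gradient_norm_EFin p0 e0.
rewrite (@Lpnorm_along_characteristics _ p k0 (e `^ (- s) / th e) (ux ^~ t) (gam ^~ t)
  (fun x => jacobian_at g lam e (g x)) (fun x => gradient_at g lam e (g x)) N) ?h1//.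
- by move=> x; have /andP[] := kb x.
- by move=> x; have /andP[] := kb x.
- exact: jacobian_mean.
- exact: m_gradient.
- by move=> a a01 Na; rewrite /= uxE ?in_itv//= gE.
Qed.

End positive_parameter.

(** * The parameter zero *)

Section root_limits.
Context {R : realType} {I : Type}.
Variables (F : set_system I) (p : R) (n : I -> \bar R) (f : I -> R).
Context {FF : Filter F}.
Hypothesis p0 : 0 < p.
Hypothesis nE : \forall t \near F, 0 <= f t /\ n t = (f t `^ p^-1)%:E.

Let p'0 : 0 < p^-1. Proof. by rewrite invr_gt0. Qed.

Lemma root_cvg (l : R) : f t @[t --> F] --> l ->
  n t @[t --> F] --> (`|l| `^ p^-1)%:E.
Proof.
move=> fl.
have h : (`|f t| `^ p^-1)%:E @[t --> F] --> (`|l| `^ p^-1)%:E.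
  apply: cvg_EFin; first exact: nearW.
  exact: (@cvg_norm_powR _ _ _ FF _ _ _ p'0).
apply: cvg_trans h; apply: near_eq_cvg; near=> t.
have [ft ->] : 0 <= f t /\ n t = (f t `^ p^-1)%:E by near: t.
by rewrite ger0_norm.
Unshelve. all: by end_near. Qed.

Lemma root_cvgy : f t @[t --> F] --> +oo -> n t @[t --> F] --> +oo%E.
Proof.
move=> fy.
have h : (f t `^ p^-1)%:E @[t --> F] --> +oo%E.
  apply/cvgeryP/cvgryPge => A; near=> t.
  have ft : `|A| `^ p <= f t by near: t; move/cvgryPge : fy; exact.
  rewrite (le_trans (ler_norm A))// -[leLHS](powRr1 (normr_ge0 _)).
  rewrite (_ : 1 = p * p^-1); last by rewrite mulfV// gt_eqF.
  rewrite powRrM; apply: (ge0_ler_powR (ltW p'0)) => //; rewrite nnegrE.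
    exact: powR_ge0.
  exact: le_trans (powR_ge0 _ _) ft.
apply: cvg_trans h; apply: near_eq_cvg; near=> t.
by have [ft ->] : 0 <= f t /\ n t = (f t `^ p^-1)%:E by near: t.
Unshelve. all: by end_near. Qed.

End root_limits.

(** The weight of [gam_alpha] when [lam = 0], up to the factor [exp (t M0)], in the
    variable [e = 1 / t]. *)
Definition exp_moment (R : realType) (g : R -> R) (r e : R) : R :=
  \int[@lebesgue_measure R]_(x in `[0, 1]) (g x `^ r * expR (- (g x / e))).

Section zero_parameter.
Context {R : realType}.
Notation mu := (@lebesgue_measure R).
Variables (q C : R) (peaks : seq R) (g : R -> R).
Hypotheses (q0 : 0 < q) (C0 : 0 < C) (pg : peak_profile q C peaks g).

Let mg : measurable_fun setT g. Proof. exact: profile_measurable pg. Qed.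
Let g_ge0 := profile_ge0 pg.

Lemma powR_le_expR (m x : R) : 0 < m -> 0 <= x -> x `^ m <= m `^ m * expR x.
Proof.
move=> m0 x0; have h : x / m <= expR (x / m).
  by rewrite (le_trans _ (expR_ge1Dx _))// lerDr.
have xm : 0 <= x / m by rewrite divr_ge0// ltW.
have -> : x `^ m = m `^ m * (x / m) `^ m.
  by rewrite -powRM ?(ltW m0)//; congr (_ `^ _); field; rewrite gt_eqF.
rewrite ler_wpM2l ?powR_ge0// (le_trans (ge0_ler_powR (ltW m0) _ _ h))//.
  by rewrite nnegrE expR_ge0.
by rewrite -expRM divfK// gt_eqF.
Qed.

(** The rescaling at the peaks applies to [z^r exp (- z)], which decays faster than
    every power; the value [1 / q + 1] is one exponent above the critical one. *)
Lemma exp_moment_cvg (r : R) : 0 <= r -> exists2 l : R, 0 < l &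
  e `^ (- (r + q^-1)) * exp_moment g r e @[e --> 0^'+] --> l.
Proof.
move=> r0; pose s := q^-1 + 1; have qi0 : 0 < q^-1 by rewrite invr_gt0.
have s0 : 0 < s by rewrite addr_gt0.
have sq1 : 1 < s * q by rewrite mulrDl mulVf ?gt_eqF// mul1r ltrDl.
pose H (z : R) := z `^ r * expR (- z).
have m0 : 0 < r + s by rewrite ltr_wpDl.
pose M := (r + s) `^ (r + s) * expR 1.
have mH : measurable_fun setT H.
  apply: measurable_funM; first exact: (@measurable_powR R r).
  by apply: measurableT_comp => //; exact: measurable_oppr.
have Hbd z : 0 <= z -> 0 <= H z <= M * (1 + z) `^ (- s).
  move=> z0; have z1 : 0 < 1 + z by rewrite ltr_pwDl.
  rewrite /H mulr_ge0 ?powR_ge0 ?expR_ge0//= powRN expRN ler_pdivrMr ?expR_gt0//.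
  rewrite mulrAC ler_pdivlMr ?powR_gt0//.
  rewrite (@le_trans _ _ ((1 + z) `^ (r + s)))//.
    rewrite powRD ?(gt_eqF z1) ?implybT// ler_wpM2r ?powR_ge0//.
    by apply: (ge0_ler_powR r0); rewrite ?nnegrE ?(ltW z1)// lerDr.
  by rewrite (le_trans (powR_le_expR m0 (ltW z1)))// expRD mulrA.
have Hcv (z_ : nat -> R) (z : R) : (forall n, 0 <= z_ n) -> z_ n @[n --> \oo] --> z ->
    H (z_ n) @[n --> \oo] --> H z.
  move=> z_0 cz; have z0 : 0 <= z.
    rewrite -(cvg_lim _ cz)//; apply: limr_ge; first by apply/cvg_ex; exists z.
    exact: nearW.
  apply: cvgM; last first.
    by apply: continuous_cvg; [exact: continuous_expR|exact: cvgN].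
  have [->|r_neq0] := eqVneq r 0.
    by under eq_fun do rewrite powRr0; rewrite powRr0; exact: cvg_cst.
  have rp : 0 < r by rewrite lt_neqAle eq_sym r_neq0.
  have := cvg_norm_powR rp cz; rewrite (ger0_norm z0).
  by under eq_fun do rewrite (ger0_norm (z_0 _)); apply.
have Hpos Z' : exists2 c, 0 < c & forall z, 1 <= z <= Z' -> c <= H z.
  exists (expR (- Z')); first exact: expR_gt0.
  move=> z /andP[z1 zZ]; rewrite -[leLHS]mul1r ler_pM ?expR_ge0//.
    have h : (1 : R) `^ r <= z `^ r.
      by apply: (ge0_ler_powR r0); rewrite ?nnegrE// (le_trans _ z1).
    by move: h; rewrite powR1.
  by rewrite ler_expR lerN2.
have main (u : nat -> R) : (forall n, 0 < u n) -> u n @[n --> \oo] --> 0 ->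
    0 < peak_mass q C peaks H /\
    u n `^ (- (r + q^-1)) * exp_moment g r (u n) @[n --> \oo] --> peak_mass q C peaks H.
  move=> u0 ucv; split.
    exact: (peak_mass_gt0 q0 C0 pg u0 ucv (fun=> mH) (fun=> Hbd) s0 sq1 Hcv ler01 Hpos).
  have E n : u n `^ (- (r + q^-1)) * exp_moment g r (u n) =
      u n `^ (- q^-1) * \int[mu]_(x in `[0, 1]) H (g x / u n); last first.
    under eq_fun do rewrite E.
    exact: (profile_rescaling q0 C0 pg u0 ucv (fun=> mH) (fun=> Hbd) s0 sq1 Hcv).
  have un := u0 n.
  have zge x : 0 <= g x / u n by rewrite divr_ge0// ltW.
  have iQ : mu.-integrable `[0, 1] (fun x => (H (g x / u n))%:E).
    apply: (@integrable_sub_unit _ _ _ M) => //.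
      by apply: measurable_funTS; apply: (measurableT_comp mH); exact: measurable_funM.
    move=> x _; have /andP[h1 h2] := Hbd _ (zge x).
    rewrite ger0_norm// (le_trans h2)// ler_piMr ?mulr_ge0 ?powR_ge0 ?expR_ge0//.
    have := @le_powRN _ s 1 (1 + g x / u n) (ltW s0) ltr01; rewrite powR1; apply.
    by rewrite lerDl.
  have -> : exp_moment g r (u n) = u n `^ r * \int[mu]_(x in `[0, 1]) H (g x / u n).
    rewrite -RintegralZl//; apply: eq_Rintegral => x _.
    rewrite mulrA -powRM ?(ltW un)//; congr (_ `^ _ * _).
    by field; rewrite gt_eqF.
  rewrite mulrA -powRD ?(gt_eqF un) ?implybT//; congr (_ `^ _ * _); ring.
have h0 n : 0 < n.+1%:R^-1 :> R by rewrite invr_gt0.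
have [l0 _] := main _ h0 (@cvg_harmonic R).
exists (peak_mass q C peaks H) => //.
by apply/cvg_at_rightP => u [u0 ucv]; have [] := main u u0 ucv.
Qed.

Let integrable_exp r e : 0 <= r -> 0 < e ->
  mu.-integrable `[0, 1] (EFin \o (fun x => g x `^ r * expR (- (g x / e)))).
Proof.
move=> r0 e0; have [B gB] := profile_bounded pg.
have gx0 x : 0 <= g x / e by rewrite divr_ge0// ltW.
apply: (@integrable_sub_unit _ _ _ (B `^ r * 1)) => //.
  apply: measurable_funTS; apply: measurable_funM.
    exact: (@measurableT_comp _ _ _ _ _ _ (@powR R ^~ r)).
  apply: measurableT_comp => //; apply: measurableT_comp => //.
  exact: measurable_funM.
move=> x _; rewrite ger0_norm ?mulr_ge0 ?powR_ge0 ?expR_ge0//.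
have /andP[h1 h2] := gB x.
rewrite ler_pM ?powR_ge0 ?expR_ge0//; last by rewrite -expR0 ler_expR oppr_le0.
by apply: (ge0_ler_powR r0); rewrite ?nnegrE// (le_trans h1).
Qed.

Let m01 : measurable (`[0, 1]%classic : set (measurableTypeR R)).
Proof. exact: measurable_itv. Qed.

Let integrable_weight e : 0 < e ->
  mu.-integrable `[0, 1] (EFin \o (fun x => expR (- (g x / e)))).
Proof.
move=> e0; have := integrable_exp (lexx 0) e0.
by apply: eq_integrable => // x _ /=; rewrite powRr0 mul1r.
Qed.

Lemma exp_moment0 e : exp_moment g 0 e = \int[mu]_(x in `[0, 1]) expR (- (g x / e)).
Proof. by apply: eq_Rintegral => x _; rewrite powRr0 mul1r. Qed.

Lemma exp_moment0_gt0 e : 0 < e -> 0 < exp_moment g 0 e.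
Proof.
move=> e0; have [B gB] := profile_bounded pg.
have c0 := expR_gt0 (- (B / e)); set c := expR _ in c0.
apply: (lt_le_trans c0); rewrite exp_moment0.
have -> : c = \int[mu]_(x in `[0, 1]) cst c x.
  by rewrite Rintegral_cst//= lebesgue_measure_itv/= lte_fin ltr01 oppr0 addr0 mulr1.
apply: (@le_Rintegral _ (measurableTypeR R) R mu _ _ _ m01 _ (integrable_weight e0)).
  by apply: (@integrable_sub_unit _ _ _ `|c|).
move=> x _; rewrite ler_expR lerN2 ler_pM2r ?invr_gt0//.
by have /andP[] := gB x.
Qed.

Lemma exp_moment_ge0 r e : 0 <= exp_moment g r e.
Proof. by apply: Rintegral_ge0 => x _; rewrite mulr_ge0 ?powR_ge0 ?expR_ge0. Qed.

Let ratio_cvg0 (r : R) : 0 < r ->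
  exp_moment g r e / exp_moment g 0 e @[e --> 0^'+] --> (0 : R).
Proof.
move=> r0; have [l l0 cl] := exp_moment_cvg (lexx 0).
have [lr lr0 clr] := exp_moment_cvg (ltW r0).
have h : e `^ r * (e `^ (- (r + q^-1)) * exp_moment g r e /
    (e `^ (- (0 + q^-1)) * exp_moment g 0 e)) @[e --> 0^'+] --> 0 * (lr / l).
  apply: cvgM; first exact: powR_cvg0.
  by apply: cvgM => //; apply: cvgV => //; rewrite gt_eqF.
rewrite mul0r in h; apply: cvg_trans h; apply: near_eq_cvg; near=> e.
have e0 : 0 < e by []; rewrite add0r opprD powRD ?(gt_eqF e0) ?implybT// powRN.
have := powR_gt0 r e0; have := powR_gt0 (- q^-1) e0; have := exp_moment0_gt0 e0.
move: (exp_moment _ _ _) (exp_moment _ _ _) (e `^ r) (e `^ (- q^-1)) => a b c d a0 d0 c0.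
by field; rewrite !gt_eqF.
Unshelve. all: by end_near. Qed.

Definition exp_gradient_norm (p e : R) : R :=
  \int[mu]_(x in `[0, 1]) (`|exp_moment g 1 e / exp_moment g 0 e - g x| `^ p *
    (expR (- (g x / e)) / exp_moment g 0 e)).

Let k e := exp_moment g 1 e / exp_moment g 0 e.

Let k_ge0 e : 0 <= k e.
Proof. by rewrite divr_ge0 ?exp_moment_ge0. Qed.

Let integrable_gradient p e : 0 < p -> 0 < e -> mu.-integrable `[0, 1]
  (EFin \o (fun x => `|k e - g x| `^ p * (expR (- (g x / e)) / exp_moment g 0 e))).
Proof.
move=> p0 e0; have [B gB] := profile_bounded pg.
have B0 : 0 <= B by have /andP[h1 h2] := gB 0; exact: le_trans h2.
have gx0 x : 0 <= g x / e by rewrite divr_ge0// ltW.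
have Z0 := exp_moment0_gt0 e0.
apply: (@integrable_sub_unit _ _ _ ((k e + B) `^ p * (1 / exp_moment g 0 e))) => //.
  apply: measurable_funTS; apply: measurable_funM.
    apply: (@measurableT_comp _ _ _ _ _ _ (@powR R ^~ p)) => //.
    by apply: measurableT_comp => //; exact: measurable_funB.
  apply: measurable_funM => //.
  apply: measurableT_comp => //; apply: measurableT_comp => //.
  exact: measurable_funM.
move=> x _; have /andP[h1 h2] := gB x.
have w0 : 0 <= expR (- (g x / e)) / exp_moment g 0 e.
  by rewrite divr_ge0 ?expR_ge0// ltW.
rewrite normrM (ger0_norm (powR_ge0 _ _)) (ger0_norm w0) ler_pM ?powR_ge0//.
  apply: (ge0_ler_powR (ltW p0)); rewrite ?nnegrE ?addr_ge0//.
  by rewrite (le_trans (ler_normB _ _))// lerD// ger0_norm.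
by rewrite ler_pM2r ?invr_gt0// -expR0 ler_expR oppr_le0.
Qed.

Lemma exp_gradient_norm_ge0 p e : 0 < e -> 0 <= exp_gradient_norm p e.
Proof.
move=> e0; apply: Rintegral_ge0 => x _.
by rewrite mulr_ge0 ?powR_ge0// divr_ge0 ?expR_ge0// ltW// exp_moment0_gt0.
Qed.

(** The weight concentrates where [g] vanishes, and both [g] and its mean are
    powers of [e] there. *)
Lemma exp_gradient_norm_cvg0 (p : R) : 0 < p ->
  exp_gradient_norm p e @[e --> 0^'+] --> (0 : R).
Proof.
move=> p0.
pose up e := 2 `^ p * (`|k e| `^ p + exp_moment g p e / exp_moment g 0 e).
have cup : up e @[e --> 0^'+] --> (0 : R).
  rewrite -[X in _ --> X](mulr0 (2 `^ p)); apply: cvgM; first exact: cvg_cst.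
  rewrite -[X in _ --> X]addr0; apply: cvgD; last exact: ratio_cvg0.
  have := cvg_norm_powR p0 (ratio_cvg0 ltr01).
  by rewrite normr0 (powR0 (lt0r_neq0 p0)); exact.
apply: (@squeeze_cvgr _ _ _ _ (cst 0) up) => //; last exact: cvg_cst.
near=> e; have e0 : 0 < e by []; rewrite exp_gradient_norm_ge0//=.
have Z0 := exp_moment0_gt0 e0.
have i1 := integrable_weight e0; have i2 := integrable_exp (ltW p0) e0.
set c1 := 2 `^ p * `|k e| `^ p / exp_moment g 0 e.
set c2 := 2 `^ p / exp_moment g 0 e.
have i1' := @integrableZl _ (measurableTypeR R) R mu _ m01 c1 _ i1.
have i2' := @integrableZl _ (measurableTypeR R) R mu _ m01 c2 _ i2.
have iD := @integrableD _ (measurableTypeR R) R mu _ m01 _ _ i1' i2'.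
have -> : up e = \int[mu]_(x in `[0, 1]) (c1 * expR (- (g x / e)) +
    c2 * (g x `^ p * expR (- (g x / e)))).
  rewrite RintegralD// !RintegralZl// -exp_moment0 -/(exp_moment g p e).
  by rewrite /up /c1 /c2; field; exact: lt0r_neq0 Z0.
apply: (@le_Rintegral _ (measurableTypeR R) R mu _ _ _ m01 (integrable_gradient p0 e0) iD).
move=> x _; have h := powR_normB_le (ltW p0) (k_ge0 e) (g_ge0 x).
have w0 : 0 <= expR (- (g x / e)) / exp_moment g 0 e.
  by rewrite divr_ge0 ?expR_ge0// ltW.
rewrite (le_trans (ler_wpM2r w0 h))// le_eqVlt; apply/orP; left; apply/eqP.
by rewrite /c1 /c2 (ger0_norm (k_ge0 e)); ring.
Unshelve. all: by end_near. Qed.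

Variables (M0 : R) (du0 : R -> R) (N : set R) (ux gam : R -> R -> R).
Hypotheses (mN : measurable N) (N0 : mu N = 0%E).
Hypothesis gE : forall x : R, 0 <= x <= 1 -> ~ N x -> g x = M0 - du0 x.

Let duE (x : R) : 0 <= x <= 1 -> ~ N x -> du0 x = M0 - g x.
Proof. by move=> x01 Nx; rewrite gE//; ring. Qed.

(** The common factor [exp (t M0)] cancels, which leaves the weight
    [exp (- t g)]. *)
Lemma Lpnorm_zero_parameter (p t : R) : 0 < p -> 0 < t ->
  (forall x, ux (x + 1) t = ux x t) -> repr_zero du0 ux gam ->
  Lpnorm p (ux ^~ t) = (exp_gradient_norm p t^-1 `^ p^-1)%:E.
Proof.
move=> p0 t0 uxP repr.
have e0 : 0 < t^-1 by rewrite invr_gt0.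
set e := t^-1 in e0 *; set Z := exp_moment g 0 e.
have Z0 : 0 < Z by exact: exp_moment0_gt0.
have expE x : 0 <= x <= 1 -> ~ N x -> expR (t * du0 x) = expR (t * M0) * expR (- (g x / e)).
  by move=> x01 Nx; rewrite duE// -expRD /e invrK; congr expR; ring.
set E := \int[mu]_(b in `[0, 1]) expR (t * du0 b).
have EE : E = expR (t * M0) * Z.
  rewrite /Z exp_moment0 -RintegralZl//; last exact: integrable_weight.
  apply: (eq_Rintegral_off_null mN N0) => x /=; rewrite in_itv/=.
  exact: expE.
set D := \int[mu]_(b in `[0, 1]) (du0 b * expR (t * du0 b)).
have DE : D = expR (t * M0) * (M0 * Z - exp_moment g 1 e).
  have i1 := integrable_weight e0; have i2 := integrable_exp ler01 e0.
  have i1' := @integrableZl _ (measurableTypeR R) R mu _ m01 M0 _ i1.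
  have iB := @integrableB _ (measurableTypeR R) R mu _ m01 _ _ i1' i2.
  rewrite /Z exp_moment0 -RintegralZl// -RintegralB// -RintegralZl//.
  apply: (eq_Rintegral_off_null mN N0) => x /=; rewrite in_itv/= => x01 Nx.
  by rewrite expE// duE// powRr1//; ring.
have [B gB] := profile_bounded pg.
have gx0 x : 0 <= g x / e by rewrite divr_ge0// ltW.
rewrite (@Lpnorm_along_characteristics _ p (expR (- (B / e)) / Z) (1 / Z)
  (ux ^~ t) (gam ^~ t) (fun x => expR (- (g x / e)) / Z) (fun x => k e - g x) N) //.
- have := integrable_gradient p0 e0; rewrite -/Z => ig.
  by rewrite /exp_gradient_norm -/Z -/(k e) /Rintegral -poweR_EFin fineK//;
    apply: integrable_fin_num.
- apply: measurable_funM => //.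
  apply: measurableT_comp => //; apply: measurableT_comp => //.
  exact: measurable_funM.
- by rewrite divr_gt0 ?expR_gt0.
- move=> x; rewrite ler_pM2r ?invr_gt0// ler_expR lerN2 ler_pM2r ?invr_gt0//.
  by have /andP[] := gB x.
- by move=> x; rewrite ler_pM2r ?invr_gt0// -expR0 ler_expR oppr_le0.
- move=> a /andP[a0 a1]; have a01 : a \in `[0, 1] by rewrite in_itv/= a0.
  have [-> _] := repr t a (ltW t0) a01; apply: (congr1 (fun z => gam 0 t + z)).
  apply: (eq_Rintegral_off_null mN N0) => x /=; rewrite in_itv/= => /andP[x0 xa] Nx.
  rewrite -/E EE expE ?x0 ?(le_trans xa)//.
  by field; rewrite !gt_eqF ?expR_gt0.
- under eq_Rintegral do rewrite mulrC.
  rewrite RintegralZl//; last exact: integrable_weight.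
  by rewrite -exp_moment0 mulVf// gt_eqF.
- exact: measurable_funB.
- move=> a a01 Na; have a01' : a \in `[0, 1] by rewrite in_itv.
  have [_ ->] := repr t a (ltW t0) a01'; rewrite -/E -/D EE DE duE// /k -/Z.
  by field; rewrite !gt_eqF ?expR_gt0.
Qed.

End zero_parameter.

(** * Limits of the norms *)

Section norm_limits.
Context {R : realType}.
Variables (q C1 M0 lam : R) (peaks : seq R) (u0 du0 : R -> R).
Variables (u ux gam : R -> R -> R).
Hypotheses (q0 : 0 < q) (C10 : C1 < 0).
Hypothesis data : initial_data q C1 M0 peaks u0 du0.
Hypothesis sol : solution lam M0 u0 du0 u ux gam.

Let C0 : 0 < `|C1|. Proof. by rewrite normr_gt0 lt_eqF. Qed.
Let M00 : 0 < M0. Proof. exact: data_max_gt0 data. Qed.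
Let du0_max x : du0 x <= M0. Proof. exact: data_max data x. Qed.

(** The reciprocals of the positive integers cannot all be among finitely many
    peaks. *)
Lemma exists_non_peak : exists2 a : R, a \in `[0, 1] & du0 a != M0.
Proof.
apply: contrapT => h.
pose f (n : nat) : R := n.+1%:R^-1.
have fp n : f n \in peaks.
  have f01 : f n \in `[0, 1].
    by rewrite in_itv/= invr_ge0 ler0n/= invf_le1// ler1n.
  apply/(data_peaksP data); split=> //; apply/eqP; apply: contrapT => nM.
  by apply: h; exists (f n) => //; exact/negP.
have fI : injective f by move=> m n /invr_inj/eqP; rewrite eqr_nat eqSS => /eqP.
have := @uniq_leq_size _ (map f (iota 0 (size peaks).+1)) peaks.
rewrite map_inj_uniq// iota_uniq size_map size_iota ltnn => /(_ isT) hh.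
by apply: notF; apply: hh => x /mapP[n _ ->].
Qed.

Lemma Lpnorm_cvg_zero_parameter (p : R) : 0 < p -> lam = 0 ->
  Lpnorm p (ux ^~ t) @[t --> +oo] --> 0%E.
Proof.
move=> p0 lamE; have [g [N [pg mN N0 gE]]] := borel_profile_exists q0 C10 data.
have nE : \forall t \near (+oo : set_system R), 0 <= exp_gradient_norm g p t^-1 /\
    Lpnorm p (ux ^~ t) = (exp_gradient_norm g p t^-1 `^ p^-1)%:E.
  near=> t; have t0 : 0 < t by near: t; apply: nbhs_pinfty_gt; rewrite num_real.
  split; first by apply: (exp_gradient_norm_ge0 pg); rewrite invr_gt0.
  apply: (Lpnorm_zero_parameter pg mN N0 gE p0 t0 _ (sol_repr_zero sol lamE)) => x.
  have ts : (t%:E < tstar lam M0 du0)%E by rewrite /tstar lamE eqxx ltry.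
  by have [] := sol_periodic sol x (ltW t0) ts.
have cinv : t^-1 @[t --> +oo] --> (0 : R)^'+.
  apply: cvg_at_right_gt; last first.
    by near=> t; rewrite invr_gt0; near: t; apply: nbhs_pinfty_gt; rewrite num_real.
  apply/cvgr0Pnorm_lt => d d0; near=> t.
  have dt : d^-1 < t by near: t; apply: nbhs_pinfty_gt; rewrite num_real.
  have t0 : 0 < t by rewrite (lt_trans _ dt)// invr_gt0.
  by rewrite gtr0_norm ?invr_gt0// -[ltRHS]invrK ltf_pV2 ?posrE ?invr_gt0.
have cN : exp_gradient_norm g p t^-1 @[t --> +oo] --> (0 : R).
  exact: (cvg_comp _ _ cinv (exp_gradient_norm_cvg0 q0 C0 pg p0)).
have := root_cvg p0 nE cN.
by rewrite normr0 powR0 ?invr_eq0 ?lt0r_neq0//; exact.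
Unshelve. all: by end_near. Qed.

Section positive.
Hypothesis lam0 : 0 < lam.

(** All that the limits need from the solution: at each time, its gradient and
    norms are those of the gap [e t], and [e t] tends to [0] at the maximal
    time. *)
Lemma gradient_along_gap : exists (g : R -> R) (e : R -> R),
  [/\ peak_profile q `|C1| peaks g,
      (0 < tstar lam M0 du0)%E /\
        (forall Ts : R, tstar lam M0 du0 = Ts%:E -> e t @[t --> Ts^'-] --> (0 : R)^'+),
      tstar lam M0 du0 = +oo%E -> e t @[t --> +oo] --> (0 : R)^'+,
      (lam <= q / 2 -> tstar lam M0 du0 = +oo%E) /\
        (q / 2 < lam -> lam != q -> exists Ts : R, tstar lam M0 du0 = Ts%:E) &
      forall t, 0 < t -> (t%:E < tstar lam M0 du0)%E ->
        (forall a, a \in `[0, 1] -> ux (gam a t) t = gradient_at g lam (e t) (M0 - du0 a)) /\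
        forall p, 0 < p -> 0 <= gradient_norm g lam p (e t) /\
          Lpnorm p (ux ^~ t) = (gradient_norm g lam p (e t) `^ p^-1)%:E].
Proof.
have [g [N [pg mN N0 gE]]] := borel_profile_exists q0 C10 data.
have tE : tstar lam M0 du0 = tstar lam M0 (fun x => M0 - g x).
  exact: (tstar_off_null _ mN N0 gE).
have [e [e0 uxE gamE efin einf]] :=
  solution_along_gap pg mN N0 gE lam0 M00 du0_max (sol_repr_pos sol lam0).
exists g, e; split; [exact: pg| |exact: einf| |].
- by split; [rewrite tE; exact: (tstar_gt0 pg lam0 M00)|exact: efin].
- rewrite tE; split; first exact: (tstar_infinite pg lam0 M00 q0 C0).
  exact: (tstar_finite pg lam0 M00 q0 C0).
move=> t t0 ts; split; first by move=> a a01; exact: uxE.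
move=> p p0; split; first exact: (gradient_norm_ge0 pg lam0 p0 (e0 t t0 ts)).
apply: (Lpnorm_gradient pg mN N0 gE lam0 p0 (e0 t t0 ts)).
- by move=> x; have [] := sol_periodic sol x (ltW t0) ts.
- by move=> a a01; exact: uxE.
- by move=> a a01; exact: gamE.
Qed.

Lemma global_norm_limit (p : R) : 0 < p -> lam <= q / 2 ->
  (forall g, peak_profile q `|C1| peaks g ->
    exists l : R, (lam < q / 2 -> l = 0) /\
      gradient_norm g lam p e @[e --> 0^'+] --> l) ->
  exists l : R, (lam < q / 2 -> l = 0) /\
    Lpnorm p (ux ^~ t) @[t --> +oo] --> l%:E.
Proof.
move=> p0 lq hl; have [g [e [pg _ einf [tinf _] h]]] := gradient_along_gap.
have tE := tinf lq; have [l [l0 cl]] := hl g pg.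
exists (`|l| `^ p^-1); split.
  by move=> /l0 ->; rewrite normr0 powR0// invr_eq0 lt0r_neq0.
have cN : gradient_norm g lam p (e t) @[t --> +oo] --> l := cvg_comp _ _ (einf tE) cl.
apply: (root_cvg p0 _ cN); near=> t.
have t0 : 0 < t by near: t; apply: nbhs_pinfty_gt; rewrite num_real.
have ts : (t%:E < tstar lam M0 du0)%E by rewrite tE ltry.
by have [_ hp] := h t t0 ts; exact: hp.
Unshelve. all: by end_near. Qed.

Let near_finite (Ts : R) : (0 < Ts%:E)%E ->
  \forall t \near Ts^'-, 0 < t /\ (t%:E < Ts%:E)%E.
Proof.
by rewrite lte_fin => Ts0; near=> t; rewrite lte_fin.
Unshelve. all: by end_near. Qed.

Lemma finite_time_convergence (p : R) : 0 < p -> q / 2 < lam -> lam != q ->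
  (forall g, peak_profile q `|C1| peaks g ->
    exists l : R, gradient_norm g lam p e @[e --> 0^'+] --> l) ->
  exists l : R, finite_time_limit lam M0 du0 p ux l%:E.
Proof.
move=> p0 qlam lamq hl.
have [g [e [pg [ts0 efin] _ [_ tfin] h]]] := gradient_along_gap.
have [Ts tE] := tfin qlam lamq; have [l cl] := hl g pg.
exists (`|l| `^ p^-1), Ts => //.
have cN : gradient_norm g lam p (e t) @[t --> Ts^'-] --> l := cvg_comp _ _ (efin _ tE) cl.
apply: (root_cvg p0 _ cN); rewrite tE in ts0 h.
by apply: filterS (near_finite ts0) => t [t0 ts]; have [_ hp] := h t t0 ts; exact: hp.
Qed.

Lemma finite_time_divergence (p : R) : 0 < p -> q / 2 < lam -> lam != q ->
  (forall g, peak_profile q `|C1| peaks g ->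
    gradient_norm g lam p e @[e --> 0^'+] --> +oo) ->
  finite_time_limit lam M0 du0 p ux +oo%E.
Proof.
move=> p0 qlam lamq hl.
have [g [e [pg [ts0 efin] _ [_ tfin] h]]] := gradient_along_gap.
have [Ts tE] := tfin qlam lamq; have cl := hl g pg.
exists Ts => //.
have cN : gradient_norm g lam p (e t) @[t --> Ts^'-] --> +oo := cvg_comp _ _ (efin _ tE) cl.
apply: (root_cvgy p0 _ cN); rewrite tE in ts0 h.
by apply: filterS (near_finite ts0) => t [t0 ts]; have [_ hp] := h t t0 ts; exact: hp.
Qed.

Lemma gradient_norm_decay (g : R -> R) (p : R) : peak_profile q `|C1| peaks g ->
  0 < p -> lam <= q / 2 ->
  exists l : R, (lam < q / 2 -> l = 0) /\ gradient_norm g lam p e @[e --> 0^'+] --> l.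
Proof.
move=> pg p0 lq; have lamq : lam < q by move: q0; lra.
have [L L0] := gradient_norm_slow q0 C0 pg lam0 lamq p0.
set x := p * (1 - 2 * lam / q) => cL.
have normE e : 0 < e ->
    e `^ x * (e `^ (- x) * gradient_norm g lam p e) = gradient_norm g lam p e.
  by move=> e0; rewrite mulrA -powRD ?(gt_eqF e0) ?implybT// addrN powRr0 mul1r.
have [lamqE|lam_neq] := eqVneq lam (q / 2).
  exists L; split; first by rewrite lamqE ltxx.
  have x0 : x = 0 by rewrite /x lamqE; field; rewrite gt_eqF.
  by move: cL; rewrite x0 oppr0; under eq_fun do rewrite powRr0 mul1r.
exists 0; split=> //.
have x0 : 0 < x.
  rewrite mulr_gt0// subr_gt0 ltr_pdivrMr// mul1r.
  have : lam < q / 2 by rewrite lt_neqAle lam_neq.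
  lra.
have : e `^ x * (e `^ (- x) * gradient_norm g lam p e) @[e --> 0^'+] --> 0 * L.
  by apply: cvgM => //; exact: powR_cvg0.
rewrite mul0r; apply: cvg_trans; apply: near_eq_cvg; near=> e.
by rewrite normE.
Unshelve. all: by end_near. Qed.

Lemma gradient_norm_growth (g : R -> R) (p : R) : peak_profile q `|C1| peaks g ->
  0 < p -> q / 2 < lam -> lam < q ->
  gradient_norm g lam p e @[e --> 0^'+] --> +oo.
Proof.
move=> pg p0 qlam lamq.
have [L L0] := gradient_norm_slow q0 C0 pg lam0 lamq p0.
set x := - (p * (1 - 2 * lam / q)) => cL.
have x0 : 0 < x.
  rewrite /x -mulrN mulr_gt0// oppr_gt0 subr_lt0 ltr_pdivlMr// mul1r; lra.
apply/cvgryPge => A; near=> e; have e0 : 0 < e by [].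
rewrite leNgt; apply/negP => Alt.
have h1 : L / 2 < e `^ x * gradient_norm g lam p e.
  by near: e; apply: cvgr_gt cL _ _; rewrite ltr_pdivrMr// ltr_pMr// ltr1n.
have h2 : e `^ x * `|A| < L / 2.
  near: e.
  have cA : e `^ x * `|A| @[e --> 0^'+] --> 0 * `|A|.
    by apply: cvgM; [exact: powR_cvg0|exact: cvg_cst].
  by rewrite mul0r in cA; apply: cvgr_lt cA _ _; rewrite divr_gt0.
have h3 : e `^ x * gradient_norm g lam p e <= e `^ x * `|A|.
  by rewrite ler_wpM2l ?powR_ge0// (le_trans (ltW Alt))// ler_norm.
by have := lt_le_trans (lt_trans h2 h1) h3; rewrite ltxx.
Unshelve. all: by end_near. Qed.

Lemma gradient_critical_limit : lam = q / 2 ->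
  exists phi : R -> R,
  [/\ forall a : R, a \in `[0, 1] -> ux (gam a t) t @[t --> +oo] --> phi a,
      exists B : R, forall a : R, a \in `[0, 1] -> `|phi a| <= B &
      exists2 a : R, a \in `[0, 1] & phi a != 0].
Proof.
move=> lamE; have [g [e [pg _ einf [tinf _] h]]] := gradient_along_gap.
have lamq : lam < q by rewrite lamE; move: q0; lra.
have tE : tstar lam M0 du0 = +oo%E by apply: tinf; rewrite lamE.
have [K [k [K0 k0 cK]]] := gradient_at_critical q0 C0 pg lam0 lamq lamE.
exists (fun a => K * ((M0 - du0 a == 0)%:R - k)); split.
- move=> a a01; have G0 : 0 <= M0 - du0 a by rewrite subr_ge0.
  have := cvg_comp _ _ (einf tE) (cK _ G0); apply: cvg_trans; apply: near_eq_cvg.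
  near=> t; have t0 : 0 < t by near: t; apply: nbhs_pinfty_gt; rewrite num_real.
  have ts : (t%:E < tstar lam M0 du0)%E by rewrite tE ltry.
  by have [uxE _] := h t t0 ts; rewrite /= uxE.
- exists (K * (1 + k)) => a _; rewrite normrM gtr0_norm// ler_pM2l//.
  rewrite (le_trans (ler_normB _ _))// (gtr0_norm k0) lerD2r.
  by case: (_ == _); rewrite ?normr1// normr0.
have [a a01 aM] := exists_non_peak; exists a => //.
have -> : (M0 - du0 a == 0) = false by rewrite subr_eq0 eq_sym (negbTE aM).
rewrite sub0r mulrN oppr_eq0.
by rewrite mulf_neq0// gt_eqF.
Unshelve. all: by end_near. Qed.

End positive.

End norm_limits.

Theorem theorem3p98 (R : realType) (q C1 M0 : R) (peaks : seq R)
    (u0 du0 : R -> R) (lam : R) (u ux gam : R -> R -> R)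
    (q_gt0 : 0 < q) (C1_lt0 : C1 < 0)
    (data : initial_data q C1 M0 peaks u0 du0)
    (sol : solution lam M0 u0 du0 u ux gam) :
  [/\ (* 1 *)
      [/\ forall p : R, 1 <= p -> 0 <= lam <= q / 2 ->
            exists l : R, Lpnorm p (ux ^~ t) @[t --> +oo] --> l%:E,
          forall p : R, 1 <= p -> 0 < lam < q / 2 ->
            Lpnorm p (ux ^~ t) @[t --> +oo] --> 0%E &
          lam = q / 2 ->
            exists phi : R -> R,
            [/\ forall a : R, a \in `[0, 1] ->
                  ux (gam a t) t @[t --> +oo] --> phi a,
                exists B : R, forall a : R, a \in `[0, 1] -> `|phi a| <= B &
                exists2 a : R, a \in `[0, 1] & phi a != 0]],
      (* 2 *)
      forall p : R, 1 < p ->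
        [\/ q / 2 < lam < q,
            1 < q /\ q < lam |
            3^-1 < q < 2^-1 /\ 2^-1 < lam < q / (1 - q)] ->
        finite_time_limit lam M0 du0 p ux +oo%E,
      (* 3 *)
      forall p : R, 0 < q < 2^-1 -> 1 <= p < 2 -> (2 - p)^-1 < lam ->
        (forall n : nat, (0 < n)%N ->
          [/\ q != n%:R^-1,
              lam != q / (1 - n%:R * q) &
              lam != q / (1 + q * (n%:R - p))]) ->
        exists l : R, finite_time_limit lam M0 du0 p ux l%:E &
      (* 4 *)
      2^-1 < q < 1 ->
        (forall p : R, 1 < p -> q < lam < q / (1 - q) ->
          finite_time_limit lam M0 du0 p ux +oo%E) /\
        (forall p : R, 1 <= p < q^-1 -> q / (1 - p * q) < lam ->
          exists l : R, finite_time_limit lam M0 du0 p ux l%:E)].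
Proof.
have near_half (lt_q : q < lam) : q / 2 < lam by move: q_gt0; lra.
have blowup (p : R) : 1 < p -> q < lam -> lam * (1 - q) < q ->
    finite_time_limit lam M0 du0 p ux +oo%E.
  move=> p1 qlam lamq; have lam0 : 0 < lam := lt_trans q_gt0 qlam.
  have p0 : 0 < p := lt_trans ltr01 p1.
  apply: (finite_time_divergence q_gt0 C1_lt0 data sol lam0 p0 (near_half qlam)).
    by rewrite gt_eqF.
  move=> g pg; apply: (gradient_norm_blowup q_gt0 _ pg lam0 p1).
  - by rewrite normr_gt0 lt_eqF.
  - by rewrite mulrC ltr_pdivrMr// mul1r.
  rewrite mulrDl mul1r mulrC -ltrBlDl ltr_pdivlMr//; lra.
have converge (p : R) : 1 <= p -> q < lam -> q < lam * (1 - p * q) ->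
    exists l : R, finite_time_limit lam M0 du0 p ux l%:E.
  move=> p1 qlam lamq; have lam0 : 0 < lam := lt_trans q_gt0 qlam.
  have p0 : 0 < p := lt_le_trans ltr01 p1.
  apply: (finite_time_convergence q_gt0 C1_lt0 data sol lam0 p0 (near_half qlam)).
    by rewrite gt_eqF.
  move=> g pg; apply: (gradient_norm_subcritical q_gt0 _ pg lam0 p1).
    by rewrite normr_gt0 lt_eqF.
  rewrite mulrDl [lam^-1 * q]mulrC -ltrBrDl ltr_pdivrMr//; lra.
have global (p : R) : 1 <= p -> 0 <= lam <= q / 2 ->
    exists l : R, (lam < q / 2 -> l = 0) /\ Lpnorm p (ux ^~ t) @[t --> +oo] --> l%:E.
  move=> p1 /andP[]; have p0 : 0 < p := lt_le_trans ltr01 p1.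
  rewrite le_eqVlt => /predU1P[lam0 _|lam0 lamq].
    exists 0; split => //.
    exact: (Lpnorm_cvg_zero_parameter q_gt0 C1_lt0 data sol p0 (esym lam0)).
  apply: (global_norm_limit q_gt0 C1_lt0 data sol lam0 p0 lamq) => g pg.
  exact: (gradient_norm_decay q_gt0 C1_lt0 lam0 pg p0 lamq).
split.
- split.
  + by move=> p p1 /(global p p1) [l [_ cl]]; exists l.
  + move=> p p1 /andP[lam0 lamq].
    have [|l [lE cl]] := global p p1; first by rewrite !ltW.
    by rewrite (lE lamq) in cl.
  + move=> lamE; have lam0 : 0 < lam by rewrite lamE divr_gt0.
    exact: (gradient_critical_limit q_gt0 C1_lt0 data sol lam0 lamE).
- move=> p p1 [/andP[qlam lamq]|[q1 qlam]|[/andP[q3 q2] /andP[lam2 lamq]]].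
  + have lam0 : 0 < lam by move: q_gt0; lra.
    have p0 : 0 < p := lt_trans ltr01 p1.
    apply: (finite_time_divergence q_gt0 C1_lt0 data sol lam0 p0 qlam).
      by rewrite lt_eqF.
    by move=> g pg; exact: (gradient_norm_growth q_gt0 C1_lt0 lam0 pg p0 qlam lamq).
  + apply: blowup => //; have : 0 < lam * (q - 1).
      by rewrite mulr_gt0 ?subr_gt0//; lra.
    by move: q_gt0; lra.
  + apply: blowup => //; first exact: lt_trans lam2.
    by rewrite -ltr_pdivlMr//; lra.
- move=> p /andP[_ q2] /andP[p1 p2] lamp _.
  have p20 : 0 < 2 - p by lra.
  have lam1 : 1 < lam * (2 - p) by rewrite -ltr_pdivrMr// mul1r.
  have lam_gt1 : 1 < lam.
    apply: (le_lt_trans _ lamp); rewrite -[leLHS]invr1 lef_pV2 ?posrE//; lra.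
  apply: converge => //; first by lra.
  have h : q * 1 < q * (lam * (2 - p)) by rewrite ltr_pM2l.
  have h2 : 0 < lam * (1 - 2 * q) by rewrite mulr_gt0//; lra.
  lra.
- move=> /andP[q2 q1]; split.
    move=> p p1 /andP[qlam lamq]; apply: blowup => //.
    by rewrite -ltr_pdivlMr//; lra.
  move=> p /andP[p1 pq] lamq.
  have pq1 : 0 < 1 - p * q by rewrite subr_gt0 -ltr_pdivlMr// mul1r.
  have h : q < lam * (1 - p * q) by rewrite -ltr_pdivrMr.
  apply: converge => //; apply: le_lt_trans lamq.
  rewrite ler_pdivlMr// ler_piMr ?(ltW q_gt0)//.
  by rewrite gerBl mulr_ge0//; lra.
Qed.
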